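(* Let $d\ge1$, $0<p\le1/d$, $\alpha=dp/2$, $\gamma=(1-\alpha)/\alpha$, $0<\rho_*<\rho_1<\rho_0$, $R>0$, let $\mu>2\gamma$ be an integer, and let $\kappa$ satisfy $1-\alpha<\kappa<\alpha(\mu+1)-1$. Let $0<\varepsilon\le\varepsilon_0$ with $\varepsilon_0\in(0,1]$ sufficiently small depending on $(d,p,\rho_*,\rho_1,\rho_0,R,\mu,\kappa)$, let $W=e^\Psi$ be an admissible final profile of size $\varepsilon$, and let $C_+\in\mathcal{A}^6_{\rho_0}$ be real-valued with $\|C_+\|_{\mathcal{A}^6_{\rho_0}}\le\varepsilon$. Then there exist polynomials in $r$, $\Omega_q(r,y)=\sum_{j=0}^{J^\Omega_q}\Omega_{q,j}(y)r^j$ and $\Sigma_q(r,y)=\sum_{j=0}^{J^S_q}\Sigma_{q,j}(y)r^j$, $q\in E_{\gamma,\mu}$, depending on $(\Psi,C_+)$, such that the finite Fuchsian profile $$L^{(\mu)}=\Psi+\Omega^{(\mu)},\qquad S^{(\mu)}=\tfrac1{1-\alpha}e^{p\operatorname{Re}\Psi}+C_+\tau^\gamma+\Sigma^{(\mu)},$$ $$\Omega^{(\mu)}(\tau,y)=\sum_{q\in E_{\gamma,\mu}}\tau^q\Omega_q(\log\tau,y),\qquad\Sigma^{(\mu)}(\tau,y)=\sum_{q\in E_{\gamma,\mu}}\tau^q\Sigma_q(\log\tau,y),$$ satisfies the following: there exist $M_\mu,N_\mu\in\mathbb{N}$ such that for $0<\tau\le1$ $$\|\Omega^{(\mu)}(\tau)\|_{\mathcal{A}^6_{\rho_1}}+\|\Sigma^{(\mu)}(\tau)\|_{\mathcal{A}^6_{\rho_1}}\lesssim_{\mu,R}\tau(1+|\log\tau|)^{M_\mu},$$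 $$\|\mathcal{R}_S(L^{(\mu)},S^{(\mu)})(\tau)\|_{\mathcal{A}^8_{\rho_1}}+\|\mathcal{R}_L(L^{(\mu)},S^{(\mu)})(\tau)\|_{\mathcal{A}^8_{\rho_1}}\lesssim_{\mu,R}\tau^\mu(1+|\log\tau|)^{N_\mu}.$$ Moreover, $S^{(\mu)}$ is real-valued.
   Context: $\mathbb{N}=\{0,1,2,\dots\}$, $E_{\gamma,\mu}=\{\ell_1+\ell_2\gamma:\ell_1,\ell_2\in\mathbb{N},\ \ell_1+\ell_2\ge1\}\cap(0,\mu)$. $\hat f(\xi)=(2\pi)^{-d/2}\int e^{-ix\cdot\xi}f(x)\,dx$; $\langle\xi\rangle=(1+|\xi|^2)^{1/2}$. For $\rho\ge0,\sigma\in\mathbb{R}$, $\mathcal{A}^\sigma_\rho$ is the space of tempered distributions on $\mathbb{R}^d$ with $\|f\|_{\mathcal{A}^\sigma_\rho}:=\int e^{\rho\langle\xi\rangle}\langle\xi\rangle^\sigma|\hat f(\xi)|\,d\xi<\infty$ (componentwise for vector fields). Admissible final profile of size $\varepsilon\in(0,1]$: $W=e^\Psi$ with $\Psi\in C^\infty(\mathbb{R}^d)$ complex-valued, $\|\nabla\Psi\|_{\mathcal{A}^6_{\rho_0}}\le R$ and $\|e^\Psi\|_{L^2}+\|e^\Psi\|_{\mathcal{A}^6_{\rho_0}}+\|e^{p\operatorname{Re}\Psi}\|_{\mathcal{A}^6_{\rho_0}}\le\varepsilon$. Residuals (dot products bilinear, no conjugation; spatial derivatives in $y\in\mathbb{R}^d$):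 $$\mathcal{R}_S(L,S)=\alpha\tau\partial_\tau S-(1-\alpha)S+\tfrac\tau2\nabla S\cdot\nabla S+e^{p\operatorname{Re}L},$$ $$\mathcal{R}_L(L,S)=\alpha\tau\partial_\tau L+\tau\nabla S\cdot\nabla L+\tfrac\tau2\Delta S+\tfrac i2\tau^{\gamma+1}(\Delta L+\nabla L\cdot\nabla L).$$ Constants in $\lesssim_{\mu,R}$ may also depend on $d,p,\rho_*,\rho_1,\rho_0$. *)

(* Defs.v *)
From HB Require Import structures.
From mathcomp Require Import all_boot all_order all_algebra.
From mathcomp Require Import all_classical all_reals all_analysis.
From mathcomp Require Import complex.
Set Implicit Arguments.
Unset Strict Implicit.
Unset Printing Implicit Defensive.
Import Order.TTheory GRing.Theory Num.Theory.
Import numFieldNormedType.Exports.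
Local Open Scope classical_set_scope.
Local Open Scope ring_scope.

(* R^d is 'rV[R]_d, with the sigma-algebra generated by the coordinates
   (the Borel sigma-algebra). *)
Section measurable_rV.
Context (R : realType) (d : nat).

Definition rV_coord (i : 'I_d) : 'rV[R]_d -> measurableTypeR R :=
  fun x => x ord0 i.

Let rV_set0 : g_sigma_preimage rV_coord set0.
Proof. exact: sigma_algebra0. Qed.

Let rV_setC A : g_sigma_preimage rV_coord A -> g_sigma_preimage rV_coord (~` A).
Proof. exact: sigma_algebraC. Qed.

Let rV_bigcup (F : _^nat) : (forall i, g_sigma_preimage rV_coord (F i)) ->
  g_sigma_preimage rV_coord (\bigcup_i (F i)).
Proof. exact: sigma_algebra_bigcup. Qed.

HB.instance Definition _ := @isMeasurable.Build
  (measure_tuple_display default_measure_display) 'rV[R]_d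
  (g_sigma_preimage rV_coord) rV_set0 rV_setC rV_bigcup.

Lemma measurable_rV_coord (i : 'I_d) : measurable_fun setT (rV_coord i).
Proof.
move=> _ Y mY; rewrite setTI; apply: sub_sigma_algebra => /=.
rewrite -bigcup_seq/=; exists i => /=; first by rewrite mem_index_enum.
by exists Y => //; rewrite setTI.
Qed.

Lemma measurable_fun_rV d' (T : measurableType d') (f : T -> 'rV[R]_d) :
  (forall i, measurable_fun setT (rV_coord i \o f)) -> measurable_fun setT f.
Proof.
move=> mf _ A mA.
have: preimage_set_system setT f (g_sigma_preimage rV_coord) (setT `&` f @^-1` A).
  by exists A.
rewrite -g_sigma_preimage_comp; apply: smallest_sub.
  exact: sigma_algebra_measurable.
elim/big_ind : _ => //= [X Y sX sY|i _]; first by rewrite subUset.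
by move=> _ [B mB <-]; exact: mf.
Qed.

End measurable_rV.

Section lebesgue_rV.
Context (R : realType).

Definition rV_cons d (xv : measurableTypeR R * 'rV[R]_d) : 'rV[R]_d.+1 :=
  \row_i oapp (xv.2 ord0) xv.1 (unlift ord0 i).

Definition rV_uncons d (v : 'rV[R]_d.+1) : measurableTypeR R * 'rV[R]_d :=
  (v ord0 ord0, \row_i v ord0 (lift ord0 i)).

Lemma rV_consK d : cancel (@rV_cons d) (@rV_uncons d).
Proof.
move=> [x v]; rewrite /rV_uncons /rV_cons mxE unlift_none/=; congr (_, _).
by apply/rowP => i; rewrite !mxE liftK.
Qed.

Lemma measurable_rV_cons d : measurable_fun setT (@rV_cons d).
Proof.
apply: measurable_fun_rV => i.
have -> : rV_coord i \o @rV_cons d =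
    (fun xv => oapp (xv.2 ord0) xv.1 (unlift ord0 i)).
  by apply/funext => xv; rewrite /= /rV_coord mxE.
case: (unlift ord0 i) => [j|] /=; last exact: measurable_fst.
exact: (measurableT_comp (measurable_rV_coord j) measurable_snd).
Qed.

Lemma measurable_rV_uncons d : measurable_fun setT (@rV_uncons d).
Proof.
apply/measurable_fun_pairP; split; first exact: (measurable_rV_coord ord0).
apply: measurable_fun_rV => i.
rewrite (_ : _ \o _ = rV_coord (lift ord0 i)); first exact: measurable_rV_coord.
by apply/funext => v; rewrite /= /rV_coord mxE.
Qed.

Section step.
Context d (m : {sigma_finite_measure set 'rV[R]_d -> \bar R}).

Definition lebesgue_rV_step : set 'rV[R]_d.+1 -> \bar R :=
  pushforward (lebesgue_measure \x m)%E (@rV_cons d).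

Let step0 : lebesgue_rV_step set0 = 0%E.
Proof. by rewrite /lebesgue_rV_step /pushforward preimage_set0 measure0. Qed.

Let step_ge0 A : (0 <= lebesgue_rV_step A)%E.
Proof. by rewrite /lebesgue_rV_step /pushforward; exact: measure_ge0. Qed.

Let step_sigma_additive : semi_sigma_additive lebesgue_rV_step.
Proof.
have mc A : measurable A -> measurable (@rV_cons d @^-1` A).
  by move=> mA; rewrite -[X in measurable X]setTI; exact: measurable_rV_cons.
move=> F mF tF mUF; rewrite /lebesgue_rV_step /pushforward preimage_bigcup.
apply: measure_semi_sigma_additive.
- by move=> n; exact: mc.
- apply/trivIsetP => /= i j _ _ ij; rewrite -preimage_setI.
  by move/trivIsetP : tF => /(_ _ _ _ _ ij) ->//; rewrite preimage_set0.
- by rewrite -preimage_bigcup; exact: mc.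
Qed.

HB.instance Definition _ := isMeasure.Build _ _ _
  lebesgue_rV_step step0 step_ge0 step_sigma_additive.

Let step_sigma_finite : sigma_finite setT lebesgue_rV_step.
Proof.
have /sigma_finiteP[F [TF ndF Foo]] := sigma_finiteT (@lebesgue_measure R).
have /sigma_finiteP[G [TG ndG Goo]] := sigma_finiteT m.
exists (fun n => @rV_uncons d @^-1` (F n `*` G n)).
  rewrite -preimage_bigcup (_ : \bigcup_i _ = setT) ?preimage_setT//.
  rewrite -setXTT TF TG predeqE => -[x y]; split.
    by move=> [n _ []/= ? ?]; split; exists n.
  move=> [/= [n _ Fnx] [k _ Gky]]; exists (maxn n k) => //; split.
  - by move: x Fnx; exact/subsetPset/ndF/leq_maxl.
  - by move: y Gky; exact/subsetPset/ndG/leq_maxr.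
move=> k; have [mF Fk] := Foo k; have [mG Gk] := Goo k; split.
  rewrite -[X in measurable X]setTI; apply: measurable_rV_uncons => //.
  exact: measurableX.
rewrite /lebesgue_rV_step /pushforward -comp_preimage.
rewrite (_ : _ \o _ = id); last by apply/funext => z /=; rewrite rV_consK.
by rewrite preimage_id product_measure1E// lte_mul_pinfty// ge0_fin_numE.
Qed.

HB.instance Definition _ := Measure_isSigmaFinite.Build _ _ _
  lebesgue_rV_step step_sigma_finite.

End step.

(* Lebesgue measure on R^d: a point mass for d = 0, and the product of the
   one-dimensional Lebesgue measure with lebesgue_rV d for d.+1. *)
Fixpoint lebesgue_rV d : {sigma_finite_measure set 'rV[R]_d -> \bar R} :=
  match d with
  | 0 => dirac (0 : 'rV[R]_0)
  | d'.+1 => lebesgue_rV_step (lebesgue_rV d')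
  end.

End lebesgue_rV.

Section complex_functions.
Context (R : realType).
Local Open Scope complex_scope.

(* The modulus |z| as an element of R; the norm of R[i] is R[i]-valued. *)
Definition cabs (z : R[i]) : R := ComplexField.Normc.normc z.

Definition cexp (z : R[i]) : R[i] :=
  (expR (complex.Re z))%:C * (cos (complex.Im z) +i* sin (complex.Im z)).

(* Analysis of R[i]-valued functions is done componentwise. *)
Definition cderive (V : normedModType R) (v : V) (f : V -> R[i]) (x : V) : R[i] :=
  'D_v (fun y => complex.Re (f y)) x +i* 'D_v (fun y => complex.Im (f y)) x.

Definition cderivable (V : normedModType R) (v : V) (f : V -> R[i]) (x : V) :=
  derivable (fun y => complex.Re (f y)) x v /\
  derivable (fun y => complex.Im (f y)) x v.

Definition ccontinuous (V : topologicalType) (f : V -> R[i]) :=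
  continuous (fun y => complex.Re (f y)) /\
  continuous (fun y => complex.Im (f y)).

Context (d : nat).
Local Notation mu := (lebesgue_rV R d).

Definition cmeasurable (f : 'rV[R]_d -> R[i]) :=
  measurable_fun setT (fun x => complex.Re (f x)) /\
  measurable_fun setT (fun x => complex.Im (f x)).

Definition cintegrable (f : 'rV[R]_d -> R[i]) :=
  mu.-integrable setT (fun x => (complex.Re (f x))%:E) /\
  mu.-integrable setT (fun x => (complex.Im (f x))%:E).

Definition cintegral (f : 'rV[R]_d -> R[i]) : R[i] :=
  (\int[mu]_x complex.Re (f x)) +i* (\int[mu]_x complex.Im (f x)).

Definition partial (i : 'I_d) : ('rV[R]_d -> R[i]) -> 'rV[R]_d -> R[i] :=
  cderive (delta_mx ord0 i).

(* partials [:: i1; ...; in] f = d_{i1} (... (d_{in} f)). *)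
Definition partials (s : seq 'I_d) (f : 'rV[R]_d -> R[i]) : 'rV[R]_d -> R[i] :=
  foldr partial f s.

(* C^oo: all iterated partial derivatives exist and are continuous. *)
Definition csmooth (f : 'rV[R]_d -> R[i]) := forall s : seq 'I_d,
  ccontinuous (partials s f) /\
  forall (i : 'I_d) x, cderivable (delta_mx ord0 i) (partials s f) x.

Definition dotp (x y : 'rV[R]_d) : R := \sum_(i < d) x ord0 i * y ord0 i.

(* The euclidean norm occurs here; the norm of 'rV[R]_d is the sup norm. *)
Definition japanese (xi : 'rV[R]_d) : R := Num.sqrt (1 + dotp xi xi).

Definition schwartz (phi : 'rV[R]_d -> R[i]) := csmooth phi /\
  forall (k : nat) (s : seq 'I_d),
    exists B : R, forall x, japanese x ^+ k * cabs (partials s phi x) <= B.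

Definition fourier (phi : 'rV[R]_d -> R[i]) (xi : 'rV[R]_d) : R[i] :=
  ((2 * pi) `^ (- (d%:R / 2)))%:C *
  cintegral (fun x => cexp (0 -i* dotp x xi) * phi x).

(* A distribution is given by its values on Schwartz functions; its values on
   other functions are irrelevant.  Continuity is for the seminorms
   max_{|s| <= k} sup_x <x>^k |d_s phi x|. *)
Definition tempered (T : ('rV[R]_d -> R[i]) -> R[i]) :=
  (forall (a : R[i]) phi psi, schwartz phi -> schwartz psi ->
     T (fun x => a * phi x + psi x) = a * T phi + T psi) /\
  exists (C : R) (k : nat), forall phi (B : R), schwartz phi ->
    (forall s : seq 'I_d, (size s <= k)%N ->
       forall x, japanese x ^+ k * cabs (partials s phi x) <= B) ->
    cabs (T phi) <= C * B.

Definition pairing (f phi : 'rV[R]_d -> R[i]) : R[i] :=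
  cintegral (fun x => f x * phi x).

(* T is the regular distribution phi |-> \int f phi. *)
Definition regular_distribution (f : 'rV[R]_d -> R[i])
    (T : ('rV[R]_d -> R[i]) -> R[i]) :=
  forall phi, schwartz phi ->
    cintegrable (fun x => f x * phi x) /\ T phi = pairing f phi.

(* The Fourier transform of T, defined by duality, is the function g. *)
Definition is_fourier (T : ('rV[R]_d -> R[i]) -> R[i]) (g : 'rV[R]_d -> R[i]) :=
  cmeasurable g /\ regular_distribution g (fun phi => T (fourier phi)).

(* The norm of A^sigma_rho, with value +oo outside of the space: the density g
   is unique up to a null set, so the infimum is over at most one value. *)
Definition A_norm_dist (rho sigma : R) (T : ('rV[R]_d -> R[i]) -> R[i]) : \bar R :=
  ereal_inf [set (\int[mu]_xi
      (expR (rho * japanese xi) * japanese xi `^ sigma * cabs (g xi))%:E)%E |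
    g in [set g | tempered T /\ is_fourier T g]].

(* The same for a function, identified with the distribution it defines. *)
Definition A_norm (rho sigma : R) (f : 'rV[R]_d -> R[i]) : \bar R :=
  ereal_inf [set A_norm_dist rho sigma T | T in regular_distribution f].

Definition L2_norm (f : 'rV[R]_d -> R[i]) : \bar R :=
  Lnorm mu 2%:E (fun x => (cabs (f x))%:E).

(* The norm of a vector field is the sum of the norms of its components. *)
Definition admissible (p rho0 Rb eps : R) (Psi : 'rV[R]_d -> R[i]) :=
  [/\ csmooth Psi,
      (\sum_(i < d) A_norm rho0 6 (partial i Psi) <= Rb%:E)%E &
      (L2_norm (fun y => cexp (Psi y)) + A_norm rho0 6 (fun y => cexp (Psi y)) +
       A_norm rho0 6 (fun y => (expR (p * complex.Re (Psi y)))%:C)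
         <= eps%:E)%E].

Definition laplacian (f : 'rV[R]_d -> R[i]) (y : 'rV[R]_d) : R[i] :=
  \sum_(i < d) partial i (partial i f) y.

(* grad f . grad g, bilinear. *)
Definition grad_dot (f g : 'rV[R]_d -> R[i]) (y : 'rV[R]_d) : R[i] :=
  \sum_(i < d) partial i f y * partial i g y.

Definition dtau (f : R -> 'rV[R]_d -> R[i]) (tau : R) (y : 'rV[R]_d) : R[i] :=
  cderive (1 : R) (fun t : R => f t y) tau.

Definition alpha_exp (p : R) : R := d%:R * p / 2.
Definition gamma_exp (p : R) : R := (1 - alpha_exp p) / alpha_exp p.

Definition residual_S (p : R) (L S : R -> 'rV[R]_d -> R[i])
    (tau : R) (y : 'rV[R]_d) : R[i] :=
  (alpha_exp p * tau)%:C * dtau S tau y - (1 - alpha_exp p)%:C * S tau y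
  + (tau / 2)%:C * grad_dot (S tau) (S tau) y
  + (expR (p * complex.Re (L tau y)))%:C.

Definition residual_L (p : R) (L S : R -> 'rV[R]_d -> R[i])
    (tau : R) (y : 'rV[R]_d) : R[i] :=
  (alpha_exp p * tau)%:C * dtau L tau y + tau%:C * grad_dot (S tau) (L tau) y
  + (tau / 2)%:C * laplacian (S tau) y
  + (0 +i* (tau `^ (gamma_exp p + 1) / 2)) *
    (laplacian (L tau) y + grad_dot (L tau) (L tau) y).

Definition exponents (gamma : R) (mu : nat) : set R :=
  [set q | (exists l1 l2 : nat, (1 <= l1 + l2)%N /\ q = l1%:R + l2%:R * gamma)
           /\ 0 < q < mu%:R].

(* sum_(q in E) tau^q sum_(j <= J q) c q j y (log tau)^j, with E finite. *)
Definition log_power_sum (E : set R) (J : R -> nat)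
    (c : R -> nat -> 'rV[R]_d -> R[i]) (tau : R) (y : 'rV[R]_d) : R[i] :=
  \sum_(q \in E) (tau `^ q)%:C * \sum_(j < (J q).+1) c q j y * (ln tau ^+ j)%:C.

Definition profile_L (Psi : 'rV[R]_d -> R[i]) (Omega : R -> 'rV[R]_d -> R[i])
    (tau : R) (y : 'rV[R]_d) : R[i] := Psi y + Omega tau y.

Definition profile_S (p : R) (Psi : 'rV[R]_d -> R[i]) (Cplus : 'rV[R]_d -> R)
    (Sigma : R -> 'rV[R]_d -> R[i]) (tau : R) (y : 'rV[R]_d) : R[i] :=
  ((1 - alpha_exp p)^-1 * expR (p * complex.Re (Psi y)))%:C
  + (Cplus y * tau `^ gamma_exp p)%:C + Sigma tau y.

End complex_functions.
Arguments alpha_exp {R} d p.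
Arguments gamma_exp {R} d p.

(* Main.v *)
Require Import Defs.
From HB Require Import structures.
From mathcomp Require Import all_boot all_order all_algebra.
From mathcomp Require Import all_classical all_reals all_analysis measurable_realfun.
From mathcomp Require Import complex ring lra.
Set Implicit Arguments.
Unset Strict Implicit.
Unset Printing Implicit Defensive.
Import Order.TTheory GRing.Theory Num.Theory.
Import numFieldNormedType.Exports.
Local Open Scope classical_set_scope.
Local Open Scope ring_scope.
Local Open Scope complex_scope.

(** Why the theorem holds.

    The unknowns [L] and [S] are sought as finite sums of terms [tau ^ q * (ln
    tau) ^ j * c(y)]. On such sums the operator [alpha * tau * d/dtau - b],
    which is the linear part of both residuals (with [b = 0] for [L] and [b =
    1 - alpha] for [S]), acts on the terms with a given [q] as [alpha * q - b]
    plus a part lowering [j]. It is therefore onto, at the price of one more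
    logarithm when [alpha * q = b] ([solve_euler]). All other terms of the
    residuals carry a factor [tau] or [tau ^ (gamma + 1)], or else are the
    exponential that couples [S] to [L]. Hence if both residuals start at
    count [k], where a term [l1 + l2 * gamma] has count [l1], then correcting
    [L] by the solution for the part of its residual below [tau ^ mu] raises
    the count of that residual and keeps that of the other; correcting [S]
    afterwards raises the second ([improve_order]). The residuals of the
    leading profile start at count [1], because [alpha * gamma = 1 - alpha];
    after finitely many steps both residuals have order [tau ^ mu] up to
    logarithms ([profile_expansion]).

    Coefficients are built from the gradient of [Psi], the density [exp (p Re
    Psi)] and the potential by sums, products, derivatives and real parts, and
    the estimates need that these operations preserve finiteness of the norms.
    At a fixed radius derivatives are unbounded, but the theorem leaves room
    between [rho1] and [rho0], and a loss of radius pays for all powers of the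
    Japanese bracket. So one works with the class [wiener] of transforms of
    densities having all weighted norms finite at radius [rho1]: it is an
    algebra with submultiplicative constants ([wienerM]), is stable under
    derivatives ([wiener_partial]) and real parts ([wiener_Re]), and the
    exponential series converges in it ([wiener_exp_rem]).

    The norms of the theorem are defined by duality with Schwartz functions,
    so they have to be compared with this class. The transform of a density
    [g] has, up to a constant, at most the norm of [g] ([wiener_A_norm]): the
    distribution is the limit of pairings damped by Gaussians, which by the
    multiplication formula are pairings of [g] with an approximate identity.
    Conversely a continuous function of finite norm is the transform of the
    density of its distribution ([A_norm_wiener]), as one sees by testing
    against modulated Gaussians, whose transforms are translated heat kernels.

    The constants are uniform since coefficients are treated as functionals of
    the data ([tame], [tauO]); in particular the lists of exponents and the
    powers of the logarithm depend on [d], [p] and [mu] only. *)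

(** * The modulus and the unit circle in the complex plane *)

Section complex_modulus.
Context {R : realType}.
Implicit Types (z w : R[i]) (x s t : R).

Lemma cReD z w : complex.Re (z + w) = complex.Re z + complex.Re w.
Proof. by case: z w => [? ?] []. Qed.
Lemma cImD z w : complex.Im (z + w) = complex.Im z + complex.Im w.
Proof. by case: z w => [? ?] []. Qed.
Lemma cReN z : complex.Re (- z) = - complex.Re z.
Proof. by case: z. Qed.
Lemma cImN z : complex.Im (- z) = - complex.Im z.
Proof. by case: z. Qed.
Lemma cReM z w : complex.Re (z * w) =
  complex.Re z * complex.Re w - complex.Im z * complex.Im w.
Proof. by case: z w => [? ?] []. Qed.
Lemma cImM z w : complex.Im (z * w) =
  complex.Re z * complex.Im w + complex.Im z * complex.Re w.
Proof. by case: z w => [? ?] []. Qed.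
Lemma cRe_conj z : complex.Re (z^*)%C = complex.Re z. Proof. by case: z. Qed.
Lemma cIm_conj z : complex.Im (z^*)%C = - complex.Im z. Proof. by case: z. Qed.

Lemma complex_ext z w : complex.Re z = complex.Re w ->
  complex.Im z = complex.Im w -> z = w.
Proof. by case: z w => [? ?] [? ?] /= -> ->. Qed.

Lemma realCD x t : (x + t)%:C = x%:C + t%:C :> R[i].
Proof. exact: rmorphD. Qed.
Lemma realCM x t : (x * t)%:C = x%:C * t%:C :> R[i].
Proof. exact: rmorphM. Qed.
Lemma realCN x : (- x)%:C = - x%:C :> R[i].
Proof. exact: rmorphN. Qed.
Lemma realCB x t : (x - t)%:C = x%:C - t%:C :> R[i].
Proof. exact: rmorphB. Qed.
Lemma realCX x n : (x ^+ n)%:C = x%:C ^+ n :> R[i].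
Proof. exact: rmorphXn. Qed.
Lemma realC_sum I (r : seq I) (P : pred I) (F : I -> R) :
  (\sum_(i <- r | P i) F i)%:C = \sum_(i <- r | P i) (F i)%:C :> R[i].
Proof. exact: rmorph_sum. Qed.

Lemma cRe_sum I (r : seq I) (P : pred I) (F : I -> R[i]) :
  complex.Re (\sum_(i <- r | P i) F i) = \sum_(i <- r | P i) complex.Re (F i).
Proof. by elim/big_rec2 : _ => //= i y1 y2 _ <-; rewrite cReD. Qed.
Lemma cIm_sum I (r : seq I) (P : pred I) (F : I -> R[i]) :
  complex.Im (\sum_(i <- r | P i) F i) = \sum_(i <- r | P i) complex.Im (F i).
Proof. by elim/big_rec2 : _ => //= i y1 y2 _ <-; rewrite cImD. Qed.

Lemma cabsE z : cabs z = Num.sqrt (complex.Re z ^+ 2 + complex.Im z ^+ 2).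
Proof. by case: z. Qed.

Lemma cabs_ge0 z : 0 <= cabs z. Proof. by rewrite cabsE sqrtr_ge0. Qed.

Lemma cabs0 : cabs (0 : R[i]) = 0.
Proof. by rewrite cabsE /= expr0n /= addr0 sqrtr0. Qed.

Lemma cabsM z w : cabs (z * w) = cabs z * cabs w.
Proof. exact: ComplexField.Normc.normcM. Qed.

Lemma cabsD z w : cabs (z + w) <= cabs z + cabs w.
Proof. exact: le_normcD. Qed.

Lemma cabsN z : cabs (- z) = cabs z.
Proof. exact: normcN. Qed.

Lemma cabsB z w : cabs (z - w) <= cabs z + cabs w.
Proof. by rewrite -(cabsN w) cabsD. Qed.

Lemma cabs_real x : cabs (x%:C) = `|x|.
Proof. by rewrite cabsE /= expr0n /= addr0 sqrtr_sqr. Qed.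

Lemma cabs_sqr z : cabs z ^+ 2 = complex.Re z ^+ 2 + complex.Im z ^+ 2.
Proof. by rewrite cabsE sqr_sqrtr// addr_ge0// sqr_ge0. Qed.

Lemma cabs_conj z : cabs (z^*)%C = cabs z.
Proof. by rewrite !cabsE cRe_conj cIm_conj sqrrN. Qed.

Lemma normr_cRe z : `|complex.Re z| <= cabs z.
Proof. by rewrite cabsE -sqrtr_sqr ler_wsqrtr// lerDl sqr_ge0. Qed.

Lemma normr_cIm z : `|complex.Im z| <= cabs z.
Proof. by rewrite cabsE -sqrtr_sqr ler_wsqrtr// lerDr sqr_ge0. Qed.

Lemma cabs_le_norm z : cabs z <= `|complex.Re z| + `|complex.Im z|.
Proof.
rewrite -(ger0_norm (cabs_ge0 z)) -(@ger0_norm _ (`|_| + _)) ?addr_ge0//.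
rewrite -ler_sqr ?nnegrE// !real_normK ?num_real// cabs_sqr sqrrD.
rewrite !real_normK ?num_real// -addrA lerD2l lerDr.
by rewrite mulrn_wge0// mulr_ge0.
Qed.

Lemma cabs_sum I (r : seq I) (P : pred I) (F : I -> R[i]) :
  cabs (\sum_(i <- r | P i) F i) <= \sum_(i <- r | P i) cabs (F i).
Proof.
elim/big_ind2 : _ => //; first by rewrite cabs0.
by move=> x1 x2 y1 y2 h1 h2; rewrite (le_trans (cabsD _ _))// lerD.
Qed.

Lemma conj_mulr z : (z^*)%C * z = (cabs z ^+ 2)%:C.
Proof.
by rewrite cabs_sqr; apply: complex_ext;
  rewrite ?cReM ?cImM cRe_conj cIm_conj /=; ring.
Qed.

Lemma conj_cM z w : ((z * w)^*)%C = (z^*)%C * (w^*)%C :> R[i].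
Proof. exact: rmorphM. Qed.

Definition expi s : R[i] := cos s +i* sin s.

Lemma expi0 : expi 0 = 1. Proof. by rewrite /expi cos0 sin0. Qed.

Lemma expiD s t : expi (s + t) = expi s * expi t.
Proof.
by apply: complex_ext; rewrite ?cReM ?cImM /= ?cosD ?sinD//; ring.
Qed.

Lemma cabs_expi s : cabs (expi s) = 1.
Proof. by rewrite cabsE /= cos2Dsin2 sqrtr1. Qed.

Lemma conj_expi s : ((expi s)^*)%C = expi (- s).
Proof. by rewrite /expi cosN sinN. Qed.

Lemma cexp_i s : cexp (0 +i* s) = expi s.
Proof. by rewrite /cexp /= expR0 mul1r. Qed.

(** The derivative is bounded only at points no larger than [s], so the lemma can
    be applied to its own conclusions: each Taylor bound below comes from the one
    of lower order. *)
Lemma mvt_bound0 (f f' : R -> R) (B s : R) :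
  (forall c, is_derive c (1 : R) f (f' c)) ->
  (forall c, `|c| <= `|s| -> `|f' c| <= B) -> `|f s - f 0| <= B * `|s|.
Proof.
move=> df f'B.
have cf : continuous f.
  by move=> c; apply/differentiable_continuous/derivable1_diffP; case: (df c).
have key a b : a <= b -> (forall c, a <= c <= b -> `|f' c| <= B) ->
    `|f b - f a| <= B * (b - a).
  move=> ab h.
  have dfab x : x \in `]a, b[%R -> is_derive x (1 : R) f (f' x) by move=> _; exact: df.
  have [c cab ->] := MVT_segment ab dfab (continuous_subspaceT cf).
  rewrite normrM [`|b - a|]ger0_norm ?subr_ge0// ler_wpM2r ?subr_ge0//.
  by apply: h; move: cab; rewrite in_itv.
have [s0|s0] := leP 0 s.
  rewrite (le_trans (key _ _ s0 _))// ?subr0 ?ger0_norm// => c /andP[c0 cs].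
  by apply: f'B; rewrite !ger0_norm// (le_trans c0).
rewrite distrC (le_trans (key _ _ (ltW s0) _))//; last first.
  by rewrite sub0r ler0_norm// ltW.
move=> c /andP[sc c0]; apply: f'B.
by rewrite !ler0_norm ?lerN2// ltW.
Qed.

Lemma normr_sin_le s : `|sin s| <= `|s|.
Proof.
have := @mvt_bound0 sin cos 1 s (fun c => is_derive_sin c).
rewrite sin0 subr0 mul1r; apply=> c _.
exact: cos_max.
Qed.

Lemma normr_cosB1 s : `|cos s - 1| <= `|s|.
Proof.
have := @mvt_bound0 cos (fun x => - sin x) 1 s (fun c => is_derive_cos c).
rewrite cos0 mul1r; apply=> c _.
by rewrite normrN sin_max.
Qed.

Lemma normr_cosB1_sqr s : `|cos s - 1| <= s ^+ 2.
Proof.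
have := @mvt_bound0 cos (fun x => - sin x) `|s| s (fun c => is_derive_cos c).
rewrite cos0 -normrM -expr2 (ger0_norm (sqr_ge0 _)); apply=> c cs.
by rewrite normrN (le_trans (normr_sin_le _)).
Qed.

Lemma normr_sinB_sqr s : `|sin s - s| <= s ^+ 2.
Proof.
have d c : is_derive c (1 : R) (fun x => sin x - x) (cos c - 1).
  by apply: is_deriveB.
have := @mvt_bound0 _ _ `|s| s d.
rewrite sin0 !subr0 -normrM -expr2 (ger0_norm (sqr_ge0 _)); apply=> c cs.
exact: le_trans (normr_cosB1 _) cs.
Qed.

Lemma cabs_expiB1 s : cabs (expi s - 1) <= 2 * `|s|.
Proof.
rewrite (le_trans (cabs_le_norm _))// cReD cImD /= subr0.
by rewrite mulr_natl mulr2n lerD// ?normr_cosB1// normr_sin_le.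
Qed.

(** The second order remainder is what makes differentiation under the Fourier
    integral a matter of a single norm inequality. *)
Lemma cabs_expi_taylor s : cabs (expi s - 1 - 0 +i* s) <= 2 * s ^+ 2.
Proof.
rewrite (le_trans (cabs_le_norm _))// !cReD !cImD !cReN !cImN /= !subr0.
by rewrite mulr_natl mulr2n lerD// ?normr_cosB1_sqr// normr_sinB_sqr.
Qed.

End complex_modulus.

(** * Integration of complex-valued functions *)

Section complex_integral.
Context {R : realType} {disp : measure_display} {T : measurableType disp}.
Variable m : {measure set T -> \bar R}.
Implicit Types (f g : T -> R[i]) (h k : T -> R).

(** Complex functions are treated componentwise, over an arbitrary measure space
    because Fubini's theorem is applied on products. *)
Definition cmeas f := measurable_fun setT (fun x => complex.Re (f x)) /\
  measurable_fun setT (fun x => complex.Im (f x)).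

Definition cintg f := m.-integrable setT (fun x => (complex.Re (f x))%:E) /\
  m.-integrable setT (fun x => (complex.Im (f x))%:E).

Definition cint f : R[i] :=
  (\int[m]_x complex.Re (f x)) +i* (\int[m]_x complex.Im (f x)).

Lemma cmeas_real h : measurable_fun setT h -> cmeas (fun x => (h x)%:C).
Proof. by split=> //=; exact: measurable_cst. Qed.

Lemma cmeas_cst (c : R[i]) : cmeas (fun=> c).
Proof. by split; exact: measurable_cst. Qed.

Lemma cmeasD f g : cmeas f -> cmeas g -> cmeas (fun x => f x + g x).
Proof.
move=> [f1 f2] [g1 g2]; split.
  by under eq_fun do rewrite cReD; exact: measurable_funD.
by under eq_fun do rewrite cImD; exact: measurable_funD.
Qed.

Lemma cmeasM f g : cmeas f -> cmeas g -> cmeas (fun x => f x * g x).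
Proof.
move=> [f1 f2] [g1 g2]; split.
  under eq_fun do rewrite cReM.
  by apply: measurable_funB; exact: measurable_funM.
under eq_fun do rewrite cImM.
by apply: measurable_funD; exact: measurable_funM.
Qed.

Lemma cmeas_prod I (r : seq I) (F : I -> T -> R[i]) :
  (forall i, cmeas (F i)) -> cmeas (fun x => \prod_(i <- r) F i x).
Proof.
move=> mF; elim: r => [|i r IH].
  by under eq_fun do rewrite big_nil; exact: cmeas_cst.
by under eq_fun do rewrite big_cons; exact: cmeasM.
Qed.

Lemma cmeas_sum I (r : seq I) (F : I -> T -> R[i]) :
  (forall i, cmeas (F i)) -> cmeas (fun x => \sum_(i <- r) F i x).
Proof.
move=> mF; elim: r => [|i r IH].
  by under eq_fun do rewrite big_nil; exact: cmeas_cst.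
by under eq_fun do rewrite big_cons; exact: cmeasD.
Qed.

Lemma cmeasN f : cmeas f -> cmeas (fun x => - f x).
Proof.
move=> [f1 f2]; split.
  by under eq_fun do rewrite cReN; exact: measurableT_comp.
by under eq_fun do rewrite cImN; exact: measurableT_comp.
Qed.

Lemma cmeasB f g : cmeas f -> cmeas g -> cmeas (fun x => f x - g x).
Proof. by move=> mf mg; apply: cmeasD => //; exact: cmeasN. Qed.

Lemma cmeas_conj f : cmeas f -> cmeas (fun x => (f x)^*)%C.
Proof.
move=> [f1 f2]; split.
  by under eq_fun do rewrite cRe_conj.
by under eq_fun do rewrite cIm_conj; exact: measurableT_comp.
Qed.

Lemma cmeas_expi h : measurable_fun setT h -> cmeas (fun x => expi (h x)).
Proof.
move=> mh; split=> /=.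
  exact: (measurableT_comp (continuous_measurable_fun (@continuous_cos R)) mh).
exact: (measurableT_comp (continuous_measurable_fun (@continuous_sin R)) mh).
Qed.

Lemma measurable_cabs f : cmeas f -> measurable_fun setT (fun x => cabs (f x)).
Proof.
move=> [f1 f2]; under eq_fun do rewrite cabsE.
apply: (measurableT_comp (continuous_measurable_fun (@sqrt_continuous R))).
by apply: measurable_funD; exact: measurable_funX.
Qed.

Lemma integrable_scale (r : R) h : m.-integrable setT (EFin \o h) ->
  m.-integrable setT (EFin \o (fun x => r * h x)).
Proof. by move=> ih; exact: (integrableZl measurableT r ih). Qed.

Lemma integrable_add h k : m.-integrable setT (EFin \o h) ->
  m.-integrable setT (EFin \o k) ->
  m.-integrable setT (EFin \o (fun x => h x + k x)).
Proof. by move=> ih ik; exact: (integrableD measurableT ih ik). Qed.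

Lemma cintg_meas f : cintg f -> cmeas f.
Proof.
by move=> [f1 f2]; split; apply/measurable_EFinP; exact: measurable_int f1 || exact: measurable_int f2.
Qed.

Lemma cintg_le f h : cmeas f -> m.-integrable setT (EFin \o h) ->
  (forall x, cabs (f x) <= h x) -> cintg f.
Proof.
move=> [f1 f2] ih fh; split; apply: le_integrable ih => //.
- exact/measurable_EFinP.
- move=> x _ /=; rewrite lee_fin (le_trans (normr_cRe _))// (le_trans (fh x))//.
  exact: ler_norm.
- exact/measurable_EFinP.
- move=> x _ /=; rewrite lee_fin (le_trans (normr_cIm _))// (le_trans (fh x))//.
  exact: ler_norm.
Qed.

Lemma cintg_cabs f : cintg f -> m.-integrable setT (fun x => (cabs (f x))%:E).
Proof.
move=> fi; have [f1 f2] := fi; have mf := cintg_meas fi.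
apply: (@le_integrable _ _ _ m setT _ _
  ((abse \o (EFin \o (fun x => complex.Re (f x)))) \+
   (abse \o (EFin \o (fun x => complex.Im (f x)))))%E) => //.
- by apply/measurable_EFinP; exact: measurable_cabs.
- move=> x _ /=; rewrite lee_fin ger0_norm ?cabs_ge0//.
  by rewrite ger0_norm ?addr_ge0// cabs_le_norm.
- by apply: integrableD => //; exact: integrable_abse.
Qed.

Lemma cintgP f : cmeas f -> (\int[m]_x (cabs (f x))%:E < +oo)%E -> cintg f.
Proof.
move=> mf foo; apply: (@cintg_le _ (fun x => cabs (f x))) => //.
apply/integrableP; split; first by apply/measurable_EFinP; exact: measurable_cabs.
by under eq_integral do rewrite /= ger0_norm ?cabs_ge0//.
Qed.

Lemma cintg_lty f : cintg f -> (\int[m]_x (cabs (f x))%:E < +oo)%E.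
Proof.
move/cintg_cabs/integrableP => [_].
by under eq_integral do rewrite /= ger0_norm ?cabs_ge0//.
Qed.

Lemma eq_cint f g : f =1 g -> cint f = cint g.
Proof. by move=> fg; congr cint; apply/funext. Qed.

Lemma cintgD f g : cintg f -> cintg g -> cintg (fun x => f x + g x).
Proof.
move=> [f1 f2] [g1 g2]; split.
  by under eq_fun do rewrite cReD EFinD; exact: integrableD.
by under eq_fun do rewrite cImD EFinD; exact: integrableD.
Qed.

Lemma cintD f g : cintg f -> cintg g ->
  cint (fun x => f x + g x) = cint f + cint g.
Proof.
move=> [f1 f2] [g1 g2]; apply: complex_ext; rewrite ?cReD ?cImD /=.
  by under eq_Rintegral do rewrite cReD; exact: RintegralD.
by under eq_Rintegral do rewrite cImD; exact: RintegralD.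
Qed.

Lemma cintgZ (c : R[i]) f : cintg f -> cintg (fun x => c * f x).
Proof.
move=> fi; have mf := cintg_meas fi.
apply: (@cintg_le _ (fun x => cabs c * cabs (f x))).
- by apply: cmeasM => //; exact: cmeas_cst.
- by apply: integrable_scale; exact: cintg_cabs.
- by move=> x; rewrite cabsM.
Qed.

Lemma cintZ (c : R[i]) f : cintg f -> cint (fun x => c * f x) = c * cint f.
Proof.
move=> [f1 f2]; apply: complex_ext; rewrite ?cReM ?cImM /=.
  under eq_Rintegral do rewrite cReM.
  by rewrite RintegralB ?RintegralZl//; exact: integrable_scale.
under eq_Rintegral do rewrite cImM.
by rewrite RintegralD ?RintegralZl//; exact: integrable_scale.
Qed.

Lemma cintZr (c : R[i]) f : cintg f -> cint (fun x => f x * c) = cint f * c.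
Proof.
by move=> fi; under eq_cint do rewrite mulrC; rewrite cintZ// mulrC.
Qed.

Lemma cintgN f : cintg f -> cintg (fun x => - f x).
Proof.
by move=> fi; under eq_fun do rewrite -mulN1r; exact: cintgZ.
Qed.

Lemma cintgB f g : cintg f -> cintg g -> cintg (fun x => f x - g x).
Proof. by move=> fi gi; apply: cintgD => //; exact: cintgN. Qed.

Lemma cintB f g : cintg f -> cintg g ->
  cint (fun x => f x - g x) = cint f - cint g.
Proof.
move=> fi gi; rewrite cintD//; last exact: cintgN.
by under [X in _ + X]eq_cint do rewrite -mulN1r; rewrite cintZ// mulN1r.
Qed.

Lemma cint_conj f : cintg f -> cint (fun x => (f x)^*)%C = ((cint f)^*)%C.
Proof.
move=> [f1 f2]; apply: complex_ext; rewrite ?cRe_conj ?cIm_conj /=.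
  by under eq_Rintegral do rewrite cRe_conj.
under eq_Rintegral do rewrite cIm_conj -mulN1r.
by rewrite RintegralZl// mulN1r.
Qed.

(** The usual rotation argument: multiplying by the conjugate of the integral
    reduces to the real part, so no constant is lost. *)
Lemma cabs_cint f : cintg f -> cabs (cint f) <= \int[m]_x cabs (f x).
Proof.
move=> fi.
have key w : complex.Re (w * cint f) <= cabs w * \int[m]_x cabs (f x).
  rewrite -(cintZ w fi) -RintegralZl//; last exact: cintg_cabs.
  apply: le_Rintegral => //; first by case: (cintgZ w fi).
    by apply: integrable_scale; exact: cintg_cabs.
  by move=> x _; rewrite -cabsM; exact: le_trans (ler_norm _) (normr_cRe _).
have [c0|c0] := eqVneq (cabs (cint f)) 0.
  by rewrite c0 Rintegral_ge0// => x _; exact: cabs_ge0.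
have cp : 0 < cabs (cint f) by rewrite lt_neqAle eq_sym c0 cabs_ge0.
by rewrite -(ler_pM2l cp) -expr2 -[X in X * _]cabs_conj (le_trans _ (key _))// conj_mulr.
Qed.

Lemma EFin_cabs_cint f : cmeas f ->
  ((cabs (cint f))%:E <= \int[m]_x (cabs (f x))%:E)%E.
Proof.
move=> mf; have [->|foo] := eqVneq (\int[m]_x (cabs (f x))%:E)%E +oo%E.
  by rewrite leey.
have fi : cintg f by apply: cintgP => //; rewrite ltey.
rewrite -[leRHS]fineK ?lee_fin; first exact: cabs_cint.
by apply: integrable_fin_num => //; exact: cintg_cabs.
Qed.

Lemma cint_eq_ae f g : cmeas f -> cmeas g ->
  {ae m, forall x, f x = g x} -> cint f = cint g.
Proof.
move=> [f1 f2] [g1 g2] fg; apply: complex_ext => /=; congr fine;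
  apply: ae_eq_integral => //; (try exact/measurable_EFinP);
  by apply: filterS fg => x -> _.
Qed.

Lemma Rintegral_dominated (u_ : nat -> T -> R) (u h : T -> R) :
  (forall n, measurable_fun setT (u_ n)) ->
  (forall x, u_ n x @[n --> \oo] --> u x) ->
  m.-integrable setT (EFin \o h) ->
  (forall n x, `|u_ n x| <= h x) ->
  m.-integrable setT (fun x => (u x)%:E) /\
  \int[m]_x u_ n x @[n --> \oo] --> \int[m]_x u x.
Proof.
move=> mu_ cu ih uh.
have mu : measurable_fun setT u by exact: (measurable_fun_cvg mu_).
have [] := @dominated_convergence _ _ _ m setT measurableT
  (fun n => EFin \o u_ n) (EFin \o u) (EFin \o h).
- by move=> n; exact/measurable_EFinP.
- exact/measurable_EFinP.
- by apply: aeW => x _; apply: cvg_EFin; [exact: nearW|exact: cu].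
- by [].
- by apply: aeW => x n _; rewrite /= lee_fin uh.
move=> iu _ cvgu; split=> //.
by apply: fine_cvg; rewrite fineK//; exact: integrable_fin_num.
Qed.

(** Convergence in [R[i]] is expressed by real and imaginary parts, so that only
    limits in [R] occur. *)
Lemma cint_dominated (f_ : nat -> T -> R[i]) f h :
  (forall n, cmeas (f_ n)) ->
  (forall x, complex.Re (f_ n x) @[n --> \oo] --> complex.Re (f x)) ->
  (forall x, complex.Im (f_ n x) @[n --> \oo] --> complex.Im (f x)) ->
  m.-integrable setT (EFin \o h) ->
  (forall n x, cabs (f_ n x) <= h x) ->
  [/\ cintg f, complex.Re (cint (f_ n)) @[n --> \oo] --> complex.Re (cint f) &
    complex.Im (cint (f_ n)) @[n --> \oo] --> complex.Im (cint f)].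
Proof.
move=> mf_ cR cI ih fh.
have [iR cvR] := Rintegral_dominated (fun n => (mf_ n).1) cR ih
  (fun n x => le_trans (normr_cRe _) (fh n x)).
have [iI cvI] := Rintegral_dominated (fun n => (mf_ n).2) cI ih
  (fun n x => le_trans (normr_cIm _) (fh n x)).
by split.
Qed.

End complex_integral.

Section preserving.
Context {R : realType} {disp : measure_display} {T : measurableType disp}.
Variable m : {measure set T -> \bar R}.

Definition preserving (phi : T -> T) := measurable_fun setT phi /\
  forall A, measurable A -> m (phi @^-1` A) = m A.

Lemma integral_preserving phi (f : T -> \bar R) : preserving phi ->
  measurable_fun setT f -> (\int[m]_x f (phi x) = \int[m]_x f x)%E.
Proof.
move=> [mphi mE].
have key (g : T -> \bar R) : measurable_fun setT g -> (forall x, 0 <= g x)%E ->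
    (\int[m]_x g (phi x) = \int[m]_x g x)%E.
  move=> mg g0.
  have := @ge0_integral_pushforward _ _ _ _ _ phi mphi m setT g measurableT mg
    (fun x _ => g0 x).
  rewrite preimage_setT => <-.
  by apply: eq_measure_integral => A mA _; rewrite -mE.
move=> mf; rewrite integralE [RHS]integralE; congr (_ - _)%E.
  rewrite (funepos_comp f phi).
  by apply: (key f^\+%E) => //; exact: measurable_funepos.
rewrite (funeneg_comp f phi).
by apply: (key f^\-%E) => //; exact: measurable_funeneg.
Qed.

Lemma Rintegral_preserving phi (f : T -> R) : preserving phi ->
  measurable_fun setT f -> \int[m]_x f (phi x) = \int[m]_x f x.
Proof.
move=> pphi mf; congr fine.
apply: (@integral_preserving phi (fun x => (f x)%:E)) => //.
exact/measurable_EFinP.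
Qed.

Lemma cmeas_comp disp' (T' : measurableType disp') (phi : T -> T') (f : T' -> R[i]) :
  measurable_fun setT phi -> cmeas f -> cmeas (fun x => f (phi x)).
Proof. move=> mphi [f1 f2]; split.
  exact: (measurableT_comp f1 mphi).
exact: (measurableT_comp f2 mphi). Qed.

Lemma cintg_preserving phi (f : T -> R[i]) : preserving phi ->
  cintg m f -> cintg m (fun x => f (phi x)).
Proof.
move=> pphi fi; have mf := cintg_meas fi; apply: cintgP.
  exact: (cmeas_comp pphi.1 mf).
rewrite (integral_preserving pphi (f := fun x => (cabs (f x))%:E)) ?cintg_lty//.
by apply/measurable_EFinP; exact: measurable_cabs.
Qed.

Lemma cint_preserving phi (f : T -> R[i]) : preserving phi ->
  cmeas f -> cint m (fun x => f (phi x)) = cint m f.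
Proof.
by move=> pphi [f1 f2]; apply: complex_ext => /=; exact: Rintegral_preserving.
Qed.

End preserving.

Section complex_fubini.
Context {R : realType} {d1 d2 : measure_display}
  {T1 : measurableType d1} {T2 : measurableType d2}.
Variables (m1 : {sigma_finite_measure set T1 -> \bar R})
  (m2 : {sigma_finite_measure set T2 -> \bar R}).

(** The inner integral is finite only almost everywhere.  Its real value, [0] on
    the exceptional set, differs from the extended one on a null set. *)
Lemma Rintegral_prod1 (f : T1 * T2 -> R) :
  (m1 \x m2)%E.-integrable setT (EFin \o f) ->
  [/\ measurable_fun setT (fun x => \int[m2]_y f (x, y)),
   m1.-integrable setT (fun x => (\int[m2]_y f (x, y))%:E) &
   \int[m1]_x (\int[m2]_y f (x, y)) = \int[(m1 \x m2)%E]_z f z].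
Proof.
move=> fi; have iF := integrable_fubini_F fi.
have mF : measurable_fun setT (fun x => \int[m2]_y f (x, y)).
  exact: (measurableT_comp (fine_measurable measurableT) (measurable_int m1 iF)).
have mEF : measurable_fun setT (fun x => (\int[m2]_y f (x, y))%:E).
  exact/measurable_EFinP.
have ae : {ae m1, forall x, setT x ->
    (fubini_F m2 (EFin \o f)) x = (\int[m2]_y f (x, y))%:E}.
  by apply: filterS (integrable_ae measurableT iF) => z /(_ I) zf _; rewrite fineK.
split => //; last first.
  congr fine; rewrite -(integral12_prod_meas1 fi); symmetry.
  by apply: ae_eq_integral => //; exact: measurable_int iF.
apply/integrableP; split => //.
move/integrableP: iF => [miF]; apply: le_lt_trans.
rewrite le_eqVlt; apply/orP; left; apply/eqP.
apply: ae_eq_integral => //; try exact: measurableT_comp.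
by apply: filterS ae => z /(_ I) <- _.
Qed.

Lemma Rintegral_prod2 (f : T1 * T2 -> R) :
  (m1 \x m2)%E.-integrable setT (EFin \o f) ->
  [/\ measurable_fun setT (fun y => \int[m1]_x f (x, y)),
   m2.-integrable setT (fun y => (\int[m1]_x f (x, y))%:E) &
   \int[m2]_y (\int[m1]_x f (x, y)) = \int[(m1 \x m2)%E]_z f z].
Proof.
move=> fi; have iF : m2.-integrable setT (fubini_G m1 (EFin \o f)).
  have mf := measurable_int _ fi.
  have mG := measurable_fubini_G fi.
  apply/integrableP; split => //.
  have := (integrable21ltyP m1 m2 mf).1 fi; apply: le_lt_trans.
  apply: ge0_le_integral => //.
  - exact: measurableT_comp.
  - apply: (@measurable_fun_fubini_tonelli_G _ _ _ _ _ m1 (abse \o (EFin \o f))) => //.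
      exact: measurableT_comp.
    by move=> z; rewrite lee_fin.
  - move=> y _; apply: le_abse_integral => //.
    exact: (measurableT_comp mf (pair2_measurable y)).
have mF : measurable_fun setT (fun y => \int[m1]_x f (x, y)).
  exact: (measurableT_comp (fine_measurable measurableT) (measurable_int m2 iF)).
have mEF : measurable_fun setT (fun y => (\int[m1]_x f (x, y))%:E).
  exact/measurable_EFinP.
have ae : {ae m2, forall y, setT y ->
    (fubini_G m1 (EFin \o f)) y = (\int[m1]_x f (x, y))%:E}.
  by apply: filterS (integrable_ae measurableT iF) => z /(_ I) zf _; rewrite fineK.
split => //; last first.
  congr fine; rewrite -(integral21_prod_meas1 fi); symmetry.
  by apply: ae_eq_integral => //; exact: measurable_int iF.
apply/integrableP; split => //.
move/integrableP: iF => [miF]; apply: le_lt_trans.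
rewrite le_eqVlt; apply/orP; left; apply/eqP.
apply: ae_eq_integral => //; try exact: measurableT_comp.
by apply: filterS ae => z /(_ I) <- _.
Qed.

Lemma cint_fubini (f : T1 * T2 -> R[i]) : cintg (m1 \x m2)%E f ->
  [/\ cintg m1 (fun x => cint m2 (fun y => f (x, y))),
   cintg m2 (fun y => cint m1 (fun x => f (x, y))) &
   cint m1 (fun x => cint m2 (fun y => f (x, y))) =
   cint m2 (fun y => cint m1 (fun x => f (x, y)))].
Proof.
move=> [fR fI].
have [_ iR1 eR1] := Rintegral_prod1 fR; have [_ iR2 eR2] := Rintegral_prod2 fR.
have [_ iI1 eI1] := Rintegral_prod1 fI; have [_ iI2 eI2] := Rintegral_prod2 fI.
split; [by split|by split|].
by apply: complex_ext => /=; [rewrite eR1 eR2|rewrite eI1 eI2].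
Qed.

Lemma cintg_prod (f : T1 * T2 -> R[i]) : cmeas f ->
  (\int[m1]_x \int[m2]_y (cabs (f (x, y)))%:E < +oo)%E ->
  cintg (m1 \x m2)%E f.
Proof.
move=> mf foo; apply: cintgP => //.
rewrite (@fubini_tonelli1 _ _ _ _ _ m1 m2 (fun z => (cabs (f z))%:E))//.
- by apply/measurable_EFinP; exact: measurable_cabs.
- by move=> z; rewrite lee_fin cabs_ge0.
Qed.

Lemma cint_prod (f : T1 -> R[i]) (g : T2 -> R[i]) :
  cintg m1 f -> cintg m2 g ->
  cintg (m1 \x m2)%E (fun z => f z.1 * g z.2) /\
  cint (m1 \x m2)%E (fun z => f z.1 * g z.2) = cint m1 f * cint m2 g.
Proof.
move=> fi gi; have mf := cintg_meas fi; have mg := cintg_meas gi.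
have i12 : cintg (m1 \x m2)%E (fun z => f z.1 * g z.2).
  apply: cintg_prod.
    by apply: cmeasM; apply: cmeas_comp.
  under eq_integral => x _ do under eq_integral => y _ do rewrite /= cabsM EFinM.
  under eq_integral => x _.
    rewrite ge0_integralZl//; last 3 first.
      by apply/measurable_EFinP; exact: measurable_cabs.
      by move=> y _; rewrite lee_fin cabs_ge0.
      by rewrite lee_fin cabs_ge0.
    over.
  rewrite ge0_integralZr//; last 3 first.
    by apply/measurable_EFinP; exact: measurable_cabs.
    by move=> y _; rewrite lee_fin cabs_ge0.
    by apply: integral_ge0 => y _; rewrite lee_fin cabs_ge0.
  by rewrite lte_mul_pinfty// ?cintg_lty// ?ge0_fin_numE ?cintg_lty//;
    apply: integral_ge0 => y _; rewrite lee_fin cabs_ge0.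
split => //.
have [iR iI] := i12.
have [_ _ eR] := Rintegral_prod1 iR; have [_ _ eI] := Rintegral_prod1 iI.
transitivity (cint m1 (fun x => cint m2 (fun y => f x * g y))).
  by apply: complex_ext => /=; rewrite ?eR ?eI.
by under eq_cint do rewrite cintZ//; rewrite cintZr.
Qed.

End complex_fubini.

(** * Invariance of Lebesgue measure *)

Section lebesgue_invariance.
Context {R : realType}.
Local Notation leb := (@lebesgue_measure R).

Lemma preserving_comp (disp : measure_display) (T : measurableType disp)
    (m : {measure set T -> \bar R}) (phi psi : T -> T) :
  preserving m phi -> preserving m psi -> preserving m (phi \o psi).
Proof.
move=> [mphi ephi] [mpsi epsi]; split; first exact: measurableT_comp.
move=> A mA; rewrite comp_preimage epsi ?ephi//.
by rewrite -[X in measurable X]setTI; exact: mphi.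
Qed.

Lemma preserving_shift (a : R) : preserving leb (fun x => x + a).
Proof.
have ms : measurable_fun setT (fun x : measurableTypeR R => (x + a : measurableTypeR R)).
  by apply: measurable_funD.
split => // A mA.
pose s_mixin := isMeasurableFun.Build _ _ _ _ _ ms.
pose s : {mfun measurableTypeR R >-> measurableTypeR R} :=
  HB.pack (fun x : measurableTypeR R => x + a : measurableTypeR R) s_mixin.
symmetry; apply: (@lebesgue_measure_unique R (pushforward leb s)) => //.
move=> _ [[b c] _ <-] /=; rewrite /pushforward.
rewrite (_ : _ @^-1` _ = `](b - a), (c - a)]%classic); last first.
  by apply/seteqP; split => x /=; rewrite !in_itv/= ltrBlDr lerBrDr.
rewrite !lebesgue_measure_itv/= !lte_fin ltrD2r.
by case: ifP => // _; rewrite -!EFinD; congr (_%:E); ring.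
Qed.

Lemma preserving_opp : preserving leb -%R.
Proof.
split; first by apply: (@measurable_funN _ _ R setT id).
by move=> A mA; exact: lebesgue_measureN.
Qed.

Lemma preserving_prod (d1 d2 : measure_display)
    (T1 : measurableType d1) (T2 : measurableType d2)
    (m1 : {sigma_finite_measure set T1 -> \bar R})
    (m2 : {sigma_finite_measure set T2 -> \bar R}) phi1 phi2 :
  preserving m1 phi1 -> preserving m2 phi2 ->
  preserving (m1 \x m2)%E (fun z => (phi1 z.1, phi2 z.2)).
Proof.
move=> [mp1 e1] [mp2 e2].
have mphi : measurable_fun setT (fun z : T1 * T2 => (phi1 z.1, phi2 z.2)).
  apply/measurable_fun_pairP; split.
    exact: (measurableT_comp mp1 measurable_fst).
  exact: (measurableT_comp mp2 measurable_snd).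
split => // A mA; symmetry.
pose s_mixin := isMeasurableFun.Build _ _ _ _ _ mphi.
pose s : {mfun (T1 * T2)%type >-> (T1 * T2)%type} :=
  HB.pack (fun z : T1 * T2 => (phi1 z.1, phi2 z.2)) s_mixin.
apply: (@product_measure_unique _ _ _ _ _ m1 m2
  (pushforward (m1 \x m2)%E s)) => //.
move=> B C mB mC /=; rewrite /pushforward.
rewrite (_ : _ @^-1` _ = (phi1 @^-1` B) `*` (phi2 @^-1` C))//.
rewrite -e1// -e2//; apply: product_measure1E.
  by rewrite -[X in measurable X]setTI; exact: mp1.
by rewrite -[X in measurable X]setTI; exact: mp2.
Qed.

(** Lebesgue measure in dimension [d.+1] is an image of a product measure, so
    invariance goes by induction on the dimension for maps that split off the
    first coordinate. *)
Lemma preserving_rV_cons d phi phi1 phi2 :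
  measurable_fun setT phi ->
  preserving leb phi1 -> preserving (lebesgue_rV R d) phi2 ->
  (forall z, phi (rV_cons z) = rV_cons (phi1 z.1, phi2 z.2)) ->
  preserving (lebesgue_rV R d.+1) phi.
Proof.
move=> mphi p1 p2 phiE; split => // A mA.
have mA' : measurable (@rV_cons R d @^-1` A).
  by rewrite -[X in measurable X]setTI; exact: measurable_rV_cons.
have := (preserving_prod p1 p2).2 _ mA'.
have -> : (fun z => (phi1 z.1, phi2 z.2)) @^-1` (@rV_cons R d @^-1` A) =
    @rV_cons R d @^-1` (phi @^-1` A).
  by apply/seteqP; split => z /=; rewrite phiE.
exact.
Qed.

Lemma measurable_rV_shift d (a : 'rV[R]_d) : measurable_fun setT (fun x : 'rV[R]_d => x + a).
Proof.
apply: measurable_fun_rV => i.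
rewrite (_ : _ \o _ = fun x : 'rV[R]_d => rV_coord i x + a ord0 i).
  by apply: measurable_funD => //; exact: measurable_rV_coord.
by apply/funext => x; rewrite /= /rV_coord mxE.
Qed.

Lemma measurable_rV_opp d : measurable_fun setT (fun x : 'rV[R]_d => - x).
Proof.
apply: measurable_fun_rV => i.
rewrite (_ : _ \o _ = fun x : 'rV[R]_d => - rV_coord i x).
  by apply: measurable_funN; exact: measurable_rV_coord.
by apply/funext => x; rewrite /= /rV_coord mxE.
Qed.

Lemma rV_shift_preserving d (a : 'rV[R]_d) :
  preserving (lebesgue_rV R d) (fun x : 'rV[R]_d => x + a).
Proof.
elim: d a => [|d IH] a.
  split; first exact: measurable_rV_shift.
  move=> A mA; congr (lebesgue_rV R 0 _).
  by apply/seteqP; split => x /=; rewrite !(flatmx0, thinmx0).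
apply: (preserving_rV_cons _ (preserving_shift (a ord0 ord0))
  (IH (\row_i a ord0 (lift ord0 i)))); first exact: measurable_rV_shift.
move=> z; apply/rowP => i; rewrite !mxE.
by case: unliftP => [j ->|->] /=; rewrite ?mxE.
Qed.

Lemma rV_opp_preserving d : preserving (lebesgue_rV R d) -%R.
Proof.
elim: d => [|d IH].
  split; first exact: measurable_rV_opp.
  move=> A mA; congr (lebesgue_rV R 0 _).
  by apply/seteqP; split => x /=; rewrite !(flatmx0, thinmx0).
apply: (preserving_rV_cons _ preserving_opp IH); first exact: measurable_rV_opp.
move=> z; apply/rowP => i; rewrite !mxE.
by case: unliftP => [j _|_] /=; rewrite ?mxE.
Qed.

Lemma rV_reflect_preserving d (a : 'rV[R]_d) :
  preserving (lebesgue_rV R d) (fun x : 'rV[R]_d => a - x).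
Proof.
rewrite (_ : (fun x : 'rV[R]_d => a - x) = (fun x => x + a) \o -%R).
  by apply: preserving_comp; [exact: rV_shift_preserving|exact: rV_opp_preserving].
by apply/funext => x /=; rewrite addrC.
Qed.

Lemma cint_rV_cons d (F : 'rV[R]_d.+1 -> R[i]) : cmeas F ->
  cint (lebesgue_rV R d.+1) F =
  cint (leb \x lebesgue_rV R d)%E (fun z => F (rV_cons z)).
Proof.
move=> [mR mI].
have key (h : 'rV[R]_d.+1 -> R) : measurable_fun setT h ->
    \int[lebesgue_rV R d.+1]_x h x =
    \int[(leb \x lebesgue_rV R d)%E]_z h (rV_cons z).
  move=> mh; congr fine.
  have pf (g : 'rV[R]_d.+1 -> \bar R) : measurable_fun setT g -> (forall x, 0 <= g x)%E ->
     (\int[lebesgue_rV R d.+1]_x g x = \int[(leb \x lebesgue_rV R d)%E]_z g (rV_cons z))%E.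
    move=> mg g0.
    have := @ge0_integral_pushforward _ _ _ _ _ (@rV_cons R d)
      (@measurable_rV_cons R d) (leb \x lebesgue_rV R d)%E setT g measurableT mg
      (fun x _ => g0 x).
    by rewrite preimage_setT => <-.
  have mEh : measurable_fun setT (EFin \o h) by exact/measurable_EFinP.
  rewrite integralE [RHS]integralE; congr (_ - _)%E.
    rewrite (funepos_comp (EFin \o h) (@rV_cons R d)).
    by apply: (pf (EFin \o h)^\+%E) => //; exact: measurable_funepos.
  rewrite (funeneg_comp (EFin \o h) (@rV_cons R d)).
  by apply: (pf (EFin \o h)^\-%E) => //; exact: measurable_funeneg.
by apply: complex_ext => /=; exact: key.
Qed.

Lemma cintg_rV_cons d (F : 'rV[R]_d.+1 -> R[i]) : cmeas F ->
  cintg (leb \x lebesgue_rV R d)%E (fun z => F (rV_cons z)) ->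
  cintg (lebesgue_rV R d.+1) F.
Proof.
move=> mF /cintg_lty Foo; apply: cintgP => //; apply: le_lt_trans Foo.
have mcF : measurable_fun setT (fun x => (cabs (F x))%:E).
  by apply/measurable_EFinP; exact: measurable_cabs.
have F0 : {in setT, forall x, 0 <= (cabs (F x))%:E}%E.
  by move=> x _; rewrite lee_fin cabs_ge0.
have := ge0_integral_pushforward (@measurable_rV_cons R d)
  (leb \x lebesgue_rV R d)%E measurableT mcF F0.
by rewrite preimage_setT => <-.
Qed.

(** The coordinates are peeled off one by one with Fubini's theorem; this is
    what reduces Gaussian integrals to the line. *)
Lemma cint_rV_prod d (f : 'I_d -> R -> R[i]) :
  (forall i, cintg leb (f i)) ->
  cintg (lebesgue_rV R d) (fun x => \prod_(i < d) f i (x ord0 i)) /\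
  cint (lebesgue_rV R d) (fun x => \prod_(i < d) f i (x ord0 i)) =
  \prod_(i < d) cint leb (f i).
Proof.
elim: d f => [|d IH] f fi.
  rewrite big_ord0; under eq_fun do rewrite big_ord0.
  have -> : cint (lebesgue_rV R 0) (fun=> 1) = 1.
    by apply: complex_ext; rewrite /= /Rintegral integral_dirac//= indicT mul1r.
  split; last by [].
  apply: cintgP; first exact: cmeas_cst.
  by rewrite integral_dirac//= ltry.
have mF : cmeas (fun x : 'rV[R]_d.+1 => \prod_(i < d.+1) f i (x ord0 i)).
  apply: cmeas_prod => i.
  exact: (cmeas_comp (measurable_rV_coord i) (cintg_meas (fi i))).
have E z : \prod_(i < d.+1) f i (rV_cons z ord0 i) =
    f ord0 z.1 * \prod_(i < d) f (lift ord0 i) (z.2 ord0 i).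
  rewrite big_ord_recl mxE unlift_none; congr (_ * _).
  by apply: eq_bigr => i _; rewrite mxE liftK.
have [IHi IHe] := IH (fun i => f (lift ord0 i)) (fun i => fi _).
have [pi pe] := cint_prod (fi ord0) IHi.
split.
  by apply: cintg_rV_cons => //; under eq_fun do rewrite E.
by rewrite cint_rV_cons//; under eq_cint do rewrite E; rewrite pe IHe big_ord_recl.
Qed.

End lebesgue_invariance.

(** * Borel sets, the Japanese bracket and integrable decay *)

Section borel_rV.
Context {R : realType} {d : nat}.

(** The sup-norm balls with rational data form a countable basis. *)
Lemma open_measurable_rV (U : set 'rV[R]_d) : open U -> measurable U.
Proof.
move=> oU.
pose box (q : 'rV[rat]_d * nat) : set 'rV[R]_d :=
  [set x | forall i, `|rV_coord i x - ratr (q.1 ord0 i)| < q.2.+1%:R^-1].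
have mbox q : measurable (box q).
  rewrite (_ : box q = \bigcap_(i in [set: 'I_d])
      ((fun x => `|rV_coord i x - ratr (q.1 ord0 i)|) @^-1` `]-oo, q.2.+1%:R^-1[)).
    apply: fin_bigcap_measurable => // i _.
    have mf : measurable_fun setT
        (fun x : 'rV[R]_d => `|rV_coord i x - ratr (q.1 ord0 i)|).
      apply: measurableT_comp => //; apply: measurable_funB => //.
      exact: measurable_rV_coord.
    by rewrite -[X in measurable X]setTI; apply: mf.
  apply/seteqP; split => x /=.
    by move=> h i _ /=; rewrite in_itv /=; exact: h.
  by move=> h i; have := h i I; rewrite /= in_itv.
pose P := [set q | box q `<=` U].
rewrite (_ : U = \bigcup_(q in [set: 'rV[rat]_d * nat]) (if pselect (P q) then box q else set0)).
  apply: countable_bigcupT_measurable => [|q].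
    exact: (@countableP ('rV[rat]_d * nat)%type).
  by case: (pselect (P q)) => HP /=; [exact: mbox|exact: measurable0].
apply/seteqP; split => [x Ux|x [q _]]; last by case: pselect => // Pq; exact: Pq.
have : nbhs x U by apply: open_nbhs_nbhs.
move=> /nbhs_ballP[e /= e0 xeU].
have [n ne] : exists n : nat, n.+1%:R^-1 < e / 2.
  by have [n] := @ltr_add_invr R 0 (e / 2) ltac:(rewrite divr_gt0//); rewrite add0r; exists n.
have n0 : 0 < n.+1%:R^-1 :> R by rewrite invr_gt0.
have qex i : exists q : rat, `|x ord0 i - ratr q| < n.+1%:R^-1.
  have /rat_in_itvoo[q] : x ord0 i - n.+1%:R^-1 < x ord0 i + n.+1%:R^-1.
    by rewrite ltrD2l gtrN.
  rewrite in_itv /= => /andP[q1 q2]; exists q.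
  by rewrite distrC ltr_distl q1 q2.
pose q := \row_i xchoose (qex i).
have xq i : `|x ord0 i - ratr (q ord0 i)| < n.+1%:R^-1.
  by rewrite mxE; exact: (xchooseP (qex i)).
exists (q, n) => //; case: pselect => [_ i|nP]; first exact: xq.
exfalso; apply: nP => y /= yq; apply: xeU; split => // i j.
rewrite (ord1 i) /ball /=.
have := yq j; have := xq j; rewrite /rV_coord /= => h1 h2.
rewrite (_ : x ord0 j - y ord0 j = (x ord0 j - ratr (q ord0 j)) - (y ord0 j - ratr (q ord0 j))); last by ring.
by rewrite (le_lt_trans (ler_normB _ _))// (splitr e) ltrD//; [exact: lt_trans h1 ne|exact: lt_trans h2 ne].
Qed.

Lemma continuous_measurable_rV (f : 'rV[R]_d -> R) :
  continuous f -> measurable_fun setT f.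
Proof.
move=> /continuousP cf; apply: (measurability _ (RGenOpens.measurableE R)).
move=> _ [_ [a [b ->] <-]]; rewrite setTI; apply: open_measurable_rV.
exact/cf/interval_open.
Qed.

Lemma ccontinuous_cmeas (f : 'rV[R]_d -> R[i]) : ccontinuous f -> cmeas f.
Proof. by move=> [f1 f2]; split; exact: continuous_measurable_rV. Qed.

End borel_rV.

Section dot_product.
Context {R : realType} {d : nat}.
Implicit Types (x y z : 'rV[R]_d).

Lemma dotpC x y : dotp x y = dotp y x.
Proof. by apply: eq_bigr => i _; rewrite mulrC. Qed.

Lemma dotpDl x y z : dotp (x + y) z = dotp x z + dotp y z.
Proof. by rewrite -big_split /=; apply: eq_bigr => i _; rewrite mxE mulrDl. Qed.

Lemma dotpDr x y z : dotp x (y + z) = dotp x y + dotp x z.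
Proof. by rewrite dotpC dotpDl !(dotpC x). Qed.

Lemma dotpZl a x y : dotp (a *: x) y = a * dotp x y.
Proof. by rewrite mulr_sumr; apply: eq_bigr => i _; rewrite mxE mulrA. Qed.

Lemma dotpZr a x y : dotp x (a *: y) = a * dotp x y.
Proof. by rewrite dotpC dotpZl dotpC. Qed.

Lemma dotpNl x y : dotp (- x) y = - dotp x y.
Proof. by rewrite -scaleN1r dotpZl mulN1r. Qed.

Lemma dotpNr x y : dotp x (- y) = - dotp x y.
Proof. by rewrite dotpC dotpNl dotpC. Qed.

Lemma dotpBr x y z : dotp x (y - z) = dotp x y - dotp x z.
Proof. by rewrite dotpDr dotpNr. Qed.

Lemma dotp0l x : dotp 0 x = 0.
Proof. by rewrite -(scale0r 0) dotpZl mul0r. Qed.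

Lemma dotp_ge0 x : 0 <= dotp x x.
Proof. by apply: sumr_ge0 => i _; rewrite -expr2 sqr_ge0. Qed.

Lemma dotp_delta i x : dotp (delta_mx ord0 i) x = x ord0 i.
Proof.
rewrite /dotp (bigD1 i)//= big1 ?addr0 => [|j ji]; first by rewrite mxE !eqxx mul1r.
by rewrite mxE (negbTE ji) andbF mul0r.
Qed.

Lemma sqr_coord_le x i : x ord0 i ^+ 2 <= dotp x x.
Proof.
rewrite /dotp (bigD1 i)//= expr2 lerDl; apply: sumr_ge0 => j _.
by rewrite -expr2 sqr_ge0.
Qed.

Lemma measurable_dotp (disp : measure_display) (T : measurableType disp)
    (f g : T -> 'rV[R]_d) : measurable_fun setT f -> measurable_fun setT g ->
  measurable_fun setT (fun t => dotp (f t) (g t)).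
Proof.
move=> mf mg; rewrite /dotp.
apply: measurable_sum => i; apply: measurable_funM.
  exact: (measurableT_comp (measurable_rV_coord i) mf).
exact: (measurableT_comp (measurable_rV_coord i) mg).
Qed.

Lemma measurable_rV_sub (disp : measure_display) (T : measurableType disp)
    (f g : T -> 'rV[R]_d) : measurable_fun setT f -> measurable_fun setT g ->
  measurable_fun setT (fun t => f t - g t).
Proof.
move=> mf mg; apply: measurable_fun_rV => i.
rewrite (_ : _ \o _ = fun t => rV_coord i (f t) - rV_coord i (g t)).
  apply: measurable_funB.
    exact: (measurableT_comp (measurable_rV_coord i) mf).
  exact: (measurableT_comp (measurable_rV_coord i) mg).
by apply/funext => t; rewrite /= /rV_coord !mxE.
Qed.

Lemma japanese_sqr x : japanese x ^+ 2 = 1 + dotp x x.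
Proof. by rewrite sqr_sqrtr// addr_ge0// dotp_ge0. Qed.

Lemma japanese_ge1 x : 1 <= japanese x.
Proof. by rewrite -[leLHS]sqrtr1 ler_wsqrtr// lerDl dotp_ge0. Qed.

Lemma japanese_gt0 x : 0 < japanese x.
Proof. exact: lt_le_trans (japanese_ge1 x). Qed.

Lemma japanese_ge0 x : 0 <= japanese x.
Proof. exact: ltW (japanese_gt0 x). Qed.

Lemma japaneseN x : japanese (- x) = japanese x.
Proof. by rewrite /japanese dotpNl dotpNr opprK. Qed.

Lemma coord_le_japanese x i : `|x ord0 i| <= japanese x.
Proof.
rewrite -ler_sqr ?nnegrE ?japanese_ge0// real_normK ?num_real// japanese_sqr.
by rewrite (le_trans (sqr_coord_le x i))// lerDr.
Qed.

(** This is Cauchy's inequality, from the nonnegativity of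
    [|<y> x - <x> y|^2]. *)
Lemma dotp_le_japanese x y : dotp x y <= japanese x * japanese y.
Proof.
have := dotp_ge0 (japanese y *: x - japanese x *: y).
rewrite dotpBr dotpC dotpBr !(dotpC (_ - _)) !dotpBr !(dotpZl,dotpZr) (dotpC y x).
have := japanese_sqr x; have := japanese_sqr y.
have := japanese_gt0 x; have := japanese_gt0 y.
set a := japanese x; set b := japanese y => b0 a0 eb ea.
have -> : dotp x x = a ^+ 2 - 1 by rewrite ea; ring.
have -> : dotp y y = b ^+ 2 - 1 by rewrite eb; ring.
move=> h; rewrite -(ler_pM2l (mulr_gt0 a0 b0)).
have := sqr_ge0 a; have := sqr_ge0 b; nra.
Qed.

Lemma japaneseD x y : japanese (x + y) <= japanese x + japanese y.
Proof.
rewrite -ler_sqr ?nnegrE ?japanese_ge0 ?addr_ge0 ?japanese_ge0//.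
rewrite sqrrD !japanese_sqr dotpDl !dotpDr (dotpC y x).
have := dotp_le_japanese x y; lra.
Qed.

Lemma measurable_japanese : measurable_fun setT (@japanese R d).
Proof.
apply: (measurableT_comp (continuous_measurable_fun (@sqrt_continuous R))).
by apply: measurable_funD => //; exact: measurable_dotp.
Qed.

End dot_product.

Section decay.
Context {R : realType}.
Local Notation leb := (@lebesgue_measure R).

Lemma cintg_oneDsqrV : cintg leb (fun x => ((1 + x ^+ 2)^-1)%:C).
Proof.
have mf : measurable_fun setT (fun x : R => (1 + x ^+ 2)^-1).
  by apply: continuous_measurable_fun; exact: continuous_oneDsqrV.
apply: cintgP; first exact: cmeas_real.
have f0 (x : R) : 0 <= (1 + x ^+ 2)^-1 by rewrite invr_ge0 addr_ge0// sqr_ge0.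
under eq_integral do rewrite cabs_real ger0_norm//.
rewrite (@ge0_symfun_integralT _ (fun x : R => (1 + x ^+ 2)^-1))//.
- rewrite -set_itvcy (@integral0y_oneDsqr R) -EFinM ltry//.
- exact: continuous_oneDsqrV.
- by move=> x /=; rewrite sqrrN.
Qed.

(** An integrable majorant of the power [- 2 * d] of the Japanese bracket which,
    unlike that power, factors over the coordinates. *)
Definition decay d (x : 'rV[R]_d) : R := \prod_(i < d) (1 + x ord0 i ^+ 2)^-1.

Lemma integrable_decay d :
  (lebesgue_rV R d).-integrable setT (EFin \o @decay d).
Proof.
have [[iR _] _] := cint_rV_prod (fun _ : 'I_d => cintg_oneDsqrV).
apply: eq_integrable iR => // x _ /=; congr (_%:E).
by rewrite /decay -(rmorph_prod (real_complex R)).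
Qed.

Lemma japanese_decay d (x : 'rV[R]_d) : (japanese x ^+ (2 * d))^-1 <= decay x.
Proof.
rewrite /decay prodfV lef_pV2 ?posrE ?exprn_gt0 ?japanese_gt0//; last first.
  by apply: prodr_gt0 => i _; rewrite ltr_pwDl// sqr_ge0.
rewrite exprM japanese_sqr -[X in _ ^+ X]card_ord -prodr_const.
apply: ler_prod => i _; rewrite addr_ge0 ?sqr_ge0//=.
by rewrite lerD2l sqr_coord_le.
Qed.

End decay.

(** * The Gaussian integral on the line *)

Section gaussian_1d.
Context {R : realType}.
Local Notation leb := (@lebesgue_measure R).

(** The fundamental theorem on [[-n, n]] and dominated convergence. *)
Lemma Rintegral_derivative_eq0 (u u' : R -> R) :
  (forall x, is_derive x (1 : R) u (u' x)) -> continuous u' ->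
  leb.-integrable setT (EFin \o u') ->
  u n%:R @[n --> \oo] --> 0 -> u (- n%:R) @[n --> \oo] --> 0 ->
  \int[leb]_x u' x = 0.
Proof.
move=> du cu' iu' up um.
have cu : continuous u.
  by move=> c; apply/differentiable_continuous/derivable1_diffP; case: (du c).
pose A n : set R := `[- n.+1%:R, n.+1%:R]%classic.
have mA n : measurable (A n) by exact: measurable_itv.
have mu' : measurable_fun setT u' by exact: continuous_measurable_fun.
have IA n : \int[leb]_(x in A n) u' x = u n.+1%:R - u (- n.+1%:R).
  have ab : - n.+1%:R < n.+1%:R :> R by rewrite gtrN// ltr0n.
  rewrite /Rintegral (@continuous_FTC2 _ _ u)//.
  - exact: continuous_subspaceT.
  - split.
    + by move=> x _; case: (du x).
    + by apply: cvg_at_right_filter; exact: cu.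
    + by apply: cvg_at_left_filter; exact: cu.
  - by move=> x _; rewrite derive1E; exact: derive_val.
have lim0 : u n.+1%:R - u (- n.+1%:R) @[n --> \oo] --> (0 : R).
  rewrite -[X in _ --> X](subr0 0); apply: cvgB.
    by rewrite (cvg_shiftS (fun n => u n%:R)).
  by rewrite (cvg_shiftS (fun n => u (- n%:R))).
have [|||n x|_] := @Rintegral_dominated _ _ _ leb (fun n => u' \_ (A n)) u'
    (fun x => `|u' x|).
- move=> n; have mAu : measurable_fun (A n) u' by exact: measurable_funTS.
  exact: ((measurable_restrictT u' (mA n)).1 mAu).
- move=> x; apply: cvg_near_cst; near=> n; rewrite patchE ifT// inE /A /= in_itv /=.
  rewrite -ler_norml; near: n.
  exists (Num.truncn `|x|) => // n /= xn.
  by rewrite (le_trans (ltW (truncnS_gt _)))// ler_nat.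
- exact: (integrable_norm iu').
- by rewrite patchE; case: ifP => // _; rewrite normr0.
under eq_fun do rewrite -Rintegral_mkcond IA.
by move=> h; exact: (cvg_unique _ h lim0).
Unshelve. all: end_near. Qed.

Variable t : R.
Hypothesis t0 : 0 < t.

Definition gauss1 (x : R) := expR (- (t / 2) * x ^+ 2).

Lemma gauss1_ge0 x : 0 <= gauss1 x. Proof. exact: expR_ge0. Qed.

Lemma is_derive_gauss1 x : is_derive x (1 : R) gauss1 (- t * x * gauss1 x).
Proof.
rewrite /gauss1; apply: is_derive_eq.
by rewrite /GRing.scale /= ; field.
Qed.

Lemma continuous_gauss1 : continuous gauss1.
Proof.
move=> x; apply/differentiable_continuous/derivable1_diffP.
by case: (is_derive_gauss1 x).
Qed.

Lemma integrable_gauss1 : leb.-integrable setT (EFin \o gauss1) /\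
  \int[leb]_x gauss1 x = Num.sqrt (2 * pi / t).
Proof.
have s0 : (Num.sqrt t)^-1 != 0 :> R by rewrite invr_neq0// sqrtr_eq0 -ltNge.
have E x : gauss1 x = Num.sqrt (2 * pi / t) * normal_pdf 0 (Num.sqrt t)^-1 x.
  rewrite normal_pdfE// /normal_peak /normal_fun subr0 exprVn sqr_sqrtr ?ltW//.
  rewrite mulrA (_ : (t^-1 * pi *+ 2) = 2 * pi / t); last by field; rewrite gt_eqF.
  rewrite divff ?mul1r; last by rewrite sqrtr_eq0 -ltNge divr_gt0// ?mulr_gt0 ?pi_gt0.
  by rewrite /gauss1; congr expR; field; rewrite gt_eqF.
have i : leb.-integrable setT (EFin \o gauss1).
  have := integrable_scale (Num.sqrt (2 * pi / t)) (integrable_normal_pdf 0 (Num.sqrt t)^-1).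
  by apply: eq_integrable => // x _ /=; rewrite E.
split=> //; under eq_Rintegral do rewrite E.
rewrite RintegralZl//; last exact: integrable_normal_pdf.
by rewrite /Rintegral integral_normal_pdf /= mulr1.
Qed.

Lemma sqr_gauss1_le x : x ^+ 2 * gauss1 x <= 4 / t * expR (- (t / 4) * x ^+ 2).
Proof.
have -> : gauss1 x = expR (- (t / 4) * x ^+ 2) * expR (- (t / 4 * x ^+ 2)).
  by rewrite /gauss1 -expRD; congr expR; field.
rewrite mulrCA mulrC ler_wpM2r ?expR_ge0//.
have := @expR_ge1Dx R (t / 4 * x ^+ 2).
rewrite expRN ler_pdivrMr ?expR_gt0// => h.
rewrite mulrAC ler_pdivlMr// mulrC; have := expR_gt0 (t / 4 * x ^+ 2).
move: h; set e := expR _; nra.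
Qed.

Lemma gauss1_cvg s : sin (s * n%:R) * gauss1 n%:R @[n --> \oo] --> (0 : R).
Proof.
pose C : R := 1 + 2 / t.
have C0 : 0 < C by rewrite addr_gt0// divr_gt0.
have Cb (n : nat) : `|sin (s * n%:R) * gauss1 n%:R| <= C * harmonic n.
  rewrite normrM (ger0_norm (gauss1_ge0 _)) (@le_trans _ _ (gauss1 n%:R))//.
    by rewrite ler_piMl ?gauss1_ge0// sin_max.
  rewrite /gauss1 mulNr expRN -div1r ler_pdivrMr ?expR_gt0//.
  rewrite mulrAC ler_pdivlMr// mul1r -natr1.
  rewrite (@le_trans _ _ (C * (1 + t / 2 * n%:R ^+ 2)))//; last first.
    by rewrite ler_wpM2l ?expR_ge1Dx// ltW.
  rewrite (_ : C * _ = 1 + 2 / t + t / 2 * n%:R ^+ 2 + n%:R ^+ 2); last first.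
    by rewrite /C; field; exact: lt0r_neq0.
  have n2 : (n%:R : R) <= n%:R ^+ 2 by rewrite -natrX ler_nat; case: (n) => // k; rewrite expnS expn1 leq_pmulr.
  have : 0 <= 2 / t by rewrite divr_ge0// ltW.
  have : 0 <= t / 2 * n%:R ^+ 2 by rewrite mulr_ge0 ?sqr_ge0// divr_ge0// ltW.
  by lra.
apply: norm_cvg0; apply: (@squeeze_cvgr _ _ _ _ (cst 0) (fun n => C * harmonic n)).
- by apply: nearW => n; rewrite normr_ge0 Cb.
- exact: cvg_cst.
- by rewrite -[X in _ --> X](mulr0 C); apply: cvgM; [exact: cvg_cst|exact: cvg_harmonic].
Qed.

End gaussian_1d.

Section gaussian_1d_fourier.
Context {R : realType}.
Local Notation leb := (@lebesgue_measure R).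
Variable t : R.
Hypothesis t0 : 0 < t.

Let dom x : R := gauss1 t x + 4 / t * gauss1 (t / 2) x.

Let dom_ge0 x : 0 <= dom x.
Proof.
by rewrite addr_ge0 ?gauss1_ge0// mulr_ge0 ?gauss1_ge0// divr_ge0// ltW.
Qed.

Let integrable_dom : leb.-integrable setT (EFin \o dom).
Proof.
have i1 := (integrable_gauss1 t0).1.
have i2 := (integrable_gauss1 (divr_gt0 t0 (ltr0n R 2))).1.
have := integrableD measurableT i1 (integrable_scale (4 / t) i2).
by apply: eq_integrable.
Qed.

Let le_dom x (c : R) : `|c| <= 1 -> `|x * c * gauss1 t x| <= dom x.
Proof.
move=> c1; rewrite !normrM (ger0_norm (gauss1_ge0 t x)).
rewrite (@le_trans _ _ ((1 + x ^+ 2) * gauss1 t x))//.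
  rewrite ler_wpM2r ?gauss1_ge0// (@le_trans _ _ `|x|) ?ler_piMr//.
  by rewrite -real_normK ?num_real//; have := normr_ge0 x; nra.
rewrite mulrDl mul1r lerD2l (le_trans (sqr_gauss1_le t0 x))//.
by rewrite /gauss1 (_ : t / 4 = t / 2 / 2)//; field.
Qed.

Let cosint s := \int[leb]_x (cos (s * x) * gauss1 t x).
Let sinint s := \int[leb]_x (x * sin (s * x) * gauss1 t x).

Let mcos s : measurable_fun setT (fun x : R => cos (s * x) * gauss1 t x).
Proof.
apply: continuous_measurable_fun => x; apply: cvgM; last exact: continuous_gauss1.
by apply: continuous_comp; [apply: cvgM; [exact: cvg_cst|exact: cvg_id]|exact: continuous_cos].
Qed.

Let csin s : continuous (fun x : R => x * sin (s * x) * gauss1 t x).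
Proof.
move=> x; apply: cvgM; last exact: continuous_gauss1.
apply: cvgM; first exact: cvg_id.
by apply: continuous_comp; [apply: cvgM; [exact: cvg_cst|exact: cvg_id]|exact: continuous_sin].
Qed.

Let icos s : leb.-integrable setT (EFin \o (fun x => cos (s * x) * gauss1 t x)).
Proof.
apply: le_integrable (integrable_gauss1 t0).1 => //; first by apply/measurable_EFinP; exact: mcos.
move=> x _ /=; rewrite lee_fin normrM ler_piMl// cos_max//.
Qed.

Let isin s : leb.-integrable setT (EFin \o (fun x => x * sin (s * x) * gauss1 t x)).
Proof.
apply: le_integrable integrable_dom => //.
  by apply/measurable_EFinP; apply: continuous_measurable_fun; exact: csin.
by move=> x _ /=; rewrite lee_fin (ger0_norm (dom_ge0 x)) le_dom// sin_max.
Qed.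

Let is_derive_f s x :
  is_derive s (1 : R) (fun s => cos (s * x) * gauss1 t x)
    (- (x * sin (s * x) * gauss1 t x)).
Proof.
by apply: is_derive_eq; rewrite /GRing.scale /=; ring.
Qed.

Let is_derive_cosint s : is_derive s (1 : R) cosint (- sinint s).
Proof.
have Is : `]s - 1, s + 1[%classic s by rewrite /= in_itv /= ltrBlDr ltrDl ltr01.
have d1E u x : partial1of2 (fun s x : R => cos (s * x) * gauss1 t x) u x =
    - (x * sin (u * x) * gauss1 t x).
  by rewrite partial1of2E; apply: derive_val.
have bound u x : `|partial1of2 (fun s x : R => cos (s * x) * gauss1 t x) u x| <= dom x.
  by rewrite d1E normrN le_dom// sin_max.
have df (u x : R) : derivable (fun s : R => cos (s * x) * gauss1 t x) u 1.
  by case: (is_derive_f u x).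
apply: DeriveDef.
  exact: (@derivable_under_integral _ _ _ leb (fun s x : R => cos (s * x) * gauss1 t x)
    setT measurableT s (s - 1) (s + 1) Is (fun u _ => icos u)
    (fun u x _ _ => df u x) dom dom_ge0 integrable_dom (fun u x _ _ => bound u x)).
rewrite -derive1E (@differentiation_under_integral _ _ _ leb (fun s x : R => cos (s * x) * gauss1 t x)
    setT measurableT s (s - 1) (s + 1) Is (fun u _ => icos u)
    (fun u x _ _ => df u x) dom dom_ge0 integrable_dom (fun u x _ _ => bound u x)).
under eq_Rintegral do rewrite d1E -mulN1r.
by rewrite RintegralZl// mulN1r.
Qed.

(* Integration by parts on the whole line. *)
Let sinint_cosint s : sinint s = s / t * cosint s.
Proof.
have du x : is_derive x (1 : R) (fun x => sin (s * x) * gauss1 t x)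
    (s * (cos (s * x) * gauss1 t x) - t * (x * sin (s * x) * gauss1 t x)).
  have := is_derive_gauss1 t x => H.
  by apply: is_derive_eq; rewrite /GRing.scale /=; ring.
have := Rintegral_derivative_eq0 du.
rewrite RintegralB//; [|exact: integrable_scale|exact: integrable_scale].
rewrite !RintegralZl// -/(cosint s) -/(sinint s) => h.
have {h} : s * cosint s - t * sinint s = 0.
  apply: h.
  - move=> x; apply: cvgB; apply: cvgM; try exact: cvg_cst; last exact: csin.
    apply: cvgM; last exact: continuous_gauss1.
    apply: continuous_comp; last exact: continuous_cos.
    by apply: cvgM; [exact: cvg_cst|exact: cvg_id].
  - have := integrableB measurableT (integrable_scale s (icos s)) (integrable_scale t (isin s)).
    exact: eq_integrable.
  - exact: gauss1_cvg.
  - rewrite (_ : (fun n => _) = (fun n => sin (- s * n%:R) * gauss1 t n%:R)).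
      exact: gauss1_cvg.
    apply/funext => n; rewrite /gauss1 sqrrN; congr (sin _ * _); ring.
move=> h; apply: (mulfI (lt0r_neq0 t0)).
by rewrite mulrA mulrCA divff ?lt0r_neq0// mulr1; move: h; lra.
Qed.

(* Both sides solve the same first order linear equation in [s]. *)
Let cosintE s : cosint s = Num.sqrt (2 * pi / t) * expR (- s ^+ 2 / (2 * t)).
Proof.
pose H s := cosint s * expR (s ^+ 2 / (2 * t)).
have dH x : is_derive x (1 : R) H 0.
  have := is_derive_cosint x => ?.
  apply: is_derive_eq; rewrite /GRing.scale /= sinint_cosint.
  by field; exact: lt0r_neq0.
have := is_derive_0_is_cst s 0 dH.
rewrite /H expr0n /= mul0r expR0 mulr1.
have -> : cosint 0 = Num.sqrt (2 * pi / t).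
  rewrite /cosint -(integrable_gauss1 t0).2.
  by apply: eq_Rintegral => x _; rewrite mul0r cos0 mul1r.
by move=> <-; rewrite -mulrA -expRD mulNr subrr expR0 mulr1.
Qed.

(* The integrand is odd. *)
Let sin_int s : \int[leb]_x (sin (s * x) * gauss1 t x) = 0.
Proof.
have mf : measurable_fun setT (fun x : R => sin (s * x) * gauss1 t x).
  apply: continuous_measurable_fun => x; apply: cvgM; last exact: continuous_gauss1.
  apply: continuous_comp; last exact: continuous_sin.
  by apply: cvgM; [exact: cvg_cst|exact: cvg_id].
have i : leb.-integrable setT (EFin \o (fun x => sin (s * x) * gauss1 t x)).
  apply: le_integrable (integrable_gauss1 t0).1 => //; first by apply/measurable_EFinP.
  by move=> x _ /=; rewrite lee_fin normrM ler_piMl// sin_max.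
have := Rintegral_preserving (@preserving_opp R) mf.
under eq_Rintegral do rewrite mulrN sinN /gauss1 sqrrN mulNr -mulN1r -/(gauss1 t _).
by rewrite RintegralZl//; lra.
Qed.

Lemma cint_gauss1 s :
  cintg leb (fun x => expi (s * x) * (gauss1 t x)%:C) /\
  cint leb (fun x => expi (s * x) * (gauss1 t x)%:C) =
    (Num.sqrt (2 * pi / t) * expR (- s ^+ 2 / (2 * t)))%:C.
Proof.
have mg : measurable_fun setT (gauss1 t).
  by apply: continuous_measurable_fun; exact: continuous_gauss1.
split.
  apply: (@cintg_le R _ (measurableTypeR R) leb _ (gauss1 t)).
  - apply: cmeasM; last exact: cmeas_real.
    by apply: cmeas_expi; exact: measurable_funM.
  - exact: (integrable_gauss1 t0).1.
  - by move=> x; rewrite cabsM cabs_expi mul1r cabs_real ger0_norm// gauss1_ge0.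
apply: complex_ext.
  transitivity (cosint s); last by rewrite cosintE.
  by apply: eq_Rintegral => x _; rewrite cReM /= mulr0 subr0.
rewrite -[RHS](sin_int s); apply: eq_Rintegral => x _.
by rewrite cImM /= mulr0 add0r.
Qed.

End gaussian_1d_fourier.

(** * Gaussians and the heat kernel *)

Section gaussian.
Context {R : realType} {d : nat}.
Local Notation mu := (lebesgue_rV R d).

(** From [1 + v <= exp v] at [v = u / (k + 1)].  Every trade of a polynomial or
    logarithmic factor against an exponential or a power goes through this. *)
Lemma pow_le_expR (k : nat) (u : R) : 0 <= u ->
  (1 + u) ^+ k.+1 <= k.+1%:R ^+ k.+1 * expR u.
Proof.
move=> u0; have -> : expR u = expR (u / k.+1%:R) ^+ k.+1.
  by rewrite -expRM_natr divfK// pnatr_eq0.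
rewrite -exprMn lerXn2r ?nnegrE ?addr_ge0 ?mulr_ge0 ?expR_ge0//.
rewrite (@le_trans _ _ (k.+1%:R * (1 + u / k.+1%:R)))//; last first.
  by rewrite ler_wpM2l// expR_ge1Dx.
by rewrite mulrDr mulr1 mulrCA divff ?pnatr_eq0// mulr1 lerD2r ler1n.
Qed.

Definition gaussd (t : R) (x : 'rV[R]_d) : R := expR (- (t / 2) * dotp x x).

Lemma gaussd_ge0 t x : 0 <= gaussd t x. Proof. exact: expR_ge0. Qed.

Lemma gaussd_prod t x : gaussd t x = \prod_(i < d) gauss1 t (x ord0 i).
Proof.
rewrite /gaussd /dotp mulr_sumr expR_sum; apply: eq_bigr => i _.
by rewrite /gauss1 expr2.
Qed.

Lemma expi_dotp_prod (s x : 'rV[R]_d) :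
  expi (dotp s x) = \prod_(i < d) expi (s ord0 i * x ord0 i).
Proof.
rewrite /dotp; elim/big_ind2 : _ => //; first exact: expi0.
by move=> a b c e <- <-; rewrite expiD.
Qed.

Lemma measurable_gaussd t : measurable_fun setT (gaussd t).
Proof.
apply: (measurableT_comp (@measurable_expR R)); apply: measurable_funM => //.
exact: measurable_dotp.
Qed.

(** Gaussians and plane waves both factor over the coordinates. *)
Lemma cint_gaussd t s : 0 < t ->
  cintg mu (fun x => expi (dotp s x) * (gaussd t x)%:C) /\
  cint mu (fun x => expi (dotp s x) * (gaussd t x)%:C) =
    (Num.sqrt (2 * pi / t) ^+ d * expR (- dotp s s / (2 * t)))%:C.
Proof.
move=> t0.
have E x : expi (dotp s x) * (gaussd t x)%:C =
    \prod_(i < d) (expi (s ord0 i * x ord0 i) * (gauss1 t (x ord0 i))%:C).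
  by rewrite big_split /= -expi_dotp_prod gaussd_prod rmorph_prod.
have [i e] := cint_rV_prod (fun i : 'I_d => (cint_gauss1 t0 (s ord0 i)).1).
under eq_fun do rewrite E; split; first exact: i.
rewrite e.
under eq_bigr do rewrite (cint_gauss1 t0 _).2.
rewrite -(rmorph_prod (real_complex R)) big_split /= prodr_const card_ord -expR_sum.
congr ((_ * expR _)%:C); rewrite /dotp -sumrN mulr_suml.
by apply: eq_bigr => j _; rewrite expr2.
Qed.

Definition c2pi : R := Num.sqrt (2 * pi) ^+ d.

Lemma c2pi_gt0 : 0 < c2pi.
Proof. by rewrite exprn_gt0// sqrtr_gt0 mulr_gt0// pi_gt0. Qed.

(** The heat kernel of half the Laplacian at time [1 / (n + 1)], up to the
    constant [c2pi]. *)
Definition heat (n : nat) (x : 'rV[R]_d) : R :=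
  Num.sqrt n.+1%:R ^+ d * gaussd n.+1%:R x.

Lemma heat_ge0 n x : 0 <= heat n x.
Proof. by rewrite mulr_ge0 ?gaussd_ge0// exprn_ge0// sqrtr_ge0. Qed.

Lemma measurable_heat n : measurable_fun setT (heat n).
Proof. by apply: measurable_funM => //; exact: measurable_gaussd. Qed.

Lemma Rintegral_gaussd t : 0 < t -> mu.-integrable setT (EFin \o gaussd t) /\
  \int[mu]_x gaussd t x = Num.sqrt (2 * pi / t) ^+ d.
Proof.
move=> t0; have [i e] := cint_gaussd 0 t0.
have E : (fun x => expi (dotp 0 x) * (gaussd t x)%:C) = (fun x => (gaussd t x)%:C).
  by apply/funext => x; rewrite dotp0l expi0 mul1r.
rewrite E in i e; split; first exact: i.1.
have := congr1 (@complex.Re R) e; rewrite /= => ->.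
by rewrite dotp0l oppr0 mul0r expR0 mulr1.
Qed.

Lemma cint_gauss_heat n s :
  cint mu (fun x => expi (dotp s x) * (gaussd (n.+1%:R^-1) x)%:C) =
  (c2pi * heat n s)%:C.
Proof.
rewrite (cint_gaussd _ _).2 ?invr_gt0// /heat /c2pi /gaussd invrK.
rewrite sqrtrM ?mulr_ge0 ?pi_ge0// exprMn -mulrA.
congr ((_ * (_ * expR _))%:C); by field.
Qed.

Lemma Rintegral_heat n a : mu.-integrable setT (EFin \o (fun x => heat n (x - a))) /\
  \int[mu]_x heat n (x - a) = c2pi.
Proof.
have i0 : mu.-integrable setT (EFin \o heat n).
  by apply: integrable_scale; exact: (@Rintegral_gaussd n.+1%:R (ltr0Sn _ _)).1.
have e0 : \int[mu]_x heat n x = c2pi.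
  have [i e] := @Rintegral_gaussd n.+1%:R (ltr0Sn _ _).
  by rewrite RintegralZl// e -exprMn -sqrtrM// mulrC divfK.
have ph := rV_shift_preserving (- a).
split; last first.
  rewrite -e0; exact: (Rintegral_preserving ph (measurable_heat n)).
have mh : measurable_fun setT (fun x : 'rV[R]_d => heat n (x - a)).
  exact: (measurableT_comp (measurable_heat n) ph.1).
apply/integrableP; split; first exact/measurable_EFinP.
have /integrableP[mi] := i0; apply: le_lt_trans; rewrite le_eqVlt; apply/orP; left.
apply/eqP; apply: (integral_preserving ph (f := fun x => `|(heat n x)%:E|%E)).
exact: measurableT_comp mi.
Qed.

(** Far from its centre the heat kernel is negligible against a fixed
    Gaussian; this is what allows functions of unknown growth. *)
Lemma heat_far (del : R) : 0 < del ->
  exists2 C : R, 0 < C & forall n x, del ^+ 2 <= dotp x x ->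
    heat n x <= C * harmonic n * gaussd 1 x.
Proof.
move=> del0.
pose b := del ^+ 2 / 2; have b0 : 0 < b by rewrite divr_gt0// exprn_gt0.
pose C := (1 + b^-1) ^+ d.+1 * d.+1%:R ^+ d.+1.
exists C; first by rewrite mulr_gt0// exprn_gt0// addr_gt0// invr_gt0.
move=> n x dx.
rewrite /heat (_ : gaussd n.+1%:R x = expR (- (n%:R / 2 * dotp x x)) * gaussd 1 x); last first.
  by rewrite /gaussd -expRD; congr expR; rewrite -natr1; field.
rewrite mulrA ler_wpM2r ?gaussd_ge0// /harmonic /= ler_pdivlMr//.
rewrite (@le_trans _ _ (n.+1%:R ^+ d * expR (- (b * n%:R)) * n.+1%:R))//.
  rewrite ler_wpM2r// ler_pM ?exprn_ge0 ?sqrtr_ge0 ?expR_ge0//.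
    rewrite lerXn2r ?nnegrE ?sqrtr_ge0//.
    rewrite -[leRHS](@sqr_sqrtr _ n.+1%:R)// expr2 ler_peMl ?sqrtr_ge0//.
    by rewrite -[leLHS]sqrtr1 ler_wsqrtr// ler1n.
  rewrite ler_expR lerN2 (_ : b * n%:R = n%:R / 2 * del ^+ 2); last by rewrite /b; field.
  by rewrite ler_wpM2l// divr_ge0.
rewrite mulrAC -exprSr expRN ler_pdivrMr ?expR_gt0// /C -mulrA.
apply: le_trans (_ : _ <= (1 + b^-1) ^+ d.+1 * (1 + b * n%:R) ^+ d.+1) _; last first.
  by rewrite ler_wpM2l ?exprn_ge0 ?addr_ge0 ?invr_ge0 ?(ltW b0)// pow_le_expR// mulr_ge0// ltW.
rewrite -exprMn lerXn2r ?nnegrE ?mulr_ge0 ?addr_ge0 ?invr_ge0 ?mulr_ge0 ?(ltW del0)//.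
rewrite -natr1 (_ : (1 + b^-1) * (1 + b * n%:R) = 1 + b^-1 + b * n%:R + n%:R); last first.
  by field; exact: lt0r_neq0.
have : 0 <= b^-1 by rewrite invr_ge0 ltW.
have : 0 <= b * n%:R by rewrite mulr_ge0// ltW.
by lra.
Qed.

Lemma heat0E x : heat 0 x = gaussd 1 x.
Proof. by rewrite /heat sqrtr1 expr1n mul1r. Qed.

Lemma ccontinuous_near (f : 'rV[R]_d -> R[i]) (a : 'rV[R]_d) (e : R) : ccontinuous f -> 0 < e ->
  exists2 del : R, 0 < del & forall x : 'rV[R]_d, (forall i, `|x ord0 i - a ord0 i| < del) ->
    cabs (f x - f a) <= e.
Proof.
move=> [cR cI] e0; have e20 : 0 < e / 2 by rewrite divr_gt0.
have := cR a; move/cvgrPdist_lt => /(_ _ e20); case/nbhs_ballP => d1 /= d10 h1.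
have := cI a; move/cvgrPdist_lt => /(_ _ e20); case/nbhs_ballP => d2 /= d20 h2.
exists (Num.min d1 d2); first by rewrite lt_min d10.
move=> x hx.
have b1 : ball a d1 x.
  by split => // i j; rewrite (ord1 i) /ball /= distrC (lt_le_trans (hx j))// ge_min lexx.
have b2 : ball a d2 x.
  by split => // i j; rewrite (ord1 i) /ball /= distrC (lt_le_trans (hx j))// ge_min lexx orbT.
rewrite (le_trans (cabs_le_norm _))// cReD cImD cReN cImN (splitr e) lerD//.
  by rewrite distrC ltW// h1.
by rewrite distrC ltW// h2.
Qed.

(** Only integrability of [f] against one fixed Gaussian is asked: close to [a]
    continuity is used, and elsewhere the heat kernel is a small multiple of
    that Gaussian. *)
Lemma approx_identity (f : 'rV[R]_d -> R[i]) a : ccontinuous f ->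
  cintg mu (fun x => f x * (gaussd 1 (x - a))%:C) ->
  forall e : R, 0 < e -> exists N, forall n, (N <= n)%N ->
    cabs (cint mu (fun x => f x * (heat n (x - a))%:C) - c2pi%:C * f a) <= e.
Proof.
move=> cf fi e e0.
pose g x := f x - f a.
have mf : cmeas f by exact: ccontinuous_cmeas.
have mg : cmeas g by apply: cmeasB => //; exact: cmeas_cst.
have mh n : measurable_fun setT (fun x : 'rV[R]_d => heat n (x - a)).
  exact: (measurableT_comp (measurable_heat n) (rV_shift_preserving (- a)).1).
pose A := \int[mu]_x (cabs (g x) * gaussd 1 (x - a)).
have iA : mu.-integrable setT (EFin \o (fun x => cabs (g x) * gaussd 1 (x - a))).
  have i1 := cintg_cabs fi.
  have i2 := integrable_scale (cabs (f a)) (Rintegral_heat 0 a).1.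
  apply: le_integrable (integrableD measurableT i1 i2) => //.
    apply/measurable_EFinP; apply: measurable_funM; first exact: measurable_cabs.
    by under eq_fun do rewrite -heat0E; exact: mh.
  move=> x _ /=; rewrite lee_fin cabsM cabs_real heat0E.
  rewrite (ger0_norm (gaussd_ge0 _ _)) !ger0_norm ?addr_ge0 ?mulr_ge0 ?cabs_ge0 ?gaussd_ge0//.
  by rewrite -mulrDl ler_wpM2r ?gaussd_ge0// cabsB.
have c0 := c2pi_gt0.
have e10 : 0 < e / (2 * c2pi) by rewrite divr_gt0// mulr_gt0.
have [del del0 fdel] := ccontinuous_near a cf e10.
have [C C0 far] := heat_far del0.
have A0 : 0 <= A by apply: Rintegral_ge0 => x _; rewrite mulr_ge0 ?cabs_ge0 ?gaussd_ge0.
have bound n x : cabs (g x * (heat n (x - a))%:C) <=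
    e / (2 * c2pi) * heat n (x - a) + C * harmonic n * (cabs (g x) * gaussd 1 (x - a)).
  rewrite cabsM cabs_real (ger0_norm (heat_ge0 _ _)).
  have [near|] := pselect (forall i, `|x ord0 i - a ord0 i| < del).
    rewrite (@le_trans _ _ (e / (2 * c2pi) * heat n (x - a)))//.
      by rewrite ler_wpM2r ?heat_ge0// fdel.
    by rewrite lerDl !mulr_ge0 ?cabs_ge0 ?gaussd_ge0 ?invr_ge0// ltW.
  move=> /existsNP[i /negP]; rewrite -leNgt => xi.
  rewrite [C * _ * (_ * _)]mulrCA (@le_trans _ _ (cabs (g x) * (C * harmonic n * gaussd 1 (x - a))))//.
    rewrite ler_wpM2l ?cabs_ge0// far// (le_trans _ (sqr_coord_le _ i))//.
    rewrite -[leRHS]real_normK ?num_real// lerXn2r ?nnegrE ?(ltW del0)//.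
    by rewrite !mxE.
  by rewrite lerDr mulr_ge0 ?heat_ge0 ?(ltW e10).
have ib n : mu.-integrable setT (EFin \o (fun x =>
    e / (2 * c2pi) * heat n (x - a) + C * harmonic n * (cabs (g x) * gaussd 1 (x - a)))).
  by apply: integrable_add; apply: integrable_scale => //; exact: (Rintegral_heat _ _).1.
have ig n : cintg mu (fun x => g x * (heat n (x - a))%:C).
  apply: cintg_le (ib n) (bound n).
  by apply: cmeasM => //; exact: cmeas_real.
have ih n : cintg mu (fun x => (heat n (x - a))%:C).
  apply: (cintg_le _ (Rintegral_heat n a).1); first exact: cmeas_real.
  by move=> x; rewrite cabs_real ger0_norm ?heat_ge0.
have E n : cint mu (fun x => f x * (heat n (x - a))%:C) - c2pi%:C * f a =
    cint mu (fun x => g x * (heat n (x - a))%:C).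
  have -> : c2pi%:C * f a = cint mu (fun x => f a * (heat n (x - a))%:C).
    rewrite cintZ// mulrC; congr (_ * _); apply: complex_ext => /=.
      by rewrite (Rintegral_heat n a).2.
    by rewrite Rintegral_cst// mul0r.
  apply/eqP; rewrite subr_eq -cintD//; last exact: cintgZ.
  by apply/eqP; apply: eq_cint => x; rewrite /g; ring.
exists (Num.truncn (2 * C * A / e)) => n Nn; rewrite E.
rewrite (le_trans (cabs_cint (ig n)))//.
rewrite (@le_trans _ _ (e / (2 * c2pi) * c2pi + C * harmonic n * A))//.
  rewrite -{2}(Rintegral_heat n a).2 -!RintegralZl//; last exact: (Rintegral_heat _ _).1.
  rewrite -RintegralD//; [|by apply: integrable_scale; exact: (Rintegral_heat _ _).1|exact: integrable_scale].
  apply: le_Rintegral => //; first exact: cintg_cabs.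
have -> : e / (2 * c2pi) * c2pi = e / 2 by field; exact: lt0r_neq0.
rewrite [leRHS](splitr e) lerD2l /harmonic /= mulrAC ler_pdivrMr//.
rewrite [leRHS]mulrC -ler_pdivrMr ?divr_gt0//.
rewrite (_ : C * A / (e / 2) = 2 * C * A / e); last by field; exact: lt0r_neq0.
by rewrite (le_trans (ltW (truncnS_gt _)))// ler_nat ltnS.
Qed.

End gaussian.
Arguments c2pi {R} d.

(** * Transforms of weighted integrable densities *)

Section wiener_space.
Context {R : realType} {d : nat}.
Local Notation mu := (lebesgue_rV R d).
Implicit Types (x xi eta : 'rV[R]_d) (f g : 'rV[R]_d -> R[i]) (rho : R) (n : nat).

(** The Fourier weight of the norms of the theorem, with the bracket doubled: an
    equivalent choice for each [n], but submultiplicative with constant [1]. *)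
Definition wt rho n xi : R := expR (rho * japanese xi) * (2 * japanese xi) ^+ n.

Lemma two_japanese_ge1 xi : 1 <= 2 * japanese xi.
Proof. by have := japanese_ge1 xi; lra. Qed.

Lemma wt_ge0 rho n xi : 0 <= wt rho n xi.
Proof. by rewrite mulr_ge0 ?expR_ge0// exprn_ge0// mulr_ge0// japanese_ge0. Qed.

Lemma wt_ge1 rho n xi : 0 <= rho -> 1 <= wt rho n xi.
Proof.
move=> rho0; rewrite -[1]mul1r ler_pM// ?exprn_ege1 ?two_japanese_ge1//.
by rewrite -[1]expR0 ler_expR mulr_ge0// japanese_ge0.
Qed.

Lemma wtS rho n xi : wt rho n.+1 xi = 2 * japanese xi * wt rho n xi.
Proof. by rewrite /wt exprS mulrCA. Qed.

Lemma coord_wt rho n xi i : `|xi ord0 i| * wt rho n xi <= wt rho n.+1 xi.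
Proof.
rewrite wtS ler_wpM2r ?wt_ge0// (le_trans (coord_le_japanese _ _))//.
by rewrite ler_peMl ?japanese_ge0// ler1n.
Qed.

Lemma wtN rho n xi : wt rho n (- xi) = wt rho n xi.
Proof. by rewrite /wt japaneseN. Qed.

(** The factor 2 makes the weight submultiplicative with constant 1, because
    [a + b <= a * b] for [a, b >= 2]. *)
Lemma wtD rho n xi eta : 0 <= rho ->
  wt rho n (xi + eta) <= wt rho n xi * wt rho n eta.
Proof.
move=> rho0; rewrite /wt mulrACA -expRD -exprMn.
have := japanese_ge1 xi; have := japanese_ge1 eta.
have := japaneseD xi eta; have := japanese_ge0 (xi + eta).
set a := japanese xi; set b := japanese eta; set c := japanese (xi + eta).
move=> c0 cab b1 a1; apply: ler_pM; rewrite ?expR_ge0 ?exprn_ge0 ?mulr_ge0//.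
  by rewrite ler_expR -mulrDr ler_wpM2l.
rewrite lerXn2r ?nnegrE ?mulr_ge0//; first by lra.
  by lra.
by nra.
Qed.

Lemma measurable_wt rho n : measurable_fun setT (wt rho n).
Proof.
apply: measurable_funM.
  apply: (measurableT_comp (@measurable_expR R)); apply: measurable_funM => //.
  exact: measurable_japanese.
by apply: measurable_funX; apply: measurable_funM => //; exact: measurable_japanese.
Qed.

Definition wnorm rho n g : \bar R := (\int[mu]_xi (wt rho n xi * cabs (g xi))%:E)%E.

Definition ift g x : R[i] := cint mu (fun xi => expi (dotp x xi) * g xi).

(** [f] is the transform of a density all of whose weighted norms are bounded by
    the sequence [K].  Since a smaller radius costs only a constant, all powers of
    the bracket are controlled at once and derivatives merely shift [K].  An
    explicit sequence of bounds keeps the estimates uniform in the functions. *)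
Definition wiener rho (K : nat -> R) f := exists g, [/\ cmeas g,
  (forall n, (wnorm rho n g <= (K n)%:E)%E) & f = ift g].

Lemma wnorm_ge0 rho n g : (0 <= wnorm rho n g)%E.
Proof. by apply: integral_ge0 => x _; rewrite lee_fin mulr_ge0 ?wt_ge0 ?cabs_ge0. Qed.

Lemma wiener_ge0 rho K f : wiener rho K f -> forall n, 0 <= K n.
Proof. by move=> [g [_ gK _]] n; rewrite -lee_fin (le_trans _ (gK n))// wnorm_ge0. Qed.

Lemma measurable_wt_cabs rho n g : cmeas g ->
  measurable_fun setT (fun xi => wt rho n xi * cabs (g xi)).
Proof.
by move=> mg; apply: measurable_funM; [exact: measurable_wt|exact: measurable_cabs].
Qed.

Lemma wnorm_integrable rho n g : cmeas g -> (wnorm rho n g < +oo)%E ->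
  mu.-integrable setT (EFin \o (fun xi => wt rho n xi * cabs (g xi))).
Proof.
move=> mg goo; apply/integrableP; split.
  by apply/measurable_EFinP; exact: measurable_wt_cabs.
move: goo; rewrite /wnorm; apply: le_lt_trans; rewrite le_eqVlt; apply/orP; left.
apply/eqP; apply: eq_integral => x _.
by rewrite /= ger0_norm// mulr_ge0 ?wt_ge0 ?cabs_ge0.
Qed.

Lemma cmeas_ift g x : cmeas g -> cmeas (fun xi => expi (dotp x xi) * g xi).
Proof.
by move=> mg; apply: cmeasM => //; apply: cmeas_expi; exact: measurable_dotp.
Qed.

Lemma wnorm_cintg rho n g : 0 <= rho -> cmeas g -> (wnorm rho n g < +oo)%E -> cintg mu g.
Proof.
move=> rho0 mg /(wnorm_integrable mg) gi; apply: cintg_le gi _ => // xi.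
by rewrite ler_peMl ?cabs_ge0// wt_ge1.
Qed.

Lemma cintg_ift g x : cintg mu g -> cintg mu (fun xi => expi (dotp x xi) * g xi).
Proof.
move=> gi; apply: (cintg_le _ (cintg_cabs gi)).
  by apply: cmeas_ift; exact: cintg_meas gi.
by move=> xi; rewrite cabsM cabs_expi mul1r.
Qed.

Lemma wiener_cintg rho K g : 0 <= rho -> cmeas g ->
  (forall n, (wnorm rho n g <= (K n)%:E)%E) -> cintg mu g.
Proof.
move=> rho0 mg gK; apply: (@wnorm_cintg rho 0%N) => //.
by rewrite (le_lt_trans (gK 0%N))// ltry.
Qed.

Lemma wiener_le rho K K' f : (forall n, K n <= K' n) -> wiener rho K f -> wiener rho K' f.
Proof.
move=> KK' [g [mg gK ->]]; exists g; split => // n.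
by rewrite (le_trans (gK n))// lee_fin.
Qed.

Lemma wiener0 rho : wiener rho (fun=> 0) (fun=> 0).
Proof.
exists (fun=> 0); split; first exact: cmeas_cst.
  move=> n; rewrite /wnorm; under eq_integral do rewrite cabs0 mulr0.
  by rewrite integral0.
apply/funext => x; rewrite /ift; under eq_cint do rewrite mulr0.
by apply: complex_ext; rewrite /= Rintegral_cst// mul0r.
Qed.

Lemma wienerD rho K1 K2 f1 f2 : 0 <= rho -> wiener rho K1 f1 -> wiener rho K2 f2 ->
  wiener rho (fun n => K1 n + K2 n) (fun x => f1 x + f2 x).
Proof.
move=> rho0 [g1 [m1 b1 ->]] [g2 [m2 b2 ->]].
exists (fun xi => g1 xi + g2 xi); split; first exact: cmeasD.
  move=> n; rewrite EFinD; apply: le_trans (leeD (b1 n) (b2 n)).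
  rewrite /wnorm -ge0_integralD//; first last.
  - by apply/measurable_EFinP; exact: measurable_wt_cabs.
  - by move=> x _; rewrite lee_fin mulr_ge0 ?wt_ge0 ?cabs_ge0.
  - by apply/measurable_EFinP; exact: measurable_wt_cabs.
  - by move=> x _; rewrite lee_fin mulr_ge0 ?wt_ge0 ?cabs_ge0.
  apply: ge0_le_integral => //.
  - by move=> x _; rewrite lee_fin mulr_ge0 ?wt_ge0 ?cabs_ge0.
  - by apply/measurable_EFinP; apply: measurable_wt_cabs; exact: cmeasD.
  - by apply/measurable_EFinP; apply: measurable_funD; exact: measurable_wt_cabs.
  - by move=> x _; rewrite -EFinD lee_fin -mulrDr ler_wpM2l ?wt_ge0// cabsD.
apply/funext => x; rewrite /ift -cintD.
- by apply: eq_cint => xi; rewrite mulrDr.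
- exact: cintg_ift (wiener_cintg rho0 m1 b1).
- exact: cintg_ift (wiener_cintg rho0 m2 b2).
Qed.

Lemma wnormZ rho n g (c r : R) (h : 'rV[R]_d -> R[i]) : 0 <= c -> cmeas g ->
  (forall xi, cabs (h xi) = c * cabs (g xi)) -> (wnorm rho n g <= r%:E)%E ->
  (wnorm rho n h <= (c * r)%:E)%E.
Proof.
move=> c0 mg hg gr; rewrite /wnorm; under eq_integral do rewrite hg mulrCA EFinM.
rewrite ge0_integralZl//.
- by rewrite EFinM lee_wpmul2l.
- by apply/measurable_EFinP; exact: measurable_wt_cabs.
- by move=> x _; rewrite lee_fin mulr_ge0 ?wt_ge0 ?cabs_ge0.
Qed.

Lemma wienerZ rho K f (c : R[i]) : 0 <= rho -> wiener rho K f ->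
  wiener rho (fun n => cabs c * K n) (fun x => c * f x).
Proof.
move=> rho0 [g [mg gK ->]]; exists (fun xi => c * g xi); split.
- by apply: cmeasM => //; exact: cmeas_cst.
- by move=> n; exact: (wnormZ (cabs_ge0 c) mg (fun xi => cabsM c (g xi)) (gK n)).
- apply/funext => x; rewrite /ift -cintZ; last exact: cintg_ift (wiener_cintg rho0 mg gK).
  by apply: eq_cint => xi; rewrite mulrCA.
Qed.

(** Conjugation of the function is conjugation and reflection of the density. *)
Lemma wiener_conj rho K f : 0 <= rho -> wiener rho K f ->
  wiener rho K (fun x => (f x)^*)%C.
Proof.
move=> rho0 [g [mg gK ->]].
have mo := @rV_opp_preserving R d.
exists (fun xi => (g (- xi))^*)%C; split.
- by apply: cmeas_conj; exact: (cmeas_comp mo.1 mg).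
- move=> n; apply: le_trans (gK n); rewrite le_eqVlt; apply/orP; left; apply/eqP.
  rewrite /wnorm -(integral_preserving mo (f := fun xi => (wt rho n xi * cabs (g xi))%:E)).
    by apply: eq_integral => xi _; rewrite cabs_conj wtN.
  by apply/measurable_EFinP; exact: measurable_wt_cabs.
- apply/funext => x; rewrite /ift -cint_conj; last exact: cintg_ift (wiener_cintg rho0 mg gK).
  rewrite -(cint_preserving mo); last by apply: cmeas_conj; exact: cmeas_ift.
  by apply: eq_cint => xi; rewrite conj_cM conj_expi dotpNr opprK.
Qed.

Lemma wiener_Re rho K f : 0 <= rho -> wiener rho K f ->
  wiener rho K (fun x => (complex.Re (f x))%:C).
Proof.
move=> rho0 fK.
have := wienerZ (2^-1)%:C rho0 (wienerD rho0 fK (wiener_conj rho0 fK)).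
rewrite (_ : (fun x => _) = (fun x => (complex.Re (f x))%:C)).
  apply: wiener_le => n; rewrite cabs_real ger0_norm ?invr_ge0//.
  by rewrite -mulr2n -[K n *+ 2]mulr_natl mulrA mulVf ?mul1r ?pnatr_eq0.
by apply/funext => x; apply: complex_ext;
  rewrite ?cReM ?cImM ?cReD ?cImD ?cRe_conj ?cIm_conj /=; field.
Qed.

End wiener_space.

(** * Products and derivatives of transforms *)

Section wiener_product.
Context {R : realType} {d : nat}.
Local Notation mu := (lebesgue_rV R d).
Variables (g1 g2 : 'rV[R]_d -> R[i]).
Hypothesis (m1 : cmeas g1) (m2 : cmeas g2).

Definition conv (eta : 'rV[R]_d) : R[i] := cint mu (fun xi => g1 xi * g2 (eta - xi)).

Let H (z : 'rV[R]_d * 'rV[R]_d) : R[i] := g1 z.1 * g2 (z.2 - z.1).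

Let wt00 (xi : 'rV[R]_d) : wt 0 0 xi = 1.
Proof. by rewrite /wt mul0r expR0 expr0 mulr1. Qed.

Let mH : cmeas H.
Proof.
apply: cmeasM; first exact: (cmeas_comp measurable_fst m1).
apply: cmeas_comp m2; apply: measurable_rV_sub.
  exact: measurable_snd.
exact: measurable_fst.
Qed.

Let mHx (eta : 'rV[R]_d) : cmeas (fun xi => g1 xi * g2 (eta - xi)).
Proof.
apply: cmeasM => //; apply: cmeas_comp m2.
exact: (rV_reflect_preserving eta).1.
Qed.

Let mHy (xi : 'rV[R]_d) : cmeas (fun eta : 'rV[R]_d => g1 xi * g2 (eta - xi)).
Proof.
apply: cmeasM; first exact: cmeas_cst.
exact: (cmeas_comp (rV_shift_preserving (- xi)).1 m2).
Qed.

(** Tonelli's theorem, after the weight at [eta] has been split between [xi] and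
    [eta - xi]. *)
Lemma wnorm_conv rho n : 0 <= rho ->
  (\int[mu]_xi \int[mu]_eta (wt rho n eta * cabs (H (xi, eta)))%:E <=
   wnorm rho n g1 * wnorm rho n g2)%E.
Proof.
move=> rho0.
have mw2 : measurable_fun setT (fun eta => (wt rho n eta * cabs (g2 eta))%:E).
  by apply/measurable_EFinP; exact: measurable_wt_cabs.
have inner xi : (\int[mu]_eta (wt rho n eta * cabs (H (xi, eta)))%:E <=
    (wt rho n xi * cabs (g1 xi))%:E * wnorm rho n g2)%E.
  have ms := rV_shift_preserving (- xi).
  rewrite /wnorm -(integral_preserving ms mw2) -ge0_integralZl//; first last.
  - by rewrite lee_fin mulr_ge0 ?wt_ge0 ?cabs_ge0.
  - by move=> x _; rewrite lee_fin mulr_ge0 ?wt_ge0 ?cabs_ge0.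
  - exact: (measurableT_comp mw2 ms.1).
  apply: ge0_le_integral => //.
  - by move=> x _; rewrite lee_fin mulr_ge0 ?wt_ge0 ?cabs_ge0.
  - apply/measurable_EFinP; apply: measurable_wt_cabs.
    exact: mHy.
  - apply/measurable_EFinP; apply: measurable_funM => //.
    exact: (measurableT_comp (measurable_wt_cabs rho n m2) ms.1).
  - move=> eta _; rewrite -EFinM lee_fin /H /= cabsM.
    rewrite [leRHS]mulrACA ler_wpM2r ?mulr_ge0 ?cabs_ge0//.
    by rewrite -{1}(subrK xi eta) addrC wtD.
apply: (@le_trans _ _ (\int[mu]_xi ((wt rho n xi * cabs (g1 xi))%:E * wnorm rho n g2))%E).
  apply: ge0_le_integral => //.
  - by move=> x _; apply: integral_ge0 => y _; rewrite lee_fin mulr_ge0 ?wt_ge0 ?cabs_ge0.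
  - apply: (@measurable_fun_fubini_tonelli_F _ _ _ _ _ mu
       (fun z => (wt rho n z.2 * cabs (H z))%:E)).
      apply/measurable_EFinP; apply: measurable_funM; last exact: measurable_cabs.
      exact: (measurableT_comp (measurable_wt rho n) measurable_snd).
    by move=> z; rewrite lee_fin mulr_ge0 ?wt_ge0 ?cabs_ge0.
  - apply: emeasurable_funM => //; apply/measurable_EFinP; exact: measurable_wt_cabs.
rewrite ge0_integralZr//.
- by apply/measurable_EFinP; exact: measurable_wt_cabs.
- by move=> x _; rewrite lee_fin mulr_ge0 ?wt_ge0 ?cabs_ge0.
- exact: wnorm_ge0.
Qed.

Hypotheses (i1 : cintg mu g1) (i2 : cintg mu g2).

Let iH : cintg (mu \x mu)%E H.
Proof.
apply: cintg_prod => //.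
have := @wnorm_conv 0 0%N (lexx 0).
rewrite (_ : (\int[mu]_xi _)%E = (\int[mu]_xi \int[mu]_eta (cabs (H (xi, eta)))%:E)%E).
  move=> /le_lt_trans; apply.
  have fin g : cintg mu g -> (wnorm 0 0 g < +oo)%E.
    move=> /cintg_lty; apply: le_lt_trans; rewrite le_eqVlt; apply/orP; left.
    by apply/eqP; apply: eq_integral => x _; rewrite wt00 mul1r.
  by apply: lte_mul_pinfty; [exact: wnorm_ge0| |exact: fin];
    rewrite ge0_fin_numE ?wnorm_ge0// fin.
by apply: eq_integral => x _; apply: eq_integral => y _; rewrite wt00 mul1r.
Qed.

Lemma cmeas_conv : cmeas conv.
Proof. by have [_ h _] := cint_fubini iH; exact: cintg_meas h. Qed.

Lemma wnorm_conv_le rho n : 0 <= rho ->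
  (wnorm rho n conv <= wnorm rho n g1 * wnorm rho n g2)%E.
Proof.
move=> rho0; apply: le_trans (wnorm_conv n rho0).
pose F (z : 'rV[R]_d * 'rV[R]_d) := (wt rho n z.2 * cabs (H z))%:E.
have F0 z : (0 <= F z)%E by rewrite lee_fin mulr_ge0 ?wt_ge0 ?cabs_ge0.
have mF : measurable_fun setT F.
  apply/measurable_EFinP; apply: measurable_funM; last exact: measurable_cabs.
  exact: (measurableT_comp (measurable_wt rho n) measurable_snd).
rewrite (fubini_tonelli F mF F0).
apply: ge0_le_integral => //.
- by move=> x _; rewrite lee_fin mulr_ge0 ?wt_ge0 ?cabs_ge0.
- by apply/measurable_EFinP; apply: measurable_wt_cabs; exact: cmeas_conv.
- exact: measurable_fun_fubini_tonelli_G.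
move=> eta _; under eq_integral => xi _ do rewrite /F /H /= EFinM.
rewrite ge0_integralZl//.
- by rewrite EFinM lee_wpmul2l ?lee_fin ?wt_ge0// EFin_cabs_cint.
- by apply/measurable_EFinP; apply: measurable_cabs; exact: mHx.
- by move=> x _; rewrite lee_fin cabs_ge0.
- by rewrite lee_fin wt_ge0.
Qed.

(** The convolution converges only for almost every frequency, so the two sides
    are first compared almost everywhere under the integral. *)
Lemma ift_conv x : ift conv x = ift g1 x * ift g2 x.
Proof.
pose G (z : 'rV[R]_d * 'rV[R]_d) := expi (dotp x z.2) * H z.
have mG : cmeas G.
  apply: cmeasM => //; apply: cmeas_expi.
  exact: (measurable_dotp (@measurable_cst _ _ _ _ _ x) measurable_snd).
have iG : cintg (mu \x mu)%E G.
  by apply: (cintg_le mG (cintg_cabs iH)) => z; rewrite cabsM cabs_expi mul1r.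
have [_ _ E] := cint_fubini iG.
transitivity (cint mu (fun eta => cint mu (fun xi => G (xi, eta)))).
  apply: (@cint_eq_ae _ _ _ mu (fun eta => expi (dotp x eta) * conv eta)
    (fun eta => cint mu (fun xi => G (xi, eta)))).
  - by apply: cmeas_ift; exact: cmeas_conv.
  - by have [_ h _] := cint_fubini iG; exact: cintg_meas h.
  have := ae_integrable2 (cintg_cabs iH).
  apply: filterS => eta ieta.
  have ih : cintg mu (fun xi => g1 xi * g2 (eta - xi)).
    by apply: (cintg_le (mHx eta) ieta) => xi; exact: lexx.
  by rewrite -(cintZ (expi (dotp x eta)) ih).
rewrite -E /ift -cintZr; last exact: cintg_ift.
apply: eq_cint => xi; rewrite /G /H /=.
under eq_cint => eta.
  rewrite -{1}(subrK xi eta) dotpDr expiD (_ : _ * _ = (expi (dotp x xi) * g1 xi) *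
     (expi (dotp x (eta - xi)) * g2 (eta - xi))); last by ring.
  over.
rewrite cintZ; last first.
  exact: (cintg_preserving (rV_shift_preserving (- xi)) (cintg_ift x i2)).
congr (_ * _).
exact: (cint_preserving (rV_shift_preserving (- xi)) (cmeas_ift x m2)).
Qed.

End wiener_product.

Section wiener_algebra.
Context {R : realType} {d : nat}.
Local Notation mu := (lebesgue_rV R d).

(** The constant is exactly one; hence powers have geometrically bounded
    constants and power series can be summed. *)
Lemma wienerM rho K1 K2 (f1 f2 : 'rV[R]_d -> R[i]) : 0 <= rho ->
  wiener rho K1 f1 -> wiener rho K2 f2 ->
  wiener rho (fun n => K1 n * K2 n) (fun x => f1 x * f2 x).
Proof.
move=> rho0 [g1 [m1 b1 ->]] [g2 [m2 b2 ->]].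
have i1 := wiener_cintg rho0 m1 b1; have i2 := wiener_cintg rho0 m2 b2.
exists (conv g1 g2); split; first exact: cmeas_conv.
  move=> n; apply: le_trans (wnorm_conv_le m1 m2 i1 i2 n rho0) _.
  by rewrite EFinM lee_pmul// wnorm_ge0.
by apply/funext => x; rewrite ift_conv.
Qed.

Lemma wiener_exp rho K (f : 'rV[R]_d -> R[i]) k : 0 <= rho -> wiener rho K f ->
  wiener rho (fun n => K n ^+ k.+1) (fun x => f x ^+ k.+1).
Proof.
move=> rho0 fK; elim: k => [|k IH]; first by [].
under [X in wiener _ X _]eq_fun do rewrite exprS.
under [X in wiener _ _ X]eq_fun do rewrite exprS.
exact: wienerM.
Qed.

(** A quadratic remainder in the step is what the Taylor bound on [expi] gives
    after integration, and it asks nothing of a candidate derivative. *)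
Lemma derive_quadratic (V : normedModType R) (F : V -> R) (x v : V) (L C : R) :
  (forall h : R, `|F (h *: v + x) - F x - h * L| <= C * h ^+ 2) ->
  derivable F x v /\ 'D_v F x = L.
Proof.
move=> FC.
suff FL : h^-1 *: ((F \o shift x) (h *: v) - F x) @[h --> 0^'] --> L.
  by split; [apply/cvg_ex; exists L|exact/cvg_lim].
have C0 : 0 <= C by have := FC 1; rewrite expr1n mulr1; apply: le_trans.
apply/cvgrPdist_le => e e0; near=> h.
have h0 : h != 0 by near: h; exact: nbhs_dnbhs_neq.
rewrite /= /GRing.scale /= distrC.
have -> : h^-1 * (F (h *: v + x) - F x) - L = h^-1 * (F (h *: v + x) - F x - h * L).
  by field.
rewrite normrM normfV mulrC ler_pdivrMr ?normr_gt0// (le_trans (FC h))//.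
rewrite -real_normK ?num_real// expr2 mulrA ler_wpM2r//.
rewrite (@le_trans _ _ ((C + 1) * `|h|))//; first by rewrite ler_wpM2r// lerDl.
rewrite mulrC -ler_pdivlMr; last by rewrite ltr_wpDl.
near: h; apply: dnbhs0_le; by rewrite divr_gt0// ltr_wpDl.
Unshelve. all: end_near. Qed.

Definition Xmul (i : 'I_d) (g : 'rV[R]_d -> R[i]) (xi : 'rV[R]_d) : R[i] :=
  (0 +i* xi ord0 i) * g xi.

Lemma cmeas_Xmul i g : cmeas g -> cmeas (Xmul i g).
Proof.
move=> mg; apply: cmeasM => //; split => /=; first exact: measurable_cst.
exact: measurable_rV_coord.
Qed.

Lemma cabs_i (r : R) : cabs (0 +i* r) = `|r|.
Proof. by rewrite cabsE /= expr0n /= add0r sqrtr_sqr. Qed.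

Lemma wnorm_Xmul rho n i g (r : R) : cmeas g -> (wnorm rho n.+1 g <= r%:E)%E ->
  (wnorm rho n (Xmul i g) <= r%:E)%E.
Proof.
move=> mg; apply: le_trans; apply: ge0_le_integral => //.
- by move=> x _; rewrite lee_fin mulr_ge0 ?wt_ge0 ?cabs_ge0.
- by apply/measurable_EFinP; apply: measurable_wt_cabs; exact: cmeas_Xmul.
- by apply/measurable_EFinP; exact: measurable_wt_cabs.
- move=> xi _; rewrite lee_fin /Xmul cabsM cabs_i mulrA ler_wpM2r ?cabs_ge0//.
  by rewrite mulrC coord_wt.
Qed.

(** The Taylor remainder of [expi] is bounded by the square of the frequency,
    which the second weighted norm integrates. *)
Lemma ift_derive rho K g (i : 'I_d) x : 0 <= rho -> cmeas g ->
  (forall n, (wnorm rho n g <= (K n)%:E)%E) ->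
  cderivable (delta_mx ord0 i) (ift g) x /\ partial i (ift g) x = ift (Xmul i g) x.
Proof.
move=> rho0 mg gK.
have gi := wiener_cintg rho0 mg gK.
have mX := cmeas_Xmul i mg.
have gX : cintg mu (Xmul i g).
  apply: (@wiener_cintg _ _ rho (fun n => K n.+1)) => // n; exact: wnorm_Xmul.
have key h : cabs (ift g (h *: delta_mx ord0 i + x) - ift g x - h%:C * ift (Xmul i g) x)
    <= 2 * fine (wnorm rho 2 g) * h ^+ 2.
  have -> : ift g (h *: delta_mx ord0 i + x) - ift g x - h%:C * ift (Xmul i g) x =
    cint mu (fun xi => expi (dotp x xi) * g xi *
       (expi (h * xi ord0 i) - 1 - 0 +i* (h * xi ord0 i))).
    rewrite /ift -cintZ; last exact: cintg_ift.
    rewrite -cintB; [|exact: cintg_ift|exact: cintg_ift].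
    rewrite -cintB; [|by apply: cintgB; exact: cintg_ift|by apply: cintgZ; exact: cintg_ift].
    apply: eq_cint => xi; rewrite dotpDl dotpZl dotp_delta expiD /Xmul.
    have -> : 0 +i* (h * xi ord0 i) = h%:C * (0 +i* xi ord0 i) :> R[i].
      by apply: complex_ext; rewrite ?cReM ?cImM /=; ring.
    ring.
  have iw : mu.-integrable setT (EFin \o (fun xi => wt rho 2 xi * cabs (g xi))).
    by apply: wnorm_integrable => //; rewrite (le_lt_trans (gK 2%N))// ltry.
  have ib := integrable_scale (2 * h ^+ 2) iw.
  have mF : cmeas (fun xi : 'rV[R]_d => expi (dotp x xi) * g xi *
       (expi (h * xi ord0 i) - 1 - 0 +i* (h * xi ord0 i))).
    have mc : measurable_fun setT (fun xi : 'rV[R]_d => h * xi ord0 i).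
      by apply: measurable_funM => //; exact: measurable_rV_coord.
    apply: cmeasM; first exact: cmeas_ift.
    apply: cmeasB; last by split => //=; exact: measurable_cst.
    by apply: cmeasB; [exact: cmeas_expi|exact: cmeas_cst].
  have Fb xi : cabs (expi (dotp x xi) * g xi *
       (expi (h * xi ord0 i) - 1 - 0 +i* (h * xi ord0 i))) <=
       2 * h ^+ 2 * (wt rho 2 xi * cabs (g xi)).
    rewrite 2!cabsM cabs_expi mul1r mulrC mulrA ler_wpM2r ?cabs_ge0//.
    rewrite (le_trans (cabs_expi_taylor _))// -mulrA ler_wpM2l// exprMn ler_wpM2l ?sqr_ge0//.
    rewrite /wt (@le_trans _ _ (1 * (2 * japanese xi) ^+ 2))//; last first.
      by rewrite ler_wpM2r ?sqr_ge0// -[1]expR0 ler_expR mulr_ge0// japanese_ge0.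
    rewrite mul1r (le_trans (sqr_coord_le xi i))// exprMn japanese_sqr.
    by have := dotp_ge0 xi; lra.
  rewrite (le_trans (cabs_cint (cintg_le mF ib Fb)))//.
  rewrite (@le_trans _ _ (\int[mu]_xi (2 * h ^+ 2 * (wt rho 2 xi * cabs (g xi)))))//.
    apply: le_Rintegral => //; apply: cintg_cabs; exact: cintg_le mF ib Fb.
  by rewrite RintegralZl// mulrAC.
pose B := 2 * fine (wnorm rho 2 g).
have kR h : `|complex.Re (ift g (h *: delta_mx ord0 i + x)) - complex.Re (ift g x) -
    h * complex.Re (ift (Xmul i g) x)| <= B * h ^+ 2.
  apply: le_trans (key h); apply: le_trans (normr_cRe _).
  by rewrite !cReD !cReN cReM [complex.Im h%:C]/= mul0r subr0.
have kI h : `|complex.Im (ift g (h *: delta_mx ord0 i + x)) - complex.Im (ift g x) -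
    h * complex.Im (ift (Xmul i g) x)| <= B * h ^+ 2.
  apply: le_trans (key h); apply: le_trans (normr_cIm _).
  by rewrite !cImD !cImN cImM [complex.Im h%:C]/= mul0r addr0.
have [dR eR] := @derive_quadratic 'rV[R]_d (fun y => complex.Re (ift g y)) _ _ _ _ kR.
have [dI eI] := @derive_quadratic 'rV[R]_d (fun y => complex.Im (ift g y)) _ _ _ _ kI.
split; first by split.
by rewrite /partial /cderive eR eI; apply: complex_ext.
Qed.

End wiener_algebra.

(** * Smoothness, completeness and the exponential *)

Section wiener_smooth.
Context {R : realType} {d : nat}.
Local Notation mu := (lebesgue_rV R d).
Variable rho : R.
Hypothesis rho0 : 0 <= rho.

Lemma wiener_derive K (f : 'rV[R]_d -> R[i]) i x : wiener rho K f ->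
  cderivable (delta_mx ord0 i) f x.
Proof. by move=> [g [mg gK ->]]; exact: (ift_derive i x rho0 mg gK).1. Qed.

Lemma wiener_partial K (f : 'rV[R]_d -> R[i]) i : wiener rho K f ->
  wiener rho (fun n => K n.+1) (partial i f).
Proof.
move=> [g [mg gK ->]]; exists (Xmul i g); split; first exact: cmeas_Xmul.
  by move=> n; exact: wnorm_Xmul.
by apply/funext => x; exact: (ift_derive i x rho0 mg gK).2.
Qed.

Lemma wiener_lipschitz K (f : 'rV[R]_d -> R[i]) : wiener rho K f ->
  forall x y, cabs (f x - f y) <= 2 * K 1%N * \sum_i `|x ord0 i - y ord0 i|.
Proof.
move=> [g [mg gK ->]] x y.
have gi := wiener_cintg rho0 mg gK.
rewrite /ift -cintB; [|exact: cintg_ift|exact: cintg_ift].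
set D := \sum_i _.
have D0 : 0 <= D by apply: sumr_ge0.
have iw : mu.-integrable setT (EFin \o (fun xi => wt rho 1 xi * cabs (g xi))).
  by apply: wnorm_integrable => //; rewrite (le_lt_trans (gK 1%N))// ltry.
have ib := integrable_scale (2 * D) iw.
have mF : cmeas (fun xi => expi (dotp x xi) * g xi - expi (dotp y xi) * g xi).
  by apply: cmeasB; exact: cmeas_ift.
have Fb xi : cabs (expi (dotp x xi) * g xi - expi (dotp y xi) * g xi) <=
    2 * D * (wt rho 1 xi * cabs (g xi)).
  have -> : expi (dotp x xi) * g xi - expi (dotp y xi) * g xi =
      expi (dotp y xi) * (expi (dotp (x - y) xi) - 1) * g xi.
    rewrite (_ : dotp x xi = dotp y xi + dotp (x - y) xi); first by rewrite expiD; ring.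
    by rewrite -dotpDl addrC subrK.
  rewrite 2!cabsM cabs_expi mul1r mulrA ler_wpM2r ?cabs_ge0//.
  rewrite (le_trans (cabs_expiB1 _))// -mulrA ler_wpM2l//.
  rewrite (le_trans (ler_norm_sum _ _ _))// mulr_suml ler_sum// => i _.
  rewrite !mxE normrM ler_wpM2l// (le_trans (coord_le_japanese _ _))// /wt expr1.
  rewrite (@le_trans _ _ (1 * (2 * japanese xi)))//.
    by rewrite mul1r ler_peMl ?japanese_ge0// ler1n.
  rewrite ler_wpM2r ?mulr_ge0 ?japanese_ge0//.
  by rewrite -[1]expR0 ler_expR mulr_ge0// japanese_ge0.
rewrite (le_trans (cabs_cint (cintg_le mF ib Fb)))//.
rewrite (@le_trans _ _ (\int[mu]_xi (2 * D * (wt rho 1 xi * cabs (g xi)))))//.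
  by apply: le_Rintegral => //; apply: cintg_cabs; exact: cintg_le mF ib Fb.
rewrite RintegralZl// mulrAC ler_wpM2r// ler_wpM2l//.
rewrite -lee_fin fineK ?gK//; exact: integrable_fin_num.
Qed.

Lemma lipschitz_ccontinuous (f : 'rV[R]_d -> R[i]) (C : R) :
  (forall x y, cabs (f x - f y) <= C * \sum_i `|x ord0 i - y ord0 i|) ->
  ccontinuous f.
Proof.
move=> fC.
suff key (F : 'rV[R]_d -> R) : (forall x y, `|F x - F y| <= cabs (f x - f y)) -> continuous F.
  split; apply: key => x y.
    by rewrite -cReN -cReD normr_cRe.
  by rewrite -cImN -cImD normr_cIm.
move=> Ff x A /nbhs_ballP[e' /= e'0 e'A].
pose e := e' / 2; have e0 : 0 < e by rewrite divr_gt0.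
pose B := `|C| * d%:R + 1; have B0 : 0 < B by rewrite ltr_wpDl// mulr_ge0.
have eB : 0 < e / B by rewrite divr_gt0.
apply/nbhs_ballP; exists (e / B) => //= y [_ xy]; apply: e'A.
rewrite /ball /= (@le_lt_trans _ _ e)//; last by rewrite /e ltr_pdivrMr// ltr_pMr// ltr1n.
rewrite (le_trans (Ff x y))// (le_trans (fC x y))//.
rewrite (@le_trans _ _ (`|C| * (d%:R * (e / B))))//.
  rewrite (@le_trans _ _ (`|C| * \sum_i `|x ord0 i - y ord0 i|))//.
    by rewrite ler_wpM2r ?sumr_ge0// ler_norm.
  rewrite ler_wpM2l// -[X in X%:R]card_ord mulr_natl -sumr_const ler_sum// => i _.
  by have := xy ord0 i; rewrite /ball /= => /ltW.
rewrite (_ : `|C| * (d%:R * (e / B)) = e * (`|C| * d%:R / B)); last by ring.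
rewrite ler_piMr ?(ltW e0)// ler_pdivrMr// mul1r /B.
by rewrite lerDl.
Qed.

Lemma wiener_ccontinuous K (f : 'rV[R]_d -> R[i]) : wiener rho K f -> ccontinuous f.
Proof. by move=> /wiener_lipschitz; exact: lipschitz_ccontinuous. Qed.

Lemma wiener_csmooth K (f : 'rV[R]_d -> R[i]) : wiener rho K f -> csmooth f.
Proof.
move=> fK s.
have [K' sK] : exists K', wiener rho K' (partials s f).
  elim: s => [|i s [K' IH]]; first by exists K.
  by exists (fun n => K' n.+1); exact: wiener_partial.
split; first exact: wiener_ccontinuous sK.
by move=> i x; exact: wiener_derive sK.
Qed.

Lemma wiener_bounded K (f : 'rV[R]_d -> R[i]) x : wiener rho K f -> cabs (f x) <= K 0%N.
Proof.
move=> [g [mg gK ->]]; rewrite -lee_fin.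
apply: le_trans (EFin_cabs_cint (mu) (cmeas_ift x mg)) _.
apply: le_trans (gK 0%N); apply: ge0_le_integral => //.
- by move=> z _; rewrite lee_fin cabs_ge0.
- by apply/measurable_EFinP; apply: measurable_cabs; exact: cmeas_ift.
- by apply/measurable_EFinP; exact: measurable_wt_cabs.
- by move=> xi _; rewrite lee_fin cabsM cabs_expi mul1r ler_peMl ?cabs_ge0// wt_ge1.
Qed.

(** Completeness, in the form used for the exponential series: the densities
    are summed outside of the null set where their norms are not summable. *)
Lemma wiener_series (K : nat -> nat -> R) (K' : nat -> R)
    (F : nat -> 'rV[R]_d -> R[i]) (f : 'rV[R]_d -> R[i]) :
  (forall k, wiener rho (K k) (F k)) ->
  (forall n N, \sum_(k < N) K k n <= K' n) ->
  (forall x, complex.Re (\sum_(k < N) F k x) @[N --> \oo] --> complex.Re (f x)) ->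
  (forall x, complex.Im (\sum_(k < N) F k x) @[N --> \oo] --> complex.Im (f x)) ->
  wiener rho K' f.
Proof.
move=> FK KK' cR cI.
have [g gP] := choice FK.
have mg k : cmeas (g k) by have [] := gP k.
have gK k n : (wnorm rho n (g k) <= (K k n)%:E)%E by have [] := gP k.
have Fg k : F k = ift (g k) by have [] := gP k.
pose G n xi := (\sum_(0 <= k <oo) (wt rho n xi * cabs (g k xi))%:E)%E.
have pos n k xi : (0 <= (wt rho n xi * cabs (g k xi))%:E)%E.
  by rewrite lee_fin mulr_ge0 ?wt_ge0 ?cabs_ge0.
have mterm n k : measurable_fun setT (fun xi => (wt rho n xi * cabs (g k xi))%:E).
  by apply/measurable_EFinP; exact: measurable_wt_cabs.
have GK n : (\int[mu]_xi G n xi <= (K' n)%:E)%E.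
  rewrite integral_nneseries//.
  apply: lime_le; first by apply: is_cvg_nneseries => k _ _; exact: wnorm_ge0.
  apply: nearW => N; rewrite big_mkord (@le_trans _ _ (\sum_(k < N) (K k n)%:E)%E)//.
    by apply: lee_sum => k _; exact: gK.
  by rewrite sumEFin lee_fin.
have mG n : measurable_fun setT (G n).
  by apply: ge0_emeasurable_sum.
have iG n : mu.-integrable setT (G n).
  apply/integrableP; split => //; apply: le_lt_trans (ltry (K' n)).
  apply: le_trans (GK n); rewrite le_eqVlt; apply/orP; left; apply/eqP.
  by apply: eq_integral => xi _; rewrite gee0_abs// nneseries_ge0.
pose S := [set xi | G 0%N xi \is a fin_num].
have mS : measurable S.
  have := emeasurable_fin_num measurableT (mG 0%N).
  by rewrite setTI.
pose Hb xi := fine (G 0%N xi).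
have G0 n xi : (0 <= G n xi)%E by apply: nneseries_ge0 => k _ _; exact: pos.
have SG xi : S xi -> G 0%N xi = (Hb xi)%:E by move=> Sxi; rewrite fineK.
have partG n N xi : ((\sum_(k < N) wt rho n xi * cabs (g k xi))%:E <= G n xi)%E.
  rewrite -sumEFin /G -(big_mkord xpredT (fun k => (wt rho n xi * cabs (g k xi))%:E)).
  by apply: nneseries_lim_ge => k _ _; exact: pos.
pose h k xi : R[i] := (\1_S xi)%:C * g k xi.
have hg k xi : cabs (h k xi) <= cabs (g k xi).
  rewrite /h cabsM cabs_real indicE; case: (_ \in _); first by rewrite normr1 mul1r.
  by rewrite normr0 mul0r cabs_ge0.
have hb N xi : \sum_(k < N) cabs (h k xi) <= Hb xi.
  rewrite /h; have [Sxi|nSxi] := pselect (S xi).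
    rewrite indicE mem_set//= -lee_fin -(SG _ Sxi); apply: le_trans (partG 0%N N xi).
    rewrite lee_fin; apply: ler_sum => k _; rewrite mul1r ler_peMl ?cabs_ge0//.
    exact: wt_ge1.
  rewrite indicE memNset//= big1 ?fine_ge0// => k _.
  by rewrite mul0r cabs0.
have cvgh (u : nat -> R) xi : (forall k, `|u k| <= cabs (h k xi)) ->
    cvgn (fun N => \sum_(k < N) u k).
  move=> uh; rewrite (_ : (fun N => _) = series u); last first.
    by apply/funext => N; rewrite /series /= big_mkord.
  apply: normed_cvg; apply: nondecreasing_is_cvgn.
    by apply: nondecreasing_series => k _ _; exact: normr_ge0.
  exists (Hb xi) => _ [N _ <-]; apply: le_trans (hb N xi).
  by rewrite [leLHS]big_mkord; apply: ler_sum => k _; exact: uh.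
pose hl xi : R[i] := (limn (fun N => \sum_(k < N) complex.Re (h k xi))) +i*
   (limn (fun N => \sum_(k < N) complex.Im (h k xi))).
have hlR xi : complex.Re (\sum_(k < N) h k xi) @[N --> \oo] --> complex.Re (hl xi).
  under eq_fun do rewrite cRe_sum; apply: (cvgh (fun k => complex.Re (h k xi)) xi) => k.
  exact: normr_cRe.
have hlI xi : complex.Im (\sum_(k < N) h k xi) @[N --> \oo] --> complex.Im (hl xi).
  under eq_fun do rewrite cIm_sum; apply: (cvgh (fun k => complex.Im (h k xi)) xi) => k.
  exact: normr_cIm.
have mh k : cmeas (h k).
  by apply: cmeasM => //; apply: cmeas_real; exact: measurable_indic.
have mhl : cmeas hl.
  split; [apply: measurable_fun_cvg (fun x _ => hlR x) => N
         |apply: measurable_fun_cvg (fun x _ => hlI x) => N].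
    by have [] : cmeas (fun xi => \sum_(k < N) h k xi) by exact: cmeas_sum.
  by have [] : cmeas (fun xi => \sum_(k < N) h k xi) by exact: cmeas_sum.
have hlabs xi : cabs (\sum_(k < N) h k xi) @[N --> \oo] --> cabs (hl xi).
  under eq_fun do rewrite cabsE; rewrite cabsE.
  apply: (continuous_cvg _ (@sqrt_continuous R _)).
  by apply: cvgD; rewrite !expr2; under eq_fun do rewrite expr2; exact: cvgM.
exists hl; split => //.
  move=> n; apply: le_trans (GK n); apply: ge0_le_integral => //.
  - by move=> xi _; rewrite lee_fin mulr_ge0 ?wt_ge0 ?cabs_ge0.
  - by apply/measurable_EFinP; exact: measurable_wt_cabs.
  move=> xi _; have [->|Goo] := eqVneq (G n xi) +oo%E; first by rewrite leey.
  have Gfin : G n xi \is a fin_num by rewrite ge0_fin_numE// ltey.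
  rewrite -(fineK Gfin) lee_fin.
  have cw : wt rho n xi * cabs (\sum_(k < N) h k xi) @[N --> \oo] -->
      wt rho n xi * cabs (hl xi) by apply: cvgM => //; exact: cvg_cst.
  rewrite -(cvg_lim (@Rhausdorff R) cw); apply: limr_le.
    by apply/cvg_ex; eexists; exact: cw.
  apply: nearW => N; rewrite -lee_fin (fineK Gfin); apply: le_trans (partG n N xi).
  rewrite lee_fin -[leRHS]mulr_sumr ler_wpM2l ?wt_ge0// (le_trans (cabs_sum _ _ _))//.
  by apply: ler_sum => k _; exact: hg.
have iHb : mu.-integrable setT (EFin \o Hb).
  apply: le_integrable (iG 0%N) => //.
    by apply/measurable_EFinP; exact: (measurableT_comp (fine_measurable measurableT) (mG 0%N)).
  move=> xi _; rewrite /= /Hb (gee0_abs (G0 _ _)) ger0_norm ?fine_ge0//.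
  by have := G0 0%N xi; case: (G 0%N xi).
have gi k : cintg mu (g k) by exact: wiener_cintg rho0 (mg k) (gK k).
have hi k : cintg mu (h k) by exact: cintg_le (mh k) (cintg_cabs (gi k)) (hg k).
have hift k x : ift (h k) x = F k x.
  rewrite Fg; apply: cint_eq_ae; [exact: cmeas_ift|exact: cmeas_ift|].
  apply: filterS (integrable_ae measurableT (iG 0%N)) => xi /(_ I) Sxi.
  by rewrite /h indicE mem_set//= mul1r.
apply/funext => x.
pose f_ N xi := expi (dotp x xi) * \sum_(k < N) h k xi.
have cf_ N : cint mu (f_ N) = \sum_(k < N) F k x.
  rewrite /f_; elim: N => [|N IH].
    rewrite big_ord0; under eq_cint do rewrite big_ord0 mulr0.
    by apply: complex_ext; rewrite /= Rintegral_cst// mul0r.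
  rewrite big_ord_recr /= -hift -IH /ift -cintD; last exact: cintg_ift.
    by apply: eq_cint => xi; rewrite big_ord_recr /= mulrDr.
  apply: cintg_ift; elim: (N) => [|M IHM].
    under eq_fun do rewrite big_ord0; apply: cintgP; first exact: cmeas_cst.
    by under eq_integral do rewrite cabs0; rewrite integral0 ltry.
  by under eq_fun do rewrite big_ord_recr; exact: cintgD.
have [] := @cint_dominated _ _ _ mu f_ (fun xi => expi (dotp x xi) * hl xi) Hb.
- by move=> N; apply: cmeas_ift; exact: cmeas_sum.
- move=> xi; rewrite cReM; under eq_fun do rewrite cReM.
  by apply: cvgB; apply: cvgM => //; exact: cvg_cst.
- move=> xi; rewrite cImM; under eq_fun do rewrite cImM.
  by apply: cvgD; apply: cvgM => //; exact: cvg_cst.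
- exact: iHb.
- move=> N xi; rewrite /f_ cabsM cabs_expi mul1r (le_trans _ (hb N xi))//.
  exact: cabs_sum.
move=> _; under eq_fun do rewrite cf_; move=> LR; under eq_fun do rewrite cf_; move=> LI.
apply: complex_ext.
  exact: (cvg_unique _ (cR x) LR).
exact: (cvg_unique _ (cI x) LI).
Qed.

Lemma exp_partial_le (x : R) N : 0 <= x -> \sum_(k < N) x ^+ k / k`!%:R <= expR x.
Proof.
move=> x0; rewrite -(big_mkord xpredT (fun k => x ^+ k / k`!%:R)).
apply: (@nondecreasing_cvgn_le _ (series (exp_coeff x))).
  by apply: nondecreasing_series => k _ _; exact: exp_coeff_ge0.
exact: is_cvg_series_exp_coeff.
Qed.

(** The exponential remainder has order [m + 1] because every term of its
    series does. *)
Lemma wiener_exp_rem K (r : 'rV[R]_d -> R) m :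
  wiener rho K (fun x => (r x)%:C) ->
  wiener rho (fun n => K n ^+ m.+1 * expR (K n))
    (fun x => (expR (r x) - \sum_(j < m.+1) r x ^+ j / j`!%:R)%:C).
Proof.
move=> rK; have K0 := wiener_ge0 rK.
pose c k : R := (k + m).+1`!%:R^-1.
have c0 k : 0 <= c k by rewrite invr_ge0.
apply: (@wiener_series (fun k n => `|c k| * K n ^+ (k + m).+1)  _
  (fun k x => (c k)%:C * (r x)%:C ^+ (k + m).+1)).
- by move=> k; rewrite -(cabs_real (c k)); apply: wienerZ => //; exact: wiener_exp.
- move=> n N; rewrite (@le_trans _ _ (K n ^+ m.+1 * \sum_(k < N) K n ^+ k / k`!%:R))//.
    rewrite mulr_sumr; apply: ler_sum => k _.
    rewrite [leRHS](_ : _ = k`!%:R^-1 * K n ^+ (k + m).+1); last first.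
      by rewrite -addnS exprD; ring.
    rewrite ger0_norm// ler_wpM2r ?exprn_ge0// /c.
    by rewrite lef_pV2 ?posrE ?ltr0n ?fact_gt0// ler_nat leq_fact// -addnS leq_addr.
  by rewrite ler_wpM2l ?exprn_ge0// exp_partial_le.
- move=> x.
  have E N : complex.Re (\sum_(k < N) (c k)%:C * (r x)%:C ^+ (k + m).+1) =
     \sum_(j < N + m.+1) r x ^+ j / j`!%:R - \sum_(j < m.+1) r x ^+ j / j`!%:R.
    rewrite cRe_sum (addnC N) big_split_ord /= addrAC subrr add0r.
    apply: eq_bigr => k _.
    by rewrite -realCX -realCM [LHS]/= mulrC /c (addnC k) -addSn.
  under eq_fun do rewrite E.
  apply: cvgB; last exact: cvg_cst.
  have h : series (exp_coeff (r x)) @ \oo --> expR (r x).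
    exact: is_cvg_series_exp_coeff.
  rewrite -(cvg_shiftn m.+1) in h.
  by under eq_fun do rewrite -(big_mkord xpredT (fun j => r x ^+ j / j`!%:R)).
- move=> x; rewrite /=; apply: cvg_near_cst; near=> N.
  by rewrite cIm_sum big1// => k _; rewrite -realCX -realCM.
Unshelve. all: end_near. Qed.

End wiener_smooth.

(** * Differentiation rules and Gaussian test functions *)

Section complex_derivative.
Context {R : realType} {V : normedModType R}.
Implicit Types (v x : V) (f g : V -> R[i]).

Definition is_cderive v f x (df : R[i]) :=
  is_derive x v (fun y => complex.Re (f y)) (complex.Re df) /\
  is_derive x v (fun y => complex.Im (f y)) (complex.Im df).

Lemma is_cderive_val v f x df : is_cderive v f x df ->
  cderivable v f x /\ cderive v f x = df.
Proof.
move=> [[d1 e1] [d2 e2]]; split; first by split.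
by rewrite /cderive e1 e2; apply: complex_ext.
Qed.

Lemma is_cderiveP v f x : cderivable v f x -> is_cderive v f x (cderive v f x).
Proof. by move=> [d1 d2]; split; apply/derivableP. Qed.

Lemma is_cderive_eq v f x df df' : is_cderive v f x df -> df = df' -> is_cderive v f x df'.
Proof. by move=> ? <-. Qed.

Lemma is_cderive_real v (h : V -> R) x dh : is_derive x v h dh ->
  is_cderive v (fun y => (h y)%:C) x dh%:C.
Proof. by move=> dh'; split => //=; exact: is_derive_cst. Qed.

Lemma is_cderive_cst v (c : R[i]) x : is_cderive v (fun=> c) x 0.
Proof. by split; exact: is_derive_cst. Qed.

Lemma is_cderiveD v f g x df dg : is_cderive v f x df -> is_cderive v g x dg ->
  is_cderive v (fun y => f y + g y) x (df + dg).
Proof.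
move=> [f1 f2] [g1 g2]; split.
  rewrite cReD (_ : (fun y => _) = (fun y => complex.Re (f y)) + (fun y => complex.Re (g y))).
    exact: is_deriveD.
  by apply/funext => y; rewrite cReD.
rewrite cImD (_ : (fun y => _) = (fun y => complex.Im (f y)) + (fun y => complex.Im (g y))).
  exact: is_deriveD.
by apply/funext => y; rewrite cImD.
Qed.

Lemma is_cderiveM v f g x df dg : is_cderive v f x df -> is_cderive v g x dg ->
  is_cderive v (fun y => f y * g y) x (df * g x + f x * dg).
Proof.
move=> [f1 f2] [g1 g2]; split.
  rewrite (_ : (fun y => _) = (fun y => complex.Re (f y)) * (fun y => complex.Re (g y)) -
     (fun y => complex.Im (f y)) * (fun y => complex.Im (g y))); last first.
    by apply/funext => y; rewrite cReM.
  apply: is_derive_eq; rewrite cReD !cReM /GRing.scale /=; ring.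
rewrite (_ : (fun y => _) = (fun y => complex.Re (f y)) * (fun y => complex.Im (g y)) +
     (fun y => complex.Im (f y)) * (fun y => complex.Re (g y))); last first.
  by apply/funext => y; rewrite cImM.
apply: is_derive_eq; rewrite cImD !cImM /GRing.scale /=; ring.
Qed.

Lemma is_cderiveZ v f (c : R[i]) x df : is_cderive v f x df ->
  is_cderive v (fun y => c * f y) x (c * df).
Proof.
move=> fd; apply: is_cderive_eq (is_cderiveM (is_cderive_cst v c x) fd) _.
by rewrite mul0r add0r.
Qed.

(** Reduces the partial derivatives of explicit functions to calculus in one
    variable, where derivatives are computed by instance resolution. *)
Lemma is_derive_line (F : V -> R) v x (L : R) :
  is_derive (0 : R) (1 : R) (fun h : R => F (h *: v + x)) L -> is_derive x v F L.
Proof.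
have E : (fun h : R => h^-1 *: (F (h *: v + x) - F x)) =
    (fun h : R => h^-1 *: (((fun h : R => F (h *: v + x)) \o shift (0 : R)) (h *: (1 : R)) -
        F (0 *: v + x))).
  by apply/funext => h; rewrite /= scale0r add0r addr0 /GRing.scale /= mulr1.
by move=> [d1 e1]; split; move: d1 e1; rewrite /derivable /derive /= E.
Qed.

End complex_derivative.

Section partial_rules.
Context {R : realType} {d : nat}.
Implicit Types (f g : 'rV[R]_d -> R[i]).

Definition cderivable_all f :=
  forall (i : 'I_d) x, cderivable (delta_mx ord0 i) f x.

Lemma partial_is_cderive f i x : cderivable_all f ->
  is_cderive (delta_mx ord0 i) f x (partial i f x).
Proof. by move=> fd; exact: is_cderiveP. Qed.

Lemma partialD f g i : cderivable_all f -> cderivable_all g ->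
  partial i (fun y => f y + g y) = (fun y => partial i f y + partial i g y).
Proof.
move=> fd gd; apply/funext => x.
exact: (is_cderive_val (is_cderiveD (partial_is_cderive i x fd) (partial_is_cderive i x gd))).2.
Qed.

Lemma cderivable_allD f g : cderivable_all f -> cderivable_all g ->
  cderivable_all (fun y => f y + g y).
Proof.
move=> fd gd i x.
exact: (is_cderive_val (is_cderiveD (partial_is_cderive i x fd) (partial_is_cderive i x gd))).1.
Qed.

Lemma partialZ (c : R[i]) f i : cderivable_all f ->
  partial i (fun y => c * f y) = (fun y => c * partial i f y).
Proof.
move=> fd; apply/funext => x.
exact: (is_cderive_val (is_cderiveZ c (partial_is_cderive i x fd))).2.
Qed.

Lemma cderivable_allZ (c : R[i]) f : cderivable_all f ->
  cderivable_all (fun y => c * f y).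
Proof.
move=> fd i x.
exact: (is_cderive_val (is_cderiveZ c (partial_is_cderive i x fd))).1.
Qed.

Lemma csmooth_cderivable f : csmooth f -> cderivable_all f.
Proof. by move=> fs i x; exact: (fs [::]).2. Qed.

Lemma csmooth_partial f i : csmooth f -> csmooth (partial i f).
Proof. by move=> fs s; have := fs (rcons s i); rewrite /partials foldr_rcons. Qed.

End partial_rules.

Section schwartz_gaussian.
Context {R : realType} {d : nat}.
Variables (t : R) (a b : 'rV[R]_d).
Hypothesis t0 : 0 < t.

Definition gaussian_wave (x : 'rV[R]_d) : R[i] :=
  expi (dotp a x) * (gaussd t (x - b))%:C.

(** Polynomials times a Gaussian: the smallest class stable under the
    operations that differentiation produces. *)
Inductive gauss_poly : ('rV[R]_d -> R[i]) -> Prop :=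
| gauss_poly_base : gauss_poly gaussian_wave
| gauss_polyD f g : gauss_poly f -> gauss_poly g -> gauss_poly (fun x => f x + g x)
| gauss_polyZ (c : R[i]) f : gauss_poly f -> gauss_poly (fun x => c * f x)
| gauss_polyX (i : 'I_d) f : gauss_poly f -> gauss_poly (fun x => (x ord0 i)%:C * f x).

Lemma is_derive_coord (i j : 'I_d) (x : 'rV[R]_d) :
  is_derive x (delta_mx ord0 j) (fun y : 'rV[R]_d => y ord0 i) (i == j)%:R.
Proof.
apply: is_derive_line.
rewrite (_ : (fun h : R => _) = (fun h : R => h * (i == j)%:R + x ord0 i)).
  apply: is_derive_eq; rewrite /GRing.scale /=. by ring.
by apply/funext => h; rewrite !mxE eqxx /= eq_sym.
Qed.

Lemma is_cderive_gaussian_wave (j : 'I_d) x :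
  is_cderive (delta_mx ord0 j) gaussian_wave x
   (((t * b ord0 j) +i* a ord0 j) * gaussian_wave x
     + (- t)%:C * ((x ord0 j)%:C * gaussian_wave x)).
Proof.
have lin h : dotp a (h *: delta_mx ord0 j + x) = h * a ord0 j + dotp a x.
  by rewrite dotpDr dotpZr (dotpC a) dotp_delta.
have quad h : gaussd t (h *: delta_mx ord0 j + x - b) =
   expR (- (t / 2) * (h ^+ 2 + 2 * h * (x ord0 j - b ord0 j) + dotp (x - b) (x - b))).
  rewrite /gaussd -addrA (_ : x ord0 j - b ord0 j = (x - b) ord0 j); last by rewrite !mxE.
  move: (x - b) => y; rewrite dotpDl !dotpDr !dotpZl !dotpZr (dotpC y) !dotp_delta.
  by rewrite !mxE !eqxx /=; congr expR; ring.
split; apply: is_derive_line.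
  rewrite (_ : (fun h : R => _) = (fun h : R => cos (h * a ord0 j + dotp a x) *
    expR (- (t / 2) * (h ^+ 2 + 2 * h * (x ord0 j - b ord0 j) + dotp (x - b) (x - b))))).
    apply: is_derive_eq; rewrite /GRing.scale /= !(mul0r, mulr0, add0r, expr0n) /=.
    by rewrite /gaussd; field.
  by apply/funext => h; rewrite /gaussian_wave cReM /= quad lin mulr0 subr0.
rewrite (_ : (fun h : R => _) = (fun h : R => sin (h * a ord0 j + dotp a x) *
    expR (- (t / 2) * (h ^+ 2 + 2 * h * (x ord0 j - b ord0 j) + dotp (x - b) (x - b))))).
  apply: is_derive_eq; rewrite /GRing.scale /= !(mul0r, mulr0, add0r, expr0n) /=.
  by rewrite /gaussd; field.
by apply/funext => h; rewrite /gaussian_wave cImM /= quad lin mulr0 add0r.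
Qed.

Lemma rV_continuousD (f g : 'rV[R]_d -> R) : continuous f -> continuous g ->
  continuous (fun x => f x + g x).
Proof.
by move=> cf cg x; apply: cvgD; [exact: nbhs_filter|exact: cf|exact: cg].
Qed.

Lemma rV_continuousB (f g : 'rV[R]_d -> R) : continuous f -> continuous g ->
  continuous (fun x => f x - g x).
Proof.
by move=> cf cg x; apply: cvgB; [exact: nbhs_filter|exact: cf|exact: cg].
Qed.

Lemma rV_continuousM (f g : 'rV[R]_d -> R) : continuous f -> continuous g ->
  continuous (fun x => f x * g x).
Proof.
by move=> cf cg x; apply: cvgM; [exact: nbhs_filter|exact: cf|exact: cg].
Qed.

Lemma continuous_sum_fun (r : seq 'I_d) (F : 'I_d -> 'rV[R]_d -> R) :
  (forall i, continuous (F i)) -> continuous (fun x => \sum_(i <- r) F i x).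
Proof.
move=> cF; elim: r => [|i r IH].
  rewrite (_ : (fun x => _) = (fun=> 0)); first exact: cst_continuous.
  by apply/funext => x; rewrite big_nil.
rewrite (_ : (fun x => _) = (fun x => F i x + \sum_(j <- r) F j x)).
  exact: rV_continuousD.
by apply/funext => x; rewrite big_cons.
Qed.

Lemma continuous_coord i : continuous (fun x : 'rV[R]_d => x ord0 i).
Proof. exact: coord_continuous. Qed.

Lemma ccontinuousD (f g : 'rV[R]_d -> R[i]) : ccontinuous f -> ccontinuous g ->
  ccontinuous (fun x => f x + g x).
Proof.
move=> [f1 f2] [g1 g2]; split.
  under eq_fun do rewrite cReD.
  exact: rV_continuousD.
under eq_fun do rewrite cImD.
exact: rV_continuousD.
Qed.

Lemma ccontinuousM (f g : 'rV[R]_d -> R[i]) : ccontinuous f -> ccontinuous g ->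
  ccontinuous (fun x => f x * g x).
Proof.
move=> [f1 f2] [g1 g2]; split.
  under eq_fun do rewrite cReM.
  by apply: rV_continuousB; exact: rV_continuousM.
under eq_fun do rewrite cImM.
by apply: rV_continuousD; exact: rV_continuousM.
Qed.

Lemma ccontinuous_real (h : 'rV[R]_d -> R) : continuous h -> ccontinuous (fun x => (h x)%:C).
Proof. by move=> ch; split => //=; exact: cst_continuous. Qed.

Lemma ccontinuous_cst (c : R[i]) : ccontinuous (fun _ : 'rV[R]_d => c).
Proof. by split; exact: cst_continuous. Qed.

Lemma ccontinuous_gaussian_wave : ccontinuous gaussian_wave.
Proof.
have ca : continuous (fun x : 'rV[R]_d => dotp a x).
  apply: continuous_sum_fun => i; apply: rV_continuousM; first exact: cst_continuous.
  exact: continuous_coord.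
apply: ccontinuousM.
  split => x.
    by apply: (continuous_comp (ca x)); exact: continuous_cos.
  by apply: (continuous_comp (ca x)); exact: continuous_sin.
apply: ccontinuous_real => x.
suff cq : continuous (fun x : 'rV[R]_d => - (t / 2) * dotp (x - b) (x - b)).
  by apply: (continuous_comp (cq x)); exact: continuous_expR.
apply: rV_continuousM; first exact: cst_continuous.
have c1 i : continuous (fun x : 'rV[R]_d => (x - b) ord0 i).
  rewrite (_ : (fun x => _) = (fun x : 'rV[R]_d => x ord0 i - b ord0 i)).
    by apply: rV_continuousB; [exact: continuous_coord|exact: cst_continuous].
  by apply/funext => z; rewrite !mxE.
by apply: continuous_sum_fun => i; exact: rV_continuousM.
Qed.

Lemma gaussian_wave_decay k : exists B : R, forall x,
  japanese x ^+ k * cabs (gaussian_wave x) <= B.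
Proof.
pose c := 1 + 2 / t.
have c0 : 0 < c by rewrite addr_gt0// divr_gt0.
exists ((2 * japanese b) ^+ k * (c ^+ k.+1 * k.+1%:R ^+ k.+1)) => x.
rewrite /gaussian_wave cabsM cabs_expi mul1r cabs_real ger0_norm ?gaussd_ge0//.
set y := x - b.
have jx : japanese x <= 2 * japanese b * japanese y.
  rewrite -(subrK b x) -/y (le_trans (japaneseD _ _))//.
  by have := japanese_ge1 y; have := japanese_ge1 b; nra.
have jy : japanese y ^+ k * gaussd t y <= c ^+ k.+1 * k.+1%:R ^+ k.+1.
  pose u := t / 2 * dotp y y.
  have u0 : 0 <= u by rewrite mulr_ge0 ?dotp_ge0// divr_ge0// ltW.
  have -> : gaussd t y = (expR u)^-1 by rewrite -expRN /gaussd /u mulNr.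
  rewrite ler_pdivrMr ?expR_gt0// -mulrA.
  rewrite (@le_trans _ _ (c ^+ k.+1 * (1 + u) ^+ k.+1))//; last first.
    by rewrite ler_wpM2l ?exprn_ge0 ?(ltW c0)// pow_le_expR.
  rewrite -exprMn (@le_trans _ _ ((japanese y ^+ 2) ^+ k.+1))//.
    rewrite -exprM ler_weXn2l ?japanese_ge1//.
    by rewrite mul2n -addnn (leq_trans (leqnSn k))// leq_addr.
  rewrite lerXn2r ?nnegrE ?sqr_ge0 ?mulr_ge0 ?addr_ge0 ?(ltW c0) ?divr_ge0 ?(ltW t0) ?dotp_ge0//.
  rewrite japanese_sqr (_ : c * (1 + u) = 1 + 2 / t + u + dotp y y); last first.
    by rewrite /c /u; field; exact: lt0r_neq0.
  have : 0 <= 2 / t by rewrite divr_ge0// ltW.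
  by lra.
rewrite (@le_trans _ _ ((2 * japanese b * japanese y) ^+ k * gaussd t y))//.
  by rewrite ler_wpM2r ?gaussd_ge0// lerXn2r ?nnegrE ?mulr_ge0 ?japanese_ge0.
by rewrite exprMn -mulrA ler_wpM2l// exprn_ge0// mulr_ge0// japanese_ge0.
Qed.

Lemma gauss_poly_partial f : gauss_poly f -> [/\ ccontinuous f,
  cderivable_all f, (forall i, gauss_poly (partial i f)) &
  forall k, exists B : R, forall x, japanese x ^+ k * cabs (f x) <= B].
Proof.
elim=> {f} [|f g _ [cf df pf Bf] _ [cg dg pg Bg]|c f _ [cf df pf Bf]|i f gf [cf df pf Bf]].
- split; [exact: ccontinuous_gaussian_wave| | |exact: gaussian_wave_decay].
    by move=> i x; exact: (is_cderive_val (is_cderive_gaussian_wave i x)).1.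
  move=> i; rewrite (_ : partial i _ = (fun x => ((t * b ord0 i) +i* a ord0 i) * gaussian_wave x
     + (- t)%:C * ((x ord0 i)%:C * gaussian_wave x))).
    apply: gauss_polyD; apply: gauss_polyZ; first exact: gauss_poly_base.
    exact/gauss_polyX/gauss_poly_base.
  by apply/funext => x; exact: (is_cderive_val (is_cderive_gaussian_wave i x)).2.
- split; [exact: ccontinuousD|exact: cderivable_allD| |].
    by move=> i; rewrite partialD//; exact: gauss_polyD.
  move=> k; have [B1 h1] := Bf k; have [B2 h2] := Bg k; exists (B1 + B2) => x.
  rewrite (le_trans _ (lerD (h1 x) (h2 x)))// -mulrDr ler_wpM2l ?cabsD//.
  by rewrite exprn_ge0// japanese_ge0.
- split; [exact: (ccontinuousM (ccontinuous_cst c))|exact: cderivable_allZ| |].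
    by move=> i; rewrite partialZ//; exact: gauss_polyZ.
  move=> k; have [B h] := Bf k; exists (cabs c * B) => x.
  by rewrite cabsM mulrCA ler_wpM2l ?cabs_ge0.
- have D j x : is_cderive (delta_mx ord0 j) (fun x => (x ord0 i)%:C * f x) x
      ((i == j)%:R%:C * f x + (x ord0 i)%:C * partial j f x).
    apply: is_cderiveM; first exact/is_cderive_real/is_derive_coord.
    exact: partial_is_cderive.
  split.
  + by apply: ccontinuousM => //; apply: ccontinuous_real; exact: continuous_coord.
  + by move=> j x; exact: (is_cderive_val (D j x)).1.
  + move=> j; rewrite (_ : partial j _ = (fun x => (i == j)%:R%:C * f x
        + (x ord0 i)%:C * partial j f x)).
      by apply: gauss_polyD; [apply: gauss_polyZ|apply: gauss_polyX; exact: pf].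
    by apply/funext => x; exact: (is_cderive_val (D j x)).2.
  + move=> k; have [B h] := Bf k.+1; exists B => x; apply: le_trans (h x).
    rewrite cabsM cabs_real mulrA ler_wpM2r ?cabs_ge0// exprSr.
    by rewrite ler_wpM2l ?coord_le_japanese// exprn_ge0// japanese_ge0.
Qed.

Lemma gauss_poly_schwartz f : gauss_poly f -> schwartz f.
Proof.
move=> gf; have key s : gauss_poly (partials s f).
  elim: s => [|i s IH]; first exact: gf.
  by have [_ _ h _] := gauss_poly_partial IH; exact: h.
split=> [s|k s]; have [c p _ B] := gauss_poly_partial (key s); last exact: B.
by split.
Qed.

End schwartz_gaussian.

(** * Comparison with the Fourier norms of distributions *)

Section multiplication_formula.
Context {R : realType} {d : nat}.
Local Notation mu := (lebesgue_rV R d).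
Implicit Types (f g h phi : 'rV[R]_d -> R[i]).

(** Both sides are the same double integral.  It replaces Fourier inversion
    wherever a transform can be moved to the other factor. *)
Lemma multiplication_formula g h : cintg mu g -> cintg mu h ->
  cint mu (fun x => ift g x * h x) = cint mu (fun xi => g xi * ift h xi).
Proof.
move=> gi hi; have mg := cintg_meas gi; have mh := cintg_meas hi.
pose H (z : 'rV[R]_d * 'rV[R]_d) := expi (dotp z.1 z.2) * (h z.1 * g z.2).
have [ip _] := cint_prod hi gi.
have iH : cintg (mu \x mu)%E H.
  apply: (cintg_le _ (cintg_cabs ip)).
    apply: cmeasM (cintg_meas ip); apply: cmeas_expi.
    exact: (measurable_dotp measurable_fst measurable_snd).
  by move=> z; rewrite /H cabsM cabs_expi mul1r.
have [_ _ E] := cint_fubini iH.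
transitivity (cint mu (fun x => cint mu (fun y => H (x, y)))).
  apply: eq_cint => x; rewrite mulrC /ift -(cintZ (h x) (cintg_ift x gi)).
  by apply: eq_cint => y; rewrite /H /=; ring.
rewrite E; apply: eq_cint => y; rewrite /ift -(cintZ (g y) (cintg_ift y hi)).
by apply: eq_cint => x; rewrite /H /= (dotpC x); ring.
Qed.

Lemma cabs_ift_le g x : cintg mu g -> cabs (ift g x) <= \int[mu]_y cabs (g y).
Proof.
move=> gi; rewrite (le_trans (cabs_cint (cintg_ift x gi)))// le_eqVlt; apply/orP; left.
by apply/eqP; apply: eq_Rintegral => y _; rewrite cabsM cabs_expi mul1r.
Qed.

(** Fubini's theorem gives measurability only together with integrability, so
    the transform is first damped by a Gaussian. *)
Lemma cmeas_iftT g : cintg mu g -> cmeas (ift g).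
Proof.
move=> gi; have mg := cintg_meas gi.
have ie : cintg mu (fun x => (gaussd 1 x)%:C).
  have [i _] := @Rintegral_gaussd R d 1 ltr01.
  apply: (cintg_le _ i); first by apply: cmeas_real; exact: measurable_gaussd.
  by move=> x; rewrite cabs_real ger0_norm// gaussd_ge0.
pose H (z : 'rV[R]_d * 'rV[R]_d) := expi (dotp z.1 z.2) * ((gaussd 1 z.1)%:C * g z.2).
have [ip _] := cint_prod ie gi.
have iH : cintg (mu \x mu)%E H.
  apply: (cintg_le _ (cintg_cabs ip)).
    apply: cmeasM (cintg_meas ip); apply: cmeas_expi.
    exact: (measurable_dotp measurable_fst measurable_snd).
  by move=> z; rewrite /H cabsM cabs_expi mul1r.
have [/cintg_meas mI _ _] := cint_fubini iH.
have mV : cmeas (fun x : 'rV[R]_d => (expR (1 / 2 * dotp x x))%:C).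
  apply: cmeas_real; apply: (measurableT_comp (@measurable_expR R)).
  by apply: measurable_funM => //; exact: measurable_dotp.
rewrite (_ : ift g = fun x => (expR (1 / 2 * dotp x x))%:C * cint mu (fun y => H (x, y))).
  exact: cmeasM.
apply/funext => x; rewrite (_ : cint mu _ = (gaussd 1 x)%:C * ift g x).
  by rewrite mulrA -realCM /gaussd mulNr expRN divff ?mul1r// gt_eqF// expR_gt0.
rewrite /ift -(cintZ _ (cintg_ift x gi)).
by apply: eq_cint => y; rewrite /H /=; ring.
Qed.

Lemma cintg_iftM g h : cintg mu g -> cintg mu h -> cintg mu (fun x => ift g x * h x).
Proof.
move=> gi hi.
have ib := integrable_scale (\int[mu]_y cabs (g y)) (cintg_cabs hi).
apply: (cintg_le _ ib); first by apply: cmeasM; [exact: cmeas_iftT|exact: cintg_meas hi].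
by move=> x; rewrite cabsM ler_wpM2r ?cabs_ge0// cabs_ift_le.
Qed.

Lemma powR_c2pi : (2 * pi) `^ (- (d%:R / 2)) = (c2pi d)^-1 :> R.
Proof.
rewrite powRN; congr (_^-1); rewrite /c2pi -powR12_sqrt ?mulr_ge0 ?pi_ge0//.
by rewrite -powR_mulrn ?powR_ge0// -powRrM; congr (_ `^ _); rewrite mulrC.
Qed.

Lemma fourierE phi xi : fourier phi xi = ((c2pi d)^-1)%:C * ift phi (- xi).
Proof.
rewrite /fourier powR_c2pi; congr (_ * _); apply: eq_cint => x.
by rewrite cexp_i dotpNl dotpC.
Qed.

Lemma schwartz_cmeas phi : schwartz phi -> cmeas phi.
Proof. by move=> [sm _]; apply: ccontinuous_cmeas; exact: (sm [::]).1. Qed.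

Lemma schwartz_decay phi (B : R) (k : nat) x : (2 * d <= k)%N ->
  japanese x ^+ k * cabs (phi x) <= B -> cabs (phi x) <= B * decay x.
Proof.
move=> dk h; have B0 : 0 <= B.
  by rewrite (le_trans _ h)// mulr_ge0 ?cabs_ge0// exprn_ge0// japanese_ge0.
apply: (@le_trans _ _ (B * (japanese x ^+ (2 * d))^-1)); last first.
  by rewrite ler_wpM2l// japanese_decay.
rewrite ler_pdivlMr ?exprn_gt0 ?japanese_gt0// mulrC (le_trans _ h)//.
by rewrite ler_wpM2r ?cabs_ge0// ler_weXn2l// japanese_ge1.
Qed.

Lemma schwartz_cintg phi : schwartz phi -> cintg mu phi.
Proof.
move=> sp; have [B hB] := sp.2 (2 * d)%N [::].
apply: (cintg_le (schwartz_cmeas sp) (integrable_scale B (@integrable_decay R d))).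
by move=> x; exact: schwartz_decay (hB x).
Qed.

Lemma schwartz_bounded phi : schwartz phi -> exists B : R, forall x, cabs (phi x) <= B.
Proof. by move=> sp; have [B hB] := sp.2 0%N [::]; exists B => x; have := hB x; rewrite expr0 mul1r. Qed.

Definition gaussn (n : nat) : 'rV[R]_d -> R := gaussd (n.+1%:R^-1).

Lemma gaussn_le1 n x : gaussn n x <= 1.
Proof.
rewrite /gaussn /gaussd -[leRHS]expR0 ler_expR mulNr oppr_le0.
by rewrite mulr_ge0 ?dotp_ge0// divr_ge0.
Qed.

Lemma gaussn_cvg x : gaussn n x @[n --> \oo] --> (1 : R).
Proof.
have h : - (n.+1%:R^-1 / 2) * dotp x x @[n --> \oo] --> - (0 / 2) * dotp x x.
  apply: cvgM; last exact: cvg_cst.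
  by apply: cvgN; apply: cvgM; [exact: cvg_harmonic|exact: cvg_cst].
have -> : (1 : R) = expR (- (0 / 2) * dotp x x) by rewrite mul0r oppr0 mul0r expR0.
exact: (continuous_cvg _ (@continuous_expR R _) h).
Qed.

Lemma gaussn_dct f : cintg mu f ->
  complex.Re (cint mu (fun x => f x * (gaussn n x)%:C)) @[n --> \oo] -->
    complex.Re (cint mu f) /\
  complex.Im (cint mu (fun x => f x * (gaussn n x)%:C)) @[n --> \oo] -->
    complex.Im (cint mu f).
Proof.
move=> fi; have mf := cintg_meas fi.
have key (c : R) x : c * gaussn n x @[n --> \oo] --> c.
  have h : c * gaussn n x @[n --> \oo] --> c * 1.
    by apply: cvgM; [exact: cvg_cst|exact: gaussn_cvg].
  by rewrite mulr1 in h.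
have [] := @cint_dominated _ _ _ mu (fun n x => f x * (gaussn n x)%:C) f (fun x => cabs (f x)).
- move=> n; apply: cmeasM => //; apply: cmeas_real; exact: measurable_gaussd.
- by move=> x; under eq_fun do rewrite cReM /= mulr0 subr0; exact: key.
- by move=> x; under eq_fun do rewrite cImM /= mulr0 add0r; exact: key.
- exact: cintg_cabs.
- move=> n x; rewrite cabsM cabs_real ger0_norm ?gaussd_ge0//.
  by rewrite ler_piMr ?cabs_ge0// gaussn_le1.
by [].
Qed.

(** Fourier inversion, made absolutely convergent by a Gaussian. *)
Lemma ift_fourier_gaussn phi n : schwartz phi ->
  cintg mu (fun x => fourier phi x * (gaussn n x)%:C) /\
  forall xi, ift (fun x => fourier phi x * (gaussn n x)%:C) xi =
    cint mu (fun y => phi y * (heat n (y - xi))%:C).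
Proof.
move=> sp; have ip := schwartz_cintg sp; have mp := cintg_meas ip.
have c0 : c2pi d != 0 :> R by rewrite gt_eqF// c2pi_gt0.
have ig : cintg mu (fun x => (gaussn n x)%:C).
  have [i _] := @Rintegral_gaussd R d n.+1%:R^-1 ltac:(by rewrite invr_gt0).
  apply: (cintg_le _ i); first by apply: cmeas_real; exact: measurable_gaussd.
  by move=> x; rewrite cabs_real ger0_norm// gaussd_ge0.
have gn x : gaussn n (- x) = gaussn n x by rewrite /gaussn /gaussd dotpNl dotpNr opprK.
have mip := cmeas_iftT ip.
have mgn : cmeas (fun x => (gaussn n x)%:C) by exact: cintg_meas ig.
have mo := @rV_opp_preserving R d.
have iw xi : cintg mu (fun x => expi (dotp (- xi) x) * (gaussn n x)%:C).
  exact: cintg_ift.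
have ifg : cintg mu (fun x => fourier phi x * (gaussn n x)%:C).
  have := cintgZ ((c2pi d)^-1)%:C (cintg_preserving mo (cintg_iftM ip ig)).
  by congr cintg; apply/funext => x; rewrite fourierE gn mulrA.
split=> // xi.
transitivity (cint mu (fun x => ((c2pi d)^-1)%:C *
    (ift phi (- x) * (expi (dotp (- xi) (- x)) * (gaussn n (- x))%:C)))).
  apply: eq_cint => x; rewrite fourierE dotpNl dotpNr opprK gn; ring.
have mP : cmeas (fun x => ((c2pi d)^-1)%:C *
    (ift phi x * (expi (dotp (- xi) x) * (gaussn n x)%:C))).
  by apply: cmeasM; [exact: cmeas_cst|apply: cmeasM => //; exact: cintg_meas (iw xi)].
rewrite (cint_preserving mo mP) (cintZ _ (cintg_iftM ip (iw xi))).
rewrite (multiplication_formula ip (iw xi)).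
have ipw : cintg mu (fun y => phi y * ift (fun x => expi (dotp (- xi) x) * (gaussn n x)%:C) y).
  by under eq_fun do rewrite mulrC; exact: cintg_iftM (iw xi) ip.
rewrite -(cintZ _ ipw).
apply: eq_cint => y; rewrite mulrCA; congr (_ * _).
have -> : ift (fun x => expi (dotp (- xi) x) * (gaussn n x)%:C) y =
    cint mu (fun x => expi (dotp (y - xi) x) * (gaussn n x)%:C).
  by apply: eq_cint => x; rewrite mulrA -expiD -dotpDl.
by rewrite cint_gauss_heat -realCM mulrA mulVf// mul1r.
Qed.

(** A convolution with the heat kernel is bounded uniformly in [n], which
    dominates the limits below. *)
Lemma heat_conv_bound phi (B : R) n xi : cmeas phi -> (forall x, cabs (phi x) <= B) ->
  cintg mu (fun y => phi y * (heat n (y - xi))%:C) /\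
  cabs (cint mu (fun y => phi y * (heat n (y - xi))%:C)) <= B * c2pi d.
Proof.
move=> mp pB; have [ih eh] := Rintegral_heat n xi.
have b y : cabs (phi y * (heat n (y - xi))%:C) <= B * heat n (y - xi).
  by rewrite cabsM cabs_real ger0_norm ?heat_ge0// ler_wpM2r ?heat_ge0.
have mh : cmeas (fun y => phi y * (heat n (y - xi))%:C).
  apply: cmeasM => //; apply: cmeas_real.
  exact: (measurableT_comp (measurable_heat n) (rV_shift_preserving (- xi)).1).
have ib := integrable_scale B ih.
have i := cintg_le mh ib b; split => //.
rewrite (le_trans (cabs_cint i))// -eh -RintegralZl//.
by apply: le_Rintegral => //; exact: cintg_cabs.
Qed.

Lemma cabs_cvg (u : nat -> R[i]) (l : R[i]) :
  (forall e : R, 0 < e -> exists N, forall n, (N <= n)%N -> cabs (u n - l) <= e) ->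
  complex.Re (u n) @[n --> \oo] --> complex.Re l /\
  complex.Im (u n) @[n --> \oo] --> complex.Im l.
Proof.
move=> ul; split; apply/cvgrPdist_le => e /ul[N hN]; exists N => // n /= Nn;
  apply: le_trans (hN n Nn); rewrite distrC.
  by rewrite -cReN -cReD normr_cRe.
by rewrite -cImN -cImD normr_cIm.
Qed.

(** Upper bound for the norm.  The distribution is defined on every function
    as the limit of Gaussian-damped pairings: on Schwartz functions this is the
    usual pairing, and on Fourier transforms of Schwartz functions the limit can
    be evaluated without knowing their decay. *)
Lemma wiener_A_norm rho K f (n : nat) : 0 <= rho -> wiener rho K f ->
  (A_norm rho n%:R f <= (c2pi d * K n)%:E)%E.
Proof.
move=> rho0 fK; have [g [mg gK fg]] := fK.
have gi := wiener_cintg rho0 mg gK.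
have c0 := @c2pi_gt0 R d.
pose u psi m := cint mu (fun x => f x * psi x * (gaussn m x)%:C).
pose T psi : R[i] := (limn (fun m => complex.Re (u psi m))) +i*
  (limn (fun m => complex.Im (u psi m))).
have Tlim psi l : complex.Re (u psi m) @[m --> \oo] --> complex.Re l /\
    complex.Im (u psi m) @[m --> \oo] --> complex.Im l -> T psi = l.
  by move=> [hR hI]; apply: complex_ext => /=; exact: cvg_lim.
have fsi psi : schwartz psi -> cintg mu (fun x => f x * psi x).
  by move=> sp; rewrite fg; apply: cintg_iftM => //; exact: schwartz_cintg.
have Treg psi : schwartz psi -> T psi = cint mu (fun x => f x * psi x).
  by move=> sp; apply: Tlim; exact: gaussn_dct (fsi psi sp).
pose g' xi := (c2pi d)%:C * g xi.
have g'i : cintg mu g' by exact: cintgZ.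
have Tfour phi : schwartz phi -> cintg mu (fun xi => g' xi * phi xi) /\
    T (fourier phi) = cint mu (fun xi => g' xi * phi xi).
  move=> sp; have mp := schwartz_cmeas sp; have [B pB] := schwartz_bounded sp.
  have ugE m : u (fourier phi) m =
      cint mu (fun xi => g xi * ift (fun x => fourier phi x * (gaussn m x)%:C) xi).
    rewrite -(multiplication_formula gi (ift_fourier_gaussn m sp).1) -fg.
    by apply: eq_cint => x; rewrite mulrA.
  have hc xi := approx_identity (sp.1 [::]).1 (a := xi).
  have hi xi : cintg mu (fun x => phi x * (gaussd 1 (x - xi))%:C).
    have [h _] := heat_conv_bound 0 xi mp pB.
    by move: h; congr cintg; apply/funext => x; rewrite heat0E.
  have cvgphi xi := cabs_cvg (hc xi (hi xi)).
  have [] := @cint_dominated _ _ _ mu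
    (fun m xi => g xi * ift (fun x => fourier phi x * (gaussn m x)%:C) xi)
    (fun xi => g' xi * phi xi) (fun xi => B * c2pi d * cabs (g xi)).
  - by move=> m; apply: cmeasM => //; apply: cmeas_iftT; exact: (ift_fourier_gaussn m sp).1.
  - move=> xi; under eq_fun do rewrite (ift_fourier_gaussn _ sp).2 cReM.
    rewrite /g' (mulrC (c2pi d)%:C) -mulrA cReM; have [h1 h2] := cvgphi xi.
    by apply: cvgB; apply: cvgM => //; exact: cvg_cst.
  - move=> xi; under eq_fun do rewrite (ift_fourier_gaussn _ sp).2 cImM.
    rewrite /g' (mulrC (c2pi d)%:C) -mulrA cImM; have [h1 h2] := cvgphi xi.
    by apply: cvgD; apply: cvgM => //; exact: cvg_cst.
  - exact: integrable_scale (cintg_cabs gi).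
  - move=> m xi; rewrite cabsM mulrC ler_wpM2r ?cabs_ge0// (ift_fourier_gaussn _ sp).2.
    exact: (heat_conv_bound _ _ mp pB).2.
  move=> i cR cI; split => //; apply: Tlim; split.
    by under eq_fun do rewrite ugE.
  by under eq_fun do rewrite ugE.
have Treg' : regular_distribution f T.
  by move=> psi sp; split; [exact: fsi|exact: Treg].
have Ttemp : tempered T.
  split.
    move=> a phi psi sp ss; have i1 := fsi _ sp; have i2 := fsi _ ss.
    rewrite (Treg _ sp) (Treg _ ss) -cintZ// -cintD//; last exact: cintgZ.
    have E : (fun x => f x * (a * phi x + psi x)) = (fun x => a * (f x * phi x) + f x * psi x).
      by apply/funext => x; ring.
    rewrite -E; apply: Tlim; apply: (@gaussn_dct (fun x => f x * (a * phi x + psi x))).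
    by rewrite E; apply: cintgD => //; exact: cintgZ.
  exists (K 0%N * \int[mu]_x decay x), (2 * d)%N => phi B sp hB.
  rewrite Treg// (le_trans (cabs_cint (fsi _ sp)))//.
  have b x : cabs (f x * phi x) <= K 0%N * B * decay x.
    rewrite cabsM -mulrA ler_pM ?cabs_ge0// ?(wiener_bounded rho0 x fK)//.
    exact: schwartz_decay (hB [::] _ x).
  rewrite mulrAC -RintegralZl//; last exact: integrable_decay.
  apply: le_Rintegral => //; first exact: cintg_cabs (fsi _ sp).
  exact: integrable_scale (@integrable_decay R d).
apply: le_trans (ereal_inf_lbound _) _; first by exists T.
apply: le_trans (ereal_inf_lbound _) _.
  exists g' => //; split => //; split; first exact: cintg_meas g'i.
  by move=> phi sp; exact: Tfour.
have hg' xi : cabs (g' xi) = c2pi d * cabs (g xi).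
  by rewrite cabsM cabs_real ger0_norm// ltW.
apply: le_trans (wnormZ (ltW c0) mg hg' (gK n)).
under eq_integral do rewrite powR_mulrn ?japanese_ge0//.
apply: ge0_le_integral => //.
- by move=> xi _; rewrite lee_fin !mulr_ge0 ?expR_ge0 ?exprn_ge0 ?japanese_ge0 ?cabs_ge0.
- apply/measurable_EFinP; apply: measurable_funM; last exact: measurable_cabs (cintg_meas g'i).
  apply: measurable_funM; last exact: measurable_funX measurable_japanese.
  apply: (measurableT_comp (@measurable_expR R)); apply: measurable_funM => //.
  exact: measurable_japanese.
- by apply/measurable_EFinP; exact: measurable_wt_cabs (cintg_meas g'i).
- move=> xi _; rewrite lee_fin ler_wpM2r ?cabs_ge0// /wt ler_wpM2l ?expR_ge0//.
  rewrite lerXn2r ?nnegrE ?mulr_ge0 ?japanese_ge0//.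
  by rewrite ler_peMl ?japanese_ge0// ler1n.
Qed.

Lemma A_norm_dist_ge0 (rho s : R) (T : ('rV[R]_d -> R[i]) -> R[i]) :
  (0 <= A_norm_dist rho s T)%E.
Proof.
apply/ereal_infP => _ [g _ <-]; apply: integral_ge0 => xi _.
by rewrite lee_fin !mulr_ge0 ?expR_ge0 ?powR_ge0 ?cabs_ge0.
Qed.

Lemma A_norm_ge0 rho s f : (0 <= A_norm rho s f)%E.
Proof. by apply/ereal_infP => _ [T _ <-]; exact: A_norm_dist_ge0. Qed.

(** A loss in the exponential weight pays for any power. *)
Lemma wt_trade rho1 rho0 n : rho1 < rho0 ->
  exists2 C : R, 0 <= C & forall xi : 'rV[R]_d, wt rho1 n xi <= C * expR (rho0 * japanese xi).
Proof.
move=> r10; pose del := rho0 - rho1; have del0 : 0 < del by rewrite subr_gt0.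
pose B := 2 / del; have B0 : 0 < B by rewrite divr_gt0.
exists (((2 + B) ^+ n.+1) * n.+1%:R ^+ n.+1).
  by rewrite mulr_ge0 ?exprn_ge0 ?addr_ge0// ltW.
move=> xi; rewrite /wt mulrC.
have -> : rho0 * japanese xi = del * japanese xi + rho1 * japanese xi by rewrite /del; ring.
rewrite expRD mulrA ler_wpM2r ?expR_ge0//.
have j0 := japanese_ge0 xi; have j1 := japanese_ge1 xi.
have u0 : 0 <= del * japanese xi by rewrite mulr_ge0// ltW.
rewrite (@le_trans _ _ ((2 + B) ^+ n.+1 * (1 + del * japanese xi) ^+ n.+1))//; last first.
  by rewrite -mulrA ler_wpM2l ?pow_le_expR// exprn_ge0// addr_ge0// ltW.
rewrite -exprMn (@le_trans _ _ ((2 * japanese xi) ^+ n.+1))//.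
  by rewrite ler_weXn2l// two_japanese_ge1.
rewrite lerXn2r ?nnegrE ?mulr_ge0 ?addr_ge0 ?(ltW B0)//.
rewrite (_ : (2 + B) * _ = 2 * japanese xi + 2 + B + 2 * (del * japanese xi)); last first.
  by rewrite /B; field; exact: lt0r_neq0.
by have := ltW B0; move: u0; set u := del * _; lra.
Qed.

(** Conversely a finite norm gives a density: testing against modulated
    Gaussians identifies a continuous function with the inverse transform. *)
Lemma A_norm_wiener rho1 rho0 : 0 <= rho1 -> rho1 < rho0 ->
  exists C : nat -> R, forall (k : nat) (K : R) f, ccontinuous f ->
    (A_norm rho0 k%:R f <= K%:E)%E -> wiener rho1 (fun n => C n * (K + 1)) f.
Proof.
move=> r0 r10.
have /choice[C CP] (n : nat) : exists C : R, 0 <= C /\ forall xi : 'rV[R]_d,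
    wt rho1 n xi <= C * expR (rho0 * japanese xi).
  by have [C C0 CP] := wt_trade n r10; exists C.
have c0 := @c2pi_gt0 R d.
exists (fun n => (c2pi d)^-1 * C n) => k K f cf fK.
have /ereal_inf_lt[_ [T Treg <-]] : (A_norm rho0 k%:R f < (K + 1)%:E)%E.
  by rewrite (le_lt_trans fK)// lte_fin ltrDl.
move=> /ereal_inf_lt[_ [g [_ [mg Tg]] <-]] gK.
have mw : measurable_fun setT (fun xi : 'rV[R]_d => expR (rho0 * japanese xi) * cabs (g xi)).
  apply: measurable_funM; last exact: measurable_cabs.
  apply: (measurableT_comp (@measurable_expR R)); apply: measurable_funM => //.
  exact: measurable_japanese.
have gK' : (\int[mu]_xi (expR (rho0 * japanese xi) * cabs (g xi))%:E <= (K + 1)%:E)%E.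
  apply: le_trans (ltW gK); apply: ge0_le_integral => //.
  - by move=> xi _; rewrite lee_fin mulr_ge0 ?expR_ge0 ?cabs_ge0.
  - exact/measurable_EFinP.
  - apply/measurable_EFinP; under eq_fun do rewrite powR_mulrn ?japanese_ge0//.
    under eq_fun do rewrite mulrAC; apply: measurable_funM => //.
    exact: measurable_funX measurable_japanese.
  - move=> xi _; rewrite lee_fin powR_mulrn ?japanese_ge0// mulrAC ler_peMr//.
      by rewrite mulr_ge0 ?expR_ge0 ?cabs_ge0.
    by rewrite exprn_ege1// japanese_ge1.
have gn n : (wnorm rho1 n g <= (C n * (K + 1))%:E)%E.
  apply: (@le_trans _ _ (\int[mu]_xi ((C n)%:E * (expR (rho0 * japanese xi) * cabs (g xi))%:E))%E).
    apply: ge0_le_integral => //.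
    - by move=> xi _; rewrite lee_fin mulr_ge0 ?wt_ge0 ?cabs_ge0.
    - by apply/measurable_EFinP; exact: measurable_wt_cabs.
    - by apply/measurable_EFinP; exact: measurable_funM.
    - by move=> xi _; rewrite -EFinM lee_fin mulrA ler_wpM2r ?cabs_ge0// (CP n).2.
  rewrite ge0_integralZl//; first last.
  - by rewrite lee_fin (CP n).1.
  - by move=> xi _; rewrite lee_fin mulr_ge0 ?expR_ge0 ?cabs_ge0.
  - exact/measurable_EFinP.
  by rewrite EFinM lee_wpmul2l// lee_fin (CP n).1.
have gi := wiener_cintg r0 mg gn.
have test a n : cintg mu (fun x => f x * (heat n (x - a))%:C) /\
    cint mu (fun x => f x * (heat n (x - a))%:C) =
    cint mu (fun xi => expi (dotp a xi) * g xi * (gaussn n xi)%:C).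
  have n0 : 0 < n.+1%:R^-1 :> R by rewrite invr_gt0.
  have s1 := gauss_poly_schwartz n0 (gauss_poly_base n.+1%:R^-1 a 0).
  have F : fourier (gaussian_wave n.+1%:R^-1 a 0) = (fun x => (heat n (x - a))%:C).
    apply/funext => x; rewrite fourierE.
    have -> : ift (gaussian_wave n.+1%:R^-1 a 0) (- x) =
        cint mu (fun y => expi (dotp (a - x) y) * (gaussd n.+1%:R^-1 y)%:C).
      by apply: eq_cint => y; rewrite /gaussian_wave subr0 mulrA -expiD -dotpDl (addrC (- x)).
    rewrite cint_gauss_heat -realCM mulrA mulVf ?mul1r ?gt_eqF//.
    by rewrite /heat /gaussd -(opprB x) dotpNl dotpNr opprK.
  have s2 : schwartz (fun x => (heat n (x - a))%:C).
    have n1 : 0 < n.+1%:R :> R by [].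
    have := gauss_poly_schwartz n1 (gauss_polyZ (Num.sqrt n.+1%:R ^+ d)%:C
      (gauss_poly_base n.+1%:R 0 a)).
    congr schwartz; apply/funext => x.
    by rewrite /gaussian_wave dotp0l expi0 mul1r /heat realCM.
  have [i e] := Treg _ s2; split => //.
  have [_] := Tg _ s1; rewrite F e => {}e.
  transitivity (cint mu (fun xi => g xi * gaussian_wave n.+1%:R^-1 a 0 xi)); first exact: e.
  by apply: eq_cint => xi; rewrite /gaussian_wave subr0 mulrA (mulrC (g xi)).
have fg a : (c2pi d)%:C * f a = ift g a.
  have hi : cintg mu (fun x => f x * (gaussd 1 (x - a))%:C).
    have [h _] := test a 0%N.
    by move: h; congr cintg; apply/funext => x; rewrite heat0E.
  have [hR hI] := cabs_cvg (approx_identity cf hi).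
  have [gR gI] := gaussn_dct (cintg_ift a gi).
  have E n := (test a n).2.
  apply: complex_ext.
    by move: hR; under eq_fun do rewrite E; move=> hR; exact: (cvg_unique _ hR gR).
  by move: hI; under eq_fun do rewrite E; move=> hI; exact: (cvg_unique _ hI gI).
have -> : f = (fun x => ((c2pi d)^-1)%:C * ift g x).
  by apply/funext => a; rewrite -fg mulrA -realCM mulVf ?mul1r// gt_eqF.
have := @wienerZ _ _ rho1 (fun n => C n * (K + 1)) (ift g) ((c2pi d)^-1)%:C r0.
rewrite cabs_real ger0_norm ?invr_ge0 ?(ltW c0)// => h.
under [X in wiener _ X _]eq_fun do rewrite -mulrA.
by apply: h; exists g.
Qed.

End multiplication_formula.

(** * Asymptotic classes as the time variable tends to zero *)

Section asymptotic_classes.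
Context {R : realType} {d : nat}.
Variables (p gam : R) (top : nat).
Hypothesis gam0 : 0 <= gam.
Hypothesis top0 : (0 < top)%N.

(** The data are the pair of the logarithm of the final profile and the
    potential.  Coefficients and remainders are functionals of the data, so that
    the combinatorial part of the construction is done once for all data. *)
Definition profile_data := (('rV[R]_d -> R[i]) * ('rV[R]_d -> R))%type.
Implicit Types (th : profile_data) (c : profile_data -> 'rV[R]_d -> R[i])
  (F G : profile_data -> R -> 'rV[R]_d -> R[i]).

(** Bounds implied by admissibility with size at most one, including those of the
    potential. *)
Definition data_bounds (rho0 Rb : R) th :=
  [/\ csmooth th.1, (forall i, (A_norm rho0 6 (partial i th.1) <= Rb%:E)%E),
      (A_norm rho0 6 (fun y => (expR (p * complex.Re (th.1 y)))%:C) <= 1%:E)%E,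
      continuous th.2 & (A_norm rho0 6 (fun y => (th.2 y)%:C) <= 1%:E)%E].

(** The bounds depend on the data only through the radii and [Rb]; the strict loss
    of radius is what yields them for all powers of the bracket. *)
Definition tame c := forall rho1 rho0 Rb : R, 0 < rho1 -> rho1 < rho0 ->
  exists K : nat -> R, forall th, data_bounds rho0 Rb th -> wiener rho1 K (c th).

Lemma tameD c1 c2 : tame c1 -> tame c2 -> tame (fun th y => c1 th y + c2 th y).
Proof.
move=> n1 n2 rho1 rho0 Rb r1 r10; have [K1 h1] := n1 _ _ Rb r1 r10.
have [K2 h2] := n2 _ _ Rb r1 r10; exists (fun n => K1 n + K2 n) => th v.
by apply: (wienerD (ltW r1)); [exact: h1|exact: h2].
Qed.

Lemma tameM c1 c2 : tame c1 -> tame c2 -> tame (fun th y => c1 th y * c2 th y).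
Proof.
move=> n1 n2 rho1 rho0 Rb r1 r10; have [K1 h1] := n1 _ _ Rb r1 r10.
have [K2 h2] := n2 _ _ Rb r1 r10; exists (fun n => K1 n * K2 n) => th v.
by apply: (wienerM (ltW r1)); [exact: h1|exact: h2].
Qed.

Lemma tameZ (a : R[i]) c : tame c -> tame (fun th y => a * c th y).
Proof.
move=> n1 rho1 rho0 Rb r1 r10; have [K h] := n1 _ _ Rb r1 r10.
by exists (fun n => cabs a * K n) => th v; apply: (wienerZ _ (ltW r1)); exact: h.
Qed.

Lemma tame_Re c : tame c -> tame (fun th y => (complex.Re (c th y))%:C).
Proof.
move=> n1 rho1 rho0 Rb r1 r10; have [K h] := n1 _ _ Rb r1 r10.
by exists K => th v; apply: (wiener_Re (ltW r1)); exact: h.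
Qed.

Lemma tame_partial i c : tame c -> tame (fun th => partial i (c th)).
Proof.
move=> n1 rho1 rho0 Rb r1 r10; have [K h] := n1 _ _ Rb r1 r10.
by exists (fun n => K n.+1) => th v; apply: (wiener_partial (ltW r1)); exact: h.
Qed.

Lemma tame_dPsi i : tame (fun th => partial i th.1).
Proof.
move=> rho1 rho0 Rb r1 r10; have [C h] := @A_norm_wiener R d _ _ (ltW r1) r10.
exists (fun n => C n * (Rb + 1)) => th [s b _ _ _]; apply: (h 6%N) => //.
exact: (csmooth_partial _ s [::]).1.
Qed.

Lemma tame_density : tame (fun th y => (expR (p * complex.Re (th.1 y)))%:C).
Proof.
move=> rho1 rho0 Rb r1 r10; have [C h] := @A_norm_wiener R d _ _ (ltW r1) r10.
exists (fun n => C n * (1 + 1)) => th [s _ b _ _]; apply: (h 6%N) => //.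
apply: ccontinuous_real => y; have [c _] := (s [::]).1.
apply: (continuous_comp (f := fun y => p * complex.Re (th.1 y))); last exact: continuous_expR.
by apply: rV_continuousM => //; exact: cst_continuous.
Qed.

Lemma tame_potential : tame (fun th y => (th.2 y)%:C).
Proof.
move=> rho1 rho0 Rb r1 r10; have [C h] := @A_norm_wiener R d _ _ (ltW r1) r10.
exists (fun n => C n * (1 + 1)) => th [_ _ _ ch b]; apply: (h 6%N) => //.
exact: ccontinuous_real.
Qed.

(** At least one for all [tau], hence powers of it increase with the exponent. *)
Definition log_weight (tau : R) : R := 1 + `|ln tau|.

Lemma log_weight_ge1 tau : 1 <= log_weight tau. Proof. by rewrite lerDl. Qed.

Lemma log_weight_ge0 tau : 0 <= log_weight tau. Proof. exact: le_trans (log_weight_ge1 tau). Qed.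

(** The class O(tau^s |log tau|^N) for some [N], uniformly over the data.  [N] is
    chosen before the radii, as in the theorem. *)
Definition tauO (s : nat) F := exists N : nat,
  forall rho1 rho0 Rb : R, 0 < rho1 -> rho1 < rho0 ->
  exists K : nat -> R, forall th tau, data_bounds rho0 Rb th -> 0 < tau <= 1 ->
    wiener rho1 (fun n => K n * (tau ^+ s * log_weight tau ^+ N)) (F th tau).

Definition data_agree F G := forall rho0 Rb th tau, data_bounds rho0 Rb th -> 0 < tau <= 1 ->
  F th tau =1 G th tau.

Lemma tauO_ext s F G : data_agree G F -> tauO s F -> tauO s G.
Proof.
move=> FG [N h]; exists N => rho1 rho0 Rb r1 r10; have [K {}h] := h _ _ Rb r1 r10.
exists K => th tau v t; rewrite (_ : G th tau = F th tau); first exact: h.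
by apply/funext; exact: (FG _ _ _ _ v).
Qed.

Lemma tauO_weaken s s' N N' (K : R) tau : (s' <= s)%N -> (N <= N')%N -> 0 < tau <= 1 ->
  0 <= K * (tau ^+ s * log_weight tau ^+ N) ->
  K * (tau ^+ s * log_weight tau ^+ N) <= K * (tau ^+ s' * log_weight tau ^+ N').
Proof.
move=> ss NN /andP[t0 t1]; have l0 : 0 < log_weight tau by apply: lt_le_trans (log_weight_ge1 tau).
rewrite pmulr_lge0 ?mulr_gt0 ?exprn_gt0// => K0.
rewrite ler_wpM2l// ler_pM ?exprn_ge0 ?(ltW t0) ?(ltW l0)//.
  by rewrite ler_wiXn2l ?(ltW t0).
by rewrite ler_weXn2l ?log_weight_ge1.
Qed.

Lemma tauO_le s s' F : (s' <= s)%N -> tauO s F -> tauO s' F.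
Proof.
move=> ss [N h]; exists N => rho1 rho0 Rb r1 r10; have [K {}h] := h _ _ Rb r1 r10.
exists K => th tau v t; have w := h _ _ v t; apply: wiener_le w => n.
by apply: tauO_weaken => //; exact: (wiener_ge0 (h _ _ v t) n).
Qed.

Lemma tauOD s F G : tauO s F -> tauO s G -> tauO s (fun th tau y => F th tau y + G th tau y).
Proof.
move=> [N1 h1] [N2 h2]; exists (N1 + N2)%N => rho1 rho0 Rb r1 r10.
have [K1 {}h1] := h1 _ _ Rb r1 r10; have [K2 {}h2] := h2 _ _ Rb r1 r10.
exists (fun n => K1 n + K2 n) => th tau v t.
apply: wiener_le (wienerD (ltW r1) (h1 _ _ v t) (h2 _ _ v t)) => n; rewrite mulrDl.
apply: lerD; apply: tauO_weaken; rewrite ?leq_addr ?leq_addl//.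
  exact: (wiener_ge0 (h1 _ _ v t) n).
exact: (wiener_ge0 (h2 _ _ v t) n).
Qed.

Lemma tauOM s1 s2 F G : tauO s1 F -> tauO s2 G ->
  tauO (s1 + s2) (fun th tau y => F th tau y * G th tau y).
Proof.
move=> [N1 h1] [N2 h2]; exists (N1 + N2)%N => rho1 rho0 Rb r1 r10.
have [K1 {}h1] := h1 _ _ Rb r1 r10; have [K2 {}h2] := h2 _ _ Rb r1 r10.
exists (fun n => K1 n * K2 n) => th tau v t.
apply: wiener_le (wienerM (ltW r1) (h1 _ _ v t) (h2 _ _ v t)) => n.
by rewrite !exprD le_eqVlt; apply/orP; left; apply/eqP; ring.
Qed.

Lemma tauOZ (a : R[i]) s F : tauO s F -> tauO s (fun th tau y => a * F th tau y).
Proof.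
move=> [N h]; exists N => rho1 rho0 Rb r1 r10; have [K {}h] := h _ _ Rb r1 r10.
exists (fun n => cabs a * K n) => th tau v t.
apply: wiener_le (wienerZ a (ltW r1) (h _ _ v t)) => n.
by rewrite mulrA.
Qed.

Lemma tauO_Re s F : tauO s F -> tauO s (fun th tau y => (complex.Re (F th tau y))%:C).
Proof.
move=> [N h]; exists N => rho1 rho0 Rb r1 r10; have [K {}h] := h _ _ Rb r1 r10.
by exists K => th tau v t; apply: (wiener_Re (ltW r1)); exact: h.
Qed.

Lemma tauO0 s : tauO s (fun _ _ _ => 0).
Proof.
exists 0%N => rho1 rho0 Rb r1 r10; exists (fun=> 0) => th tau v t.
apply: wiener_le (wiener0 rho1) => n; by rewrite mul0r.
Qed.

(** The exponents [l1 + l2 * gam] with at least [k] factors of [tau] besides the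
    powers of [tau ^ gam].  Counts add under products, and each nonlinear or
    spatial term of the residuals has count at least one. *)
Definition exponent_ge (k : nat) (q : R) := exists l1 l2 : nat, (k <= l1)%N /\ q = l1%:R + l2%:R * gam.

Lemma exponent_lower_bound k q : exponent_ge k q -> k%:R <= q.
Proof.
move=> [l1 [l2 [kl ->]]]; rewrite (@le_trans _ _ l1%:R) ?ler_nat//.
by rewrite lerDl mulr_ge0.
Qed.

Lemma exponent_geD k l q r : exponent_ge k q -> exponent_ge l r -> exponent_ge (k + l) (q + r).
Proof.
move=> [a1 [a2 [ka ->]]] [b1 [b2 [lb ->]]]; exists (a1 + b1)%N, (a2 + b2)%N.
by split; [exact: leq_add|rewrite !natrD; ring].
Qed.

Lemma exponent_ge_le k l q : (l <= k)%N -> exponent_ge k q -> exponent_ge l q.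
Proof. by move=> lk [a [b [ka E]]]; exists a, b; split => //; exact: leq_trans ka. Qed.

Lemma exponent_ge_nat k : exponent_ge k k%:R.
Proof. by exists k, 0%N; split; rewrite ?mul0r ?addr0. Qed.

Lemma exponent_ge_gam : exponent_ge 0 gam.
Proof. by exists 0%N, 1%N; split; rewrite ?mul1r ?add0r. Qed.

Definition log_monomial (q : R) (j : nat) c th (tau : R) (y : 'rV[R]_d) : R[i] :=
  (tau `^ q * ln tau ^+ j)%:C * c th y.

Lemma tauO_log_monomial s q j c : s%:R <= q -> tame c -> tauO s (log_monomial q j c).
Proof.
move=> sq nc; exists j => rho1 rho0 Rb r1 r10; have [K h] := nc _ _ Rb r1 r10.
exists K => th tau v /andP[t0 t1].
have w := h _ v; apply: wiener_le (wienerZ _ (ltW r1) w) => n.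
rewrite mulrC ler_wpM2l ?(wiener_ge0 w)// cabs_real normrM normrX.
rewrite ger0_norm ?powR_ge0// ler_pM ?exprn_ge0 ?powR_ge0//.
  by rewrite -powR_mulrn ?(ltW t0)// ger_powR// t0.
by rewrite lerXn2r ?nnegrE ?log_weight_ge0// lerDr.
Qed.

(** With [u = - ln tau] this is a polynomial in [u] against its exponential. *)
Lemma log_weight_power_le N : exists2 C : R, 0 <= C & forall tau, 0 < tau <= 1 -> tau * log_weight tau ^+ N <= C.
Proof.
exists (N.+1%:R ^+ N.+1); first by rewrite exprn_ge0.
move=> tau /andP[t0 t1]; pose u := - ln tau.
have u0 : 0 <= u by rewrite oppr_ge0 ln_le0.
have -> : log_weight tau = 1 + u by rewrite /log_weight ler0_norm ?ln_le0.
have et : expR u = tau^-1 by rewrite expRN lnK.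
rewrite (@le_trans _ _ (tau * (1 + u) ^+ N.+1))//.
  by rewrite ler_wpM2l ?(ltW t0)// ler_weXn2l// lerDl.
rewrite (le_trans (ler_wpM2l (ltW t0) (pow_le_expR N u0)))// et.
by rewrite mulrCA divff ?mulr1// lt0r_neq0.
Qed.

(** Raising to the power [m.+1] multiplies the order, and the exponential of
    the bound stays bounded since [tau * log_weight tau ^+ N] is. *)
Lemma tauO_exp_rem (r : profile_data -> R -> 'rV[R]_d -> R) m :
  tauO 1 (fun th tau y => (r th tau y)%:C) ->
  tauO m.+1 (fun th tau y =>
     (expR (r th tau y) - \sum_(j < m.+1) r th tau y ^+ j / j`!%:R)%:C).
Proof.
move=> [N h]; have [C C0 hC] := log_weight_power_le N.
exists (N * m.+1)%N => rho1 rho0 Rb r1 r10; have [K {}h] := h _ _ Rb r1 r10.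
exists (fun n => K n ^+ m.+1 * expR (K n * C)) => th tau v t.
have w := h _ _ v t; apply: wiener_le (wiener_exp_rem (ltW r1) m w) => n.
have t0 : 0 < tau by case/andP: t.
have l0 : 0 < log_weight tau by apply: lt_le_trans (log_weight_ge1 tau).
have K0 : 0 <= K n by have := wiener_ge0 w n; rewrite pmulr_lge0// mulr_gt0 ?exprn_gt0.
have a0 : 0 <= tau ^+ 1 * log_weight tau ^+ N by rewrite mulr_ge0// exprn_ge0 ?(ltW t0) ?(ltW l0).
rewrite /= [leRHS](_ : _ = (K n * (tau ^+ 1 * log_weight tau ^+ N)) ^+ m.+1 * expR (K n * C)).
  apply: ler_wpM2l; first by apply: exprn_ge0; exact: mulr_ge0.
  by rewrite ler_expR; apply: ler_wpM2l => //; rewrite expr1 hC.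
by rewrite !exprMn -!exprM mul1n; ring.
Qed.

(** Finite sums of powers and logarithms with exponents counted by [k], modulo
    a remainder of order [top].  The remainders form an ideal for all
    operations, so that expansions can be multiplied and composed without being
    computed. *)
Inductive expands (k : nat) : (profile_data -> R -> 'rV[R]_d -> R[i]) -> Prop :=
| expands_term q j c : exponent_ge k q -> tame c -> expands k (log_monomial q j c)
| expands_O F : tauO top F -> expands k F
| expands_D F G : expands k F -> expands k G -> expands k (fun th tau y => F th tau y + G th tau y)
| expands_ext F G : data_agree G F -> expands k F -> expands k G.

Lemma expands_tauO k s F : (s <= k)%N -> (s <= top)%N -> expands k F -> tauO s F.
Proof.
move=> sk st; elim=> {F} [q j c e n|F|F G _ h1 _ h2|F G FG _ h].
- by apply: tauO_log_monomial => //; apply: le_trans (exponent_lower_bound e); rewrite ler_nat.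
- exact: tauO_le.
- exact: tauOD.
- exact: tauO_ext h.
Qed.

Lemma expands_le k l F : (l <= k)%N -> expands k F -> expands l F.
Proof.
move=> lk; elim=> {F} [q j c e n|F|F G _ h1 _ h2|F G FG _ h].
- by apply: expands_term => //; exact: exponent_ge_le e.
- exact: expands_O.
- exact: expands_D.
- exact: expands_ext h.
Qed.

(** A product of terms is a term; any product with a remainder is a remainder,
    since every expansion is bounded up to logarithms. *)
Lemma expands_M k l F G : expands k F -> expands l G -> expands (k + l) (fun th tau y => F th tau y * G th tau y).
Proof.
move=> QF QG; elim: QF => {F} [q j c e n|F OF|F F' _ h1 _ h2|F F' FF _ h].
- elim: QG => {G} [q' j' c' e' n'|G OG|G G' _ h1 _ h2|G G' GG _ h].
  + apply: expands_ext (expands_term (j + j') (exponent_geD e e') (tameM n n')) => rho0 Rb th tau _ /andP[t0 _] y.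
    rewrite /log_monomial powRD; last by rewrite (gt_eqF t0) implybT.
    by rewrite exprD !realCM; ring.
  + apply: expands_O; rewrite -(add0n top); apply: tauOM => //; apply: tauO_log_monomial => //.
    by apply: le_trans (exponent_lower_bound e).
  + by apply: expands_ext (expands_D h1 h2) => rho0 Rb th tau _ _ y; rewrite mulrDr.
  + by apply: expands_ext h => rho0 Rb th tau v t y; rewrite (GG _ _ _ _ v t).
- apply: expands_O; rewrite -(addn0 top); apply: tauOM => //.
  exact: (expands_tauO (leq0n l)).
- by apply: expands_ext (expands_D h1 h2) => rho0 Rb th tau _ _ y; rewrite mulrDl.
- by apply: expands_ext h => rho0 Rb th tau v t y; rewrite (FF _ _ _ _ v t).
Qed.

Lemma expands_coef c : tame c -> expands 0 (fun th tau y => c th y).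
Proof.
move=> n; apply: expands_ext (expands_term 0 (exponent_ge_nat 0) n) => rho0 Rb th tau _ _ y.
by rewrite /log_monomial powRr0 expr0 mulr1 mul1r.
Qed.

Lemma expands_Z (a : R[i]) k F : expands k F -> expands k (fun th tau y => a * F th tau y).
Proof.
elim=> {F} [q j c e n|F OF|F G _ h1 _ h2|F G FG _ h].
- apply: expands_ext (expands_term j e (tameZ a n)) => rho0 Rb th tau _ _ y.
  by rewrite /log_monomial mulrCA.
- exact/expands_O/tauOZ.
- by apply: expands_ext (expands_D h1 h2) => rho0 Rb th tau _ _ y; rewrite mulrDr.
- by apply: expands_ext h => rho0 Rb th tau v t y; rewrite (FG _ _ _ _ v t).
Qed.

Lemma expands_0 k : expands k (fun _ _ _ => 0).
Proof. exact/expands_O/tauO0. Qed.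

Lemma expands_sum k I (r : seq I) (F : I -> profile_data -> R -> 'rV[R]_d -> R[i]) :
  (forall i, expands k (F i)) -> expands k (fun th tau y => \sum_(i <- r) F i th tau y).
Proof.
move=> h; elim: r => [|i r IH].
  by apply: expands_ext (expands_0 k) => rho0 Rb th tau _ _ y; rewrite big_nil.
by apply: expands_ext (expands_D (h i) IH) => rho0 Rb th tau _ _ y; rewrite big_cons.
Qed.

(** The power carries its own count [l], which adds to that of the expansion. *)
Lemma expands_pow k q l F : exponent_ge l q -> expands k F ->
  expands (l + k) (fun th tau y => (tau `^ q)%:C * F th tau y).
Proof.
move=> e; elim=> {F} [q' j c e' n|F OF|F G _ h1 _ h2|F G FG _ h].
- apply: expands_ext (expands_term j (exponent_geD e e') n) => rho0 Rb th tau _ /andP[t0 _] y.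
  rewrite /log_monomial powRD; last by rewrite (gt_eqF t0) implybT.
  by rewrite !realCM; ring.
- apply: expands_O; case: OF => N h; exists N => rho1 rho0 Rb r1 r10.
  have [K {}h] := h _ _ Rb r1 r10; exists K => th tau v t.
  have w := h _ _ v t; apply: wiener_le (wienerZ _ (ltW r1) w) => n.
  rewrite cabs_real ger0_norm ?powR_ge0// -[leRHS]mul1r ler_wpM2r ?(wiener_ge0 w)//.
  by rewrite -(powRr0 tau) ger_powR// (le_trans _ (exponent_lower_bound e)).
- by apply: expands_ext (expands_D h1 h2) => rho0 Rb th tau _ _ y; rewrite mulrDr.
- by apply: expands_ext h => rho0 Rb th tau v t y; rewrite (FG _ _ _ _ v t).
Qed.

Lemma expands_X k F j : expands k F -> expands k (fun th tau y => F th tau y ^+ j.+1).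
Proof.
move=> h; elim: j => [|j IH].
  by apply: expands_ext h => rho0 Rb th tau _ _ y; rewrite expr1.
apply: (expands_le (leq_addr k k)).
by apply: expands_ext (expands_M h IH) => rho0 Rb th tau _ _ y; rewrite exprS.
Qed.

(** Nonzero constants are not transforms of integrable densities, so [1] is
    subtracted.  The Taylor polynomial of degree [top] is an expansion and what
    is left has order [top]. *)
Lemma expands_exp k (r : profile_data -> R -> 'rV[R]_d -> R) : (0 < k)%N ->
  expands k (fun th tau y => (r th tau y)%:C) ->
  expands k (fun th tau y => (expR (r th tau y) - 1)%:C).
Proof.
move=> k0 h; have O1 : tauO 1 (fun th tau y => (r th tau y)%:C) by exact: expands_tauO h.
have Qs : expands k (fun th tau y => \sum_(j < top) (j.+1`!%:R^-1)%:C * (r th tau y)%:C ^+ j.+1).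
  by apply: expands_sum => j; apply: expands_Z; exact: expands_X.
have OR := tauO_le (leqnSn top) (tauO_exp_rem top O1).
apply: expands_ext (expands_D (expands_O k OR) Qs) => rho0 Rb th tau _ _ y.
rewrite (_ : \sum_(j < top) _ = (\sum_(j < top) r th tau y ^+ j.+1 / j.+1`!%:R)%:C).
  by rewrite -realCD big_ord_recl expr0 fact0 divr1; congr _%:C; rewrite -[LHS]/(_ - _); ring.
by rewrite realC_sum; apply: eq_bigr => j _; rewrite -realCX -realCM mulrC.
Qed.

End asymptotic_classes.

(** * Finite sums of powers and logarithms *)

Section log_power_lists.
Context {R : realType} {d : nat}.
Variables (p gam al : R) (top : nat).
Hypothesis gam0 : 0 <= gam.
Hypothesis top0 : (0 < top)%N.
Hypothesis al0 : 0 < al.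

Local Notation data := (@profile_data R d).
Local Notation coef := (data -> 'rV[R]_d -> R[i]).
Definition log_term : Type := (R * nat * (data -> 'rV[R]_d -> R[i]))%type.
Implicit Types (t : log_term) (l : seq log_term) (P : log_term -> Prop) (c : coef).

(** Coefficients are functionals, without decidable equality, so this is a
    proposition over the list. *)
Definition forall_terms P l : Prop := foldr (fun t A => P t /\ A) True l.

Lemma forall_cat P l1 l2 : forall_terms P l1 -> forall_terms P l2 -> forall_terms P (l1 ++ l2).
Proof. by elim: l1 => //= t l1 IH [pt p1] p2; split=> //; exact: IH. Qed.

Lemma forall_sub P P' l : (forall t, P t -> P' t) -> forall_terms P l -> forall_terms P' l.
Proof. by move=> h; elim: l => //= t l IH [pt pl]; split; [exact: h|exact: IH]. Qed.

Lemma forall_map P P' (f : log_term -> log_term) l :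
  (forall t, P t -> P' (f t)) -> forall_terms P l -> forall_terms P' (map f l).
Proof. by move=> h; elim: l => //= t l IH [pt pl]; split; [exact: h|exact: IH]. Qed.

Definition log_eval l (th : data) (tau : R) (y : 'rV[R]_d) : R[i] :=
  \sum_(t <- l) log_monomial t.1.1 t.1.2 t.2 th tau y.

Lemma log_eval_cons t l th tau y :
  log_eval (t :: l) th tau y = log_monomial t.1.1 t.1.2 t.2 th tau y + log_eval l th tau y.
Proof. by rewrite /log_eval big_cons. Qed.

Lemma log_eval_cat l1 l2 th tau y : log_eval (l1 ++ l2) th tau y = log_eval l1 th tau y + log_eval l2 th tau y.
Proof. by rewrite /log_eval big_cat. Qed.

Lemma log_eval_nil th tau y : log_eval [::] th tau y = 0.
Proof. by rewrite /log_eval big_nil. Qed.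

Definition map_coef (f : coef -> coef) l : seq log_term := [seq (t.1, f t.2) | t <- l].

Lemma log_eval_Re l th tau y : log_eval (map_coef (fun c th y => (complex.Re (c th y))%:C) l) th tau y =
  (complex.Re (log_eval l th tau y))%:C.
Proof.
elim: l => [|t l IH]; first by rewrite /= !log_eval_nil; apply: complex_ext.
by rewrite /= !log_eval_cons cReD realCD IH /log_monomial /= cReM /= mul0r subr0 !realCM.
Qed.

Lemma log_eval_scale (a : R[i]) l th tau y :
  log_eval (map_coef (fun c th y => a * c th y) l) th tau y = a * log_eval l th tau y.
Proof.
elim: l => [|t l IH]; first by rewrite /= !log_eval_nil mulr0.
by rewrite /= !log_eval_cons mulrDr IH /log_monomial /= mulrCA.
Qed.

Definition smooth_on th l := forall_terms (fun t => csmooth (t.2 th)) l.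

Lemma log_eval_cderivable l th tau : smooth_on th l -> cderivable_all (log_eval l th tau).
Proof.
elim: l => [|t l IH] /=.
  move=> _ i x; rewrite (_ : log_eval _ _ _ = fun=> 0); last by apply/funext => y; rewrite log_eval_nil.
  exact: (is_cderive_val (is_cderive_cst _ _ _)).1.
move=> [st sl].
rewrite (_ : log_eval _ _ _ = (fun y => (tau `^ t.1.1 * ln tau ^+ t.1.2)%:C * t.2 th y +
    log_eval l th tau y)); last by apply/funext => y; rewrite log_eval_cons.
apply: cderivable_allD; last exact: IH.
exact/cderivable_allZ/csmooth_cderivable.
Qed.

Definition grad_terms i l := map_coef (fun c th => partial i (c th)) l.

Lemma log_eval_partial i l th tau : smooth_on th l ->
  partial i (log_eval l th tau) = log_eval (grad_terms i l) th tau.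
Proof.
elim: l => [|t l IH] /=.
  move=> _; rewrite (_ : log_eval _ _ _ = fun=> 0); last by apply/funext => y; rewrite log_eval_nil.
  apply/funext => x.
  exact: (is_cderive_val (is_cderive_cst _ _ _)).2.
move=> [st sl].
rewrite (_ : log_eval _ _ _ = (fun y => (tau `^ t.1.1 * ln tau ^+ t.1.2)%:C * t.2 th y +
    log_eval l th tau y)); last by apply/funext => y; rewrite log_eval_cons.
rewrite partialD; first last.
- exact: log_eval_cderivable.
- exact/cderivable_allZ/csmooth_cderivable.
rewrite partialZ; last exact: csmooth_cderivable.
by rewrite IH//; apply/funext => y; rewrite /grad_terms /= log_eval_cons.
Qed.

(** By Leibniz' rule the Euler operator [al * tau * d/dtau] is [al * q] plus a
    lowering of the logarithm.  Without logarithm the second term has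
    coefficient [0], so that its exponent does not matter. *)
Definition euler_term t : seq log_term :=
  [:: (t.1, fun th y => (al * t.1.1)%:C * t.2 th y);
      ((t.1.1, t.1.2.-1), fun th y => (al * t.1.2%:R)%:C * t.2 th y)].

Definition euler l : seq log_term := flatten (map euler_term l).

Lemma euler_cat l1 l2 : euler (l1 ++ l2) = euler l1 ++ euler l2.
Proof. by rewrite /euler map_cat flatten_cat. Qed.

Lemma is_cderive_log_monomial q j c th tau y : 0 < tau ->
  is_cderive (1 : R) (fun s : R => log_monomial q j c th s y) tau
   ((q * tau `^ (q - 1) * ln tau ^+ j + tau `^ q * (j%:R * ln tau ^+ j.-1 * tau^-1))%:C * c th y).
Proof.
move=> t0; rewrite -[X in is_cderive _ _ _ X]addr0 -[X in is_cderive _ _ _ (_ + X)](mulr0 (tau `^ q * ln tau ^+ j)%:C).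
apply: is_cderiveM; last exact: is_cderive_cst.
apply: is_cderive_real.
have h1 := is_derive1_powR q t0; have h2 := is_deriveX j (is_derive1_ln t0).
rewrite (_ : (fun s : R => _) = (fun s : R => s `^ q) * (@ln R) ^+ j); last first.
  by apply/funext => s; rewrite /= !fctE.
apply: (is_derive_eq (is_deriveM h1 h2)).
rewrite /GRing.scale /= !fctE; ring.
Qed.

Lemma log_eval_euler l th tau y : 0 < tau ->
  cderivable (1 : R) (fun s : R => log_eval l th s y) tau /\
  (al * tau)%:C * dtau (log_eval l th) tau y = log_eval (euler l) th tau y.
Proof.
move=> t0; suff [D [hD E]] : exists D, is_cderive (1 : R) (fun s : R => log_eval l th s y) tau D /\
    (al * tau)%:C * D = log_eval (euler l) th tau y.
  by have [h1 h2] := is_cderive_val hD; split=> //; rewrite /dtau h2.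
elim: l => [|t l [D [hD E]]].
  exists 0; split; last by rewrite mulr0 log_eval_nil.
  under eq_fun do rewrite log_eval_nil; exact: is_cderive_cst.
have ht := @is_cderive_log_monomial t.1.1 t.1.2 t.2 th tau y t0.
eexists; split.
  under eq_fun do rewrite log_eval_cons.
  exact: is_cderiveD ht hD.
rewrite mulrDr E /euler /= !log_eval_cons addrA; congr (_ + _).
rewrite mulrA -realCM /log_monomial /= !mulrA -!realCM -mulrDl -realCD; congr (_%:C * _).
have e : tau `^ t.1.1 = tau * tau `^ (t.1.1 - 1).
  rewrite -{2}(powRr1 (ltW t0)) -powRD ?(gt_eqF t0) ?implybT//; congr (_ `^ _); ring.
by rewrite e; field; exact: lt0r_neq0.
Qed.

(** For an exponent [q] with [al * q != b] the top logarithm is divided by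
    [al * q - b] and the remainder has a lower power of the logarithm; at a
    resonance [al * q = b] one more logarithm is needed. *)
Lemma solve_euler_term (C : coef -> Prop) (b : R) q j c :
  (forall (x : R) c, C c -> C (fun th y => x%:C * c th y)) -> C c ->
  exists l, forall_terms (fun t => t.1.1 = q /\ C t.2) l /\
    forall th tau y, log_eval (euler l) th tau y - b%:C * log_eval l th tau y = log_monomial q j c th tau y.
Proof.
move=> CZ Cc; case: (eqVneq (al * q) b) => [e|ne].
  exists [:: ((q, j.+1), fun th y => ((al * j.+1%:R)^-1)%:C * c th y)].
  split; first by split=> //; split=> //; exact: CZ.
  move=> th tau y; rewrite /euler /= !log_eval_cons !log_eval_nil /log_monomial /= e.
  have a0 : al * j.+1%:R != 0 by rewrite mulf_neq0 ?lt0r_neq0// pnatr_eq0.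
  have E : (al * j.+1%:R)%:C * ((al * j.+1%:R)^-1)%:C * c th y = c th y.
    by rewrite -realCM divff// mul1r.
  by rewrite -[in RHS]E; ring.
have k0 : al * q - b != 0 by rewrite subr_eq0.
have kE x : (al * q)%:C * (((al * q - b)^-1)%:C * x) - b%:C * (((al * q - b)^-1)%:C * x) = x.
  by rewrite -mulrBl -realCB mulrA -realCM divff// mul1r.
elim: j c Cc => [|j IH] c Cc.
  exists [:: ((q, 0%N), fun th y => ((al * q - b)^-1)%:C * c th y)].
  split; first by split=> //; split=> //; exact: CZ.
  move=> th tau y; rewrite /euler /= !log_eval_cons !log_eval_nil /log_monomial /= -[in RHS](kE (c th y)) mulr0.
  by ring.
have [l [Cl hl]] := IH _ (CZ (- (al * j.+1%:R * (al * q - b)^-1)) _ Cc).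
exists (((q, j.+1), fun th y => ((al * q - b)^-1)%:C * c th y) :: l).
split; first by split=> //; split=> //; exact: CZ.
move=> th tau y; rewrite (euler_cat [:: _]) log_eval_cat /euler /= !log_eval_cons log_eval_nil.
rewrite -/(euler l) -[log_eval (euler l) th tau y](subrK (b%:C * log_eval l th tau y)) hl.
rewrite /log_monomial /= -[in RHS](kE (c th y)) !(realCN, realCM); ring.
Qed.

(** The Fuchsian equation [al * tau * d/dtau u - b * u = f] is solved term by
    term, without changing exponents; [C] stands for tameness, alone or with
    reality of the coefficients. *)
Lemma solve_euler (C : coef -> Prop) (E : R -> Prop) (b : R) l :
  (forall (x : R) c, C c -> C (fun th y => x%:C * c th y)) ->
  forall_terms (fun t => E t.1.1 /\ C t.2) l ->
  exists2 l', forall_terms (fun t => E t.1.1 /\ C t.2) l' &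
    forall th tau y, log_eval (euler l') th tau y - b%:C * log_eval l' th tau y = log_eval l th tau y.
Proof.
move=> CZ; elim: l => [_|t l IH [[Et Ct] /IH[l' hl' e']]].
  by exists [::] => // th tau y; rewrite /euler /= log_eval_nil mulr0 subr0.
have [l1 [h1 e1]] := solve_euler_term b t.1.1 t.1.2 CZ Ct; exists (l1 ++ l').
  by apply: forall_cat => //; apply: forall_sub h1 => s [-> ?].
move=> th tau y; rewrite euler_cat !log_eval_cat log_eval_cons -e1 -e'; ring.
Qed.

(** Terms with exponents [top] and larger belong to the remainder. *)
Definition kept_term k t := (exponent_ge gam k t.1.1 /\ t.1.1 < top%:R) /\ tame p t.2.

Lemma expands_log_eval k l : forall_terms (fun t => exponent_ge gam k t.1.1 /\ tame p t.2) l ->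
  expands p gam top k (log_eval l).
Proof.
elim: l => [_|t l IH [[e n] /IH h]].
  by apply: expands_ext (@expands_0 R d p gam top k) => rho0 Rb th tau _ _ y; rewrite log_eval_nil.
apply: expands_ext (expands_D (expands_term top t.1.2 e n) h) => rho0 Rb th tau _ _ y.
by rewrite log_eval_cons.
Qed.

Lemma expands_list k F : expands p gam top k F -> exists2 l, forall_terms (kept_term k) l &
  tauO p top (fun th tau y => F th tau y - log_eval l th tau y).
Proof.
elim=> {F} [q j c e n|F OF|F G _ [l1 g1 h1] _ [l2 g2 h2]|F G FG _ [l g h]].
- case: (ltP q top%:R) => qt.
    exists [:: ((q, j), c)] => //.
    apply: tauO_ext (@tauO0 R d p top) => rho0 Rb th tau _ _ y.
    by rewrite log_eval_cons log_eval_nil addr0 subrr.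
  exists [::] => //; apply: tauO_ext (tauO_log_monomial j qt n) => rho0 Rb th tau _ _ y.
  by rewrite log_eval_nil subr0.
- exists [::] => //; apply: tauO_ext OF => rho0 Rb th tau _ _ y.
  by rewrite log_eval_nil subr0.
- exists (l1 ++ l2); first exact: forall_cat.
  apply: tauO_ext (tauOD h1 h2) => rho0 Rb th tau _ _ y.
  by rewrite log_eval_cat; ring.
- exists l => //; apply: tauO_ext h => rho0 Rb th tau v t y.
  by rewrite (FG _ _ _ _ v t).
Qed.

End log_power_lists.

(** * Residuals and their improvement *)

Section fuchsian_residuals.
Context {R : realType} {d : nat}.
Variables (p : R) (top : nat).
Local Notation al := (alpha_exp d p).
Local Notation gam := (gamma_exp d p).
Hypothesis al_gt0 : 0 < al.
Hypothesis gam0 : 0 <= gam.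
Hypothesis top0 : (0 < top)%N.
Hypothesis al_neq1 : 1 - al != 0.

Local Notation data := (@profile_data R d).
Local Notation coef := (data -> 'rV[R]_d -> R[i]).
Local Notation expands := (@expands R d p gam top).
Implicit Types (o s l : seq (@log_term R d)) (c : coef) (th : data).

Definition density th y : R[i] := (expR (p * complex.Re (th.1 y)))%:C.

(** In list form, the leading phase is differentiated and multiplied by the same
    rules as its corrections. *)
Definition S_lead : seq (@log_term R d) :=
  [:: ((0, 0%N), fun th y => ((1 - al)^-1)%:C * density th y);
      ((gam, 0%N), fun th y => (th.2 y)%:C)].

(** The gradient of the logarithmic profile itself is a list although the
    profile need not be one: the datum enters only through its derivatives. *)
Definition grad_L i o : seq (@log_term R d) :=
  ((0, 0%N), fun th => partial i th.1) :: grad_terms i o.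

(** The residuals written with lists only.  Derivatives act on coefficients, and
    the residuals of a modified profile can be compared algebraically. *)
Definition formal_L o s th (tau : R) y : R[i] := log_eval (euler al o) th tau y +
  \sum_(i < d) (tau%:C * (log_eval (grad_terms i s) th tau y * log_eval (grad_L i o) th tau y) +
    (tau / 2)%:C * log_eval (grad_terms i (grad_terms i s)) th tau y +
    (0 +i* (tau `^ (gam + 1) / 2)) * (log_eval (grad_terms i (grad_L i o)) th tau y +
       log_eval (grad_L i o) th tau y * log_eval (grad_L i o) th tau y)).

Definition formal_S o s th (tau : R) y : R[i] :=
  log_eval (euler al s) th tau y - (1 - al)%:C * log_eval s th tau y +
  \sum_(i < d) (tau / 2)%:C * (log_eval (grad_terms i s) th tau y * log_eval (grad_terms i s) th tau y) +
  density th y * (expR (p * complex.Re (log_eval o th tau y)))%:C.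

Definition tame_list k l := forall_terms (fun t => exponent_ge gam k t.1.1 /\ tame p t.2) l.

Definition real_coef c := forall th y, complex.Im (c th y) = 0.

Definition real_list l := forall_terms (fun t => real_coef t.2) l.

Lemma real_coef_partial i c : real_coef c -> real_coef (fun th => partial i (c th)).
Proof.
move=> rc th y; rewrite /partial /cderive /=.
rewrite (_ : (fun y => _) = fun=> 0); first exact: derive_cst.
by apply/funext => z; exact: rc.
Qed.

Lemma tame_list_grad k i l : tame_list k l -> tame_list k (grad_terms i l).
Proof. by apply: forall_map => t [e n]; split => //=; exact: tame_partial. Qed.

Lemma real_grad i l : real_list l -> real_list (grad_terms i l).
Proof. by apply: forall_map => t r; exact: real_coef_partial. Qed.

Lemma log_eval_real l th tau y : real_list l -> complex.Im (log_eval l th tau y) = 0.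
Proof.
elim: l => [|t l IH] /=; first by rewrite log_eval_nil.
move=> [rt /IH h]; rewrite log_eval_cons cImD h addr0 /log_monomial cImM /= rt.
by rewrite mulr0 mul0r addr0.
Qed.

Lemma grad_cat i l1 l2 : grad_terms i (l1 ++ l2) = grad_terms i l1 ++ grad_terms i l2.
Proof. exact: map_cat. Qed.

Lemma tame_list_grad_L i o : tame_list 0 o -> tame_list 0 (grad_L i o).
Proof.
move=> h; split; last exact: tame_list_grad.
by split; [exact: (exponent_ge_nat gam 0)|exact: tame_dPsi].
Qed.

Lemma expands_reg k l : tame_list k l -> expands k (log_eval l).
Proof. exact: expands_log_eval. Qed.

Lemma tame_list_le k k' l : (k' <= k)%N -> tame_list k l -> tame_list k' l.
Proof. by move=> kk; apply: forall_sub => t [e n]; split => //; exact: exponent_ge_le e. Qed.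

Lemma expands_tau k F : expands k F -> expands k.+1 (fun th tau y => tau%:C * F th tau y).
Proof.
move=> h; rewrite -add1n.
apply: expands_ext (expands_pow gam0 (exponent_ge_nat gam 1) h) => rho0 Rb th tau _ /andP[t0 _] y.
by rewrite powRr1// ltW.
Qed.

(** The weight [tau ^ (gam + 1)] counts as one power of [tau]. *)
Lemma expands_dispersive k F : expands k F ->
  expands k.+1 (fun th tau y => (0 +i* (tau `^ (gam + 1) / 2)) * F th tau y).
Proof.
move=> h; have e : exponent_ge gam 1 (gam + 1).
  by rewrite addrC; exists 1%N, 1%N; rewrite mul1r.
apply: expands_ext (expands_Z (0 +i* (1 / 2)) (expands_pow gam0 e h)) => rho0 Rb th tau _ _ y.
rewrite mulrA; congr (_ * _); apply: complex_ext; rewrite /= ?cReM ?cImM /=; ring.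
Qed.

Lemma expands_half_tau k F : expands k F -> expands k.+1 (fun th tau y => (tau / 2)%:C * F th tau y).
Proof.
move=> /expands_tau /(expands_Z (2^-1)%:C); apply: expands_ext => rho0 Rb th tau _ _ y.
by rewrite realCM; ring.
Qed.

Lemma formal_S_real o s th tau y : real_list s -> complex.Im (formal_S o s th tau y) = 0.
Proof.
move=> rs; have Zr (a : R) z : complex.Im z = 0 -> complex.Im (a%:C * z) = 0.
  by move=> z0; rewrite cImM /= z0 mulr0 mul0r addr0.
have Er : complex.Im (log_eval (euler al s) th tau y) = 0.
  apply: log_eval_real; elim: s rs => //= t s IH [rt rs']; split; last split.
  - by move=> th' y'; exact: Zr.
  - by move=> th' y'; exact: Zr.
  - exact: IH.
rewrite /formal_S !cImD cImN Er Zr ?log_eval_real// cIm_sum big1.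
  by rewrite Zr// oppr0 !addr0.
by move=> i _; rewrite Zr// cImM !log_eval_real ?mulr0 ?mul0r ?addr0//; exact: real_grad.
Qed.

Section variation.
Variables (o s l : seq (@log_term R d)).

Lemma formal_L_o th tau y : formal_L (o ++ l) s th tau y =
  formal_L o s th tau y + log_eval (euler al l) th tau y +
  \sum_(i < d) (tau%:C * (log_eval (grad_terms i s) th tau y * log_eval (grad_terms i l) th tau y) +
    (0 +i* (tau `^ (gam + 1) / 2)) * (log_eval (grad_terms i (grad_terms i l)) th tau y +
       (log_eval (grad_L i o) th tau y + log_eval (grad_L i o) th tau y + log_eval (grad_terms i l) th tau y)
         * log_eval (grad_terms i l) th tau y)).
Proof.
rewrite /formal_L euler_cat log_eval_cat -!addrA; congr (_ + _).
rewrite [RHS]addrCA; congr (_ + _); rewrite -big_split; apply: eq_bigr => i _; cbv beta.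
rewrite (_ : grad_L i (o ++ l) = grad_L i o ++ grad_terms i l); last first.
  by rewrite /grad_L grad_cat.
by rewrite (grad_cat i (grad_L i o)) !log_eval_cat; rewrite -[RHS]/(_ + _); ring.
Qed.

Lemma formal_L_s th tau y : formal_L o (s ++ l) th tau y = formal_L o s th tau y +
  \sum_(i < d) (tau%:C * (log_eval (grad_terms i l) th tau y * log_eval (grad_L i o) th tau y) +
    (tau / 2)%:C * log_eval (grad_terms i (grad_terms i l)) th tau y).
Proof.
rewrite /formal_L -!addrA; congr (_ + _).
rewrite -big_split; apply: eq_bigr => i _ /=.
by rewrite !grad_cat !log_eval_cat; ring.
Qed.

Lemma formal_S_o th tau y : formal_S (o ++ l) s th tau y = formal_S o s th tau y +
  density th y * (expR (p * complex.Re (log_eval o th tau y)))%:C *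
    (expR (p * complex.Re (log_eval l th tau y)) - 1)%:C.
Proof.
rewrite /formal_S log_eval_cat cReD mulrDr expRD realCM realCB; ring.
Qed.

Lemma formal_S_s th tau y : formal_S o (s ++ l) th tau y = formal_S o s th tau y +
  (log_eval (euler al l) th tau y - (1 - al)%:C * log_eval l th tau y) +
  \sum_(i < d) (tau / 2)%:C *
    ((log_eval (grad_terms i s) th tau y + log_eval (grad_terms i s) th tau y +
      log_eval (grad_terms i l) th tau y) * log_eval (grad_terms i l) th tau y).
Proof.
rewrite /formal_S euler_cat !log_eval_cat.
rewrite [X in _ + X + _ = _](_ : _ = \sum_(i < d) (tau / 2)%:C *
   (log_eval (grad_terms i s) th tau y * log_eval (grad_terms i s) th tau y) + \sum_(i < d) (tau / 2)%:C *
    ((log_eval (grad_terms i s) th tau y + log_eval (grad_terms i s) th tau y +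
      log_eval (grad_terms i l) th tau y) * log_eval (grad_terms i l) th tau y)).
  by ring.
by rewrite -big_split; apply: eq_bigr => i _ /=; rewrite grad_cat log_eval_cat; ring.
Qed.

End variation.

Lemma expands_exp_list k l : (0 < k)%N -> tame_list k l ->
  expands k (fun th tau y => (expR (p * complex.Re (log_eval l th tau y)) - 1)%:C).
Proof.
move=> k0 rl; apply: (expands_exp gam0 top0 (r := fun th tau y => p * complex.Re (log_eval l th tau y))) => //.
have h : tame_list k (map_coef (fun c th y => (complex.Re (c th y))%:C) l).
  by apply: forall_map rl => t [e n]; split => //=; exact: tame_Re.
apply: expands_ext (expands_Z p%:C (expands_reg h)) => rho0 Rb th tau _ _ y.
by rewrite log_eval_Re realCM.
Qed.

(** The density is tame while the exponential alone is not. *)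
Lemma expands_density_exp l : tame_list 1 l ->
  expands 0 (fun th tau y => density th y * (expR (p * complex.Re (log_eval l th tau y)))%:C).
Proof.
move=> rl; have QV := expands_coef gam top (@tame_density R d p).
have Qe := expands_le (leq0n 1) (expands_exp_list (ltn0Sn 0) rl).
apply: expands_ext (expands_D (expands_M gam0 QV Qe) QV) => rho0 Rb th tau _ _ y.
by rewrite realCB /density; ring.
Qed.

(** Correcting [L] so as to cancel the terms of its residual changes that
    residual otherwise only by terms with one more power of [tau], but changes the
    residual of [S] through the exponential, at the same count [k].  The latter
    is therefore cancelled second: a correction of [S] changes both residuals,
    besides the cancellation, by terms with one more power of [tau]. *)
Lemma improve_order k o s : (0 < k)%N -> tame_list 1 o -> tame_list 0 s -> real_list s ->
  expands k (formal_L o s) -> expands k (formal_S o s) ->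
  exists o' s', [/\ forall_terms (kept_term p gam top k) o',
    forall_terms (fun t => kept_term p gam top k t /\ real_coef t.2) s',
    expands k.+1 (formal_L (o ++ o') (s ++ s')) & expands k.+1 (formal_S (o ++ o') (s ++ s'))].
Proof.
move=> k0 ro rs real_s QL QS.
have good_reg l : forall_terms (kept_term p gam top k) l -> tame_list k l.
  by apply: forall_sub => t [[e _] n].
have regS i : tame_list 0 (grad_terms i s) by exact: tame_list_grad.
have regL o1 i : tame_list 1 o1 -> tame_list 0 (grad_L i o1).
  by move=> r1; apply/tame_list_grad_L/(tame_list_le (leq0n 1)).
have [l gl hl] := expands_list QL.
have [ o' go' ho'] : exists2 o', forall_terms (kept_term p gam top k) o' &
    forall th tau y, log_eval (euler al o') th tau y = - log_eval l th tau y.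
  have gl' : forall_terms (kept_term p gam top k) (map_coef (fun c th y => (-1) * c th y) l).
    by apply: forall_map gl => t [e n]; split => //; exact: tameZ.
  have CZ (x : R) (c : coef) : tame p c -> tame p (fun th y => x%:C * c th y) by exact: tameZ.
  have [ o' go' ho'] := solve_euler (E := fun q => exponent_ge gam k q /\ q < top%:R) al_gt0 0 CZ gl'.
  exists o' => // th tau y; move: (ho' th tau y).
  by rewrite mul0r subr0 log_eval_scale mulN1r.
have ro' := good_reg _ go'.
have ro1 : tame_list 1 (o ++ o').
  by apply: forall_cat => //; exact: tame_list_le ro'.
have QL1 : expands k.+1 (formal_L (o ++ o') s).
  have QG := expands_O gam k.+1 hl.
  pose D (i : 'I_d) th tau y := tau%:C *
     (log_eval (grad_terms i s) th tau y * log_eval (grad_terms i o') th tau y) +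
    (0 +i* (tau `^ (gam + 1) / 2)) * (log_eval (grad_terms i (grad_terms i o')) th tau y +
       (log_eval (grad_L i o) th tau y + log_eval (grad_L i o) th tau y +
        log_eval (grad_terms i o') th tau y) * log_eval (grad_terms i o') th tau y).
  have QD i : expands k.+1 (D i).
    have Qi := expands_reg (tame_list_grad i ro').
    apply: expands_D; first exact: (expands_tau (expands_M gam0 (expands_reg (regS i)) Qi)).
    apply: expands_dispersive; apply: expands_D; first exact: (expands_reg (tame_list_grad i (tame_list_grad i ro'))).
    apply: (expands_M (k := 0) gam0 _ Qi); apply: expands_D; last exact: (expands_le (leq0n k) Qi).
    by apply: expands_D; exact: (expands_reg (regL o i ro)).
  apply: expands_ext (expands_D QG (expands_sum (index_enum 'I_d) QD)) => rho0 Rb th tau _ _ y.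
  by rewrite formal_L_o ho'.
have QS1 : expands k (formal_S (o ++ o') s).
  apply: expands_ext (expands_D QS (expands_M (k := 0) gam0 (expands_density_exp ro) (expands_exp_list k0 ro'))).
  by move=> rho0 Rb th tau _ _ y; rewrite formal_S_o.
have [m gm hm] := expands_list QS1.
have [s' gs' hs'] : exists2 s', forall_terms (fun t => kept_term p gam top k t /\ real_coef t.2) s' &
    forall th tau y, log_eval (euler al s') th tau y - (1 - al)%:C * log_eval s' th tau y =
      - (complex.Re (log_eval m th tau y))%:C.
  have CZ (x : R) (c : coef) : tame p c /\ real_coef c ->
      tame p (fun th y => x%:C * c th y) /\ real_coef (fun th y => x%:C * c th y).
    move=> [n r]; split; first exact: tameZ.
    by move=> th y; rewrite cImM /= r mulr0 mul0r addr0.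
  have gm' : forall_terms (fun t => (exponent_ge gam k t.1.1 /\ t.1.1 < top%:R) /\
      (tame p t.2 /\ real_coef t.2))
      (map_coef (fun c th y => (-1) * c th y)
       (map_coef (fun c th y => (complex.Re (c th y))%:C) m)).
    rewrite /map_coef -map_comp; apply: forall_map gm => t [e n] /=; split=> //; split.
      by apply: tameZ; exact: tame_Re.
    by move=> th y; rewrite mulN1r -realCN.
  have [s' gs' hs'] := solve_euler (E := fun q => exponent_ge gam k q /\ q < top%:R) al_gt0 (1 - al) CZ gm'.
  exists s'; first by apply: forall_sub gs' => t [e [n r]]; split.
  by move=> th tau y; rewrite hs' log_eval_scale log_eval_Re mulN1r.
have rs' : tame_list k s' by apply: forall_sub gs' => t [[[e _] n] _].
exists o', s'; split => //.
- pose D (i : 'I_d) th tau y :=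
    tau%:C * (log_eval (grad_terms i s') th tau y * log_eval (grad_L i (o ++ o')) th tau y) +
    (tau / 2)%:C * log_eval (grad_terms i (grad_terms i s')) th tau y.
  have QD i : expands k.+1 (D i).
    have Qi := expands_reg (tame_list_grad i rs').
    apply: expands_D.
      apply: expands_tau; rewrite -(addn0 k); apply: (expands_M gam0 Qi).
      exact: (expands_reg (regL _ i ro1)).
    exact: (expands_half_tau (expands_reg (tame_list_grad i (tame_list_grad i rs')))).
  apply: expands_ext (expands_D QL1 (expands_sum (index_enum 'I_d) QD)) => rho0 Rb th tau _ _ y.
  by rewrite formal_L_s.
- pose D (i : 'I_d) th tau y := (tau / 2)%:C *
    ((log_eval (grad_terms i s) th tau y + log_eval (grad_terms i s) th tau y +
      log_eval (grad_terms i s') th tau y) * log_eval (grad_terms i s') th tau y).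
  have QD i : expands k.+1 (D i).
    have Qi := expands_reg (tame_list_grad i rs').
    apply: expands_half_tau; apply: (expands_M (k := 0) gam0 _ Qi).
    apply: expands_D; last exact: (expands_le (leq0n k) Qi).
    by apply: expands_D; exact: (expands_reg (regS i)).
  have QG := expands_O gam k.+1 (tauO_Re hm).
  apply: expands_ext (expands_D QG (expands_sum (index_enum 'I_d) QD)) => rho0 Rb th tau _ _ y.
  rewrite formal_S_s hs' cReD cReN realCD realCN; congr (_ - _ + _).
  by apply: complex_ext => //=; rewrite formal_S_real.
Qed.

Lemma S_lead_tame : tame_list 0 S_lead /\ real_list S_lead.
Proof.
split.
  split; first by split; [exact: (exponent_ge_nat gam 0)|apply: tameZ; exact: tame_density].
  by split=> //; split; [exact: exponent_ge_gam|exact: tame_potential].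
split; last by split.
by move=> th y; rewrite cImM /= mulr0 mul0r addr0.
Qed.

(** The leading profile solves the transport equation without its quadratic
    term, because [al * gam = 1 - al]. *)
Lemma S_lead_solves th tau y : log_eval (euler al S_lead) th tau y -
  (1 - al)%:C * log_eval S_lead th tau y + density th y = 0.
Proof.
have ag : al * gam = 1 - al by rewrite mulrC divfK// lt0r_neq0.
rewrite /euler /= !log_eval_cons log_eval_nil /log_monomial /= ag !mulr0 !mul0r !mulr0.
rewrite powRr0 expr0 !mulr1 mul1r !add0r !addr0.
have e : (1 - al)%:C * (((1 - al)^-1)%:C * density th y) = density th y.
  by rewrite mulrA -realCM divff// mul1r.
by rewrite mulrDr e; ring.
Qed.

Lemma profile_expansion k : exists o s, [/\ forall_terms (kept_term p gam top 1) o,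
    forall_terms (fun t => kept_term p gam top 1 t /\ real_coef t.2) s,
    expands k.+1 (formal_L o (S_lead ++ s)) & expands k.+1 (formal_S o (S_lead ++ s))].
Proof.
have [rS realS] := S_lead_tame.
elim: k => [|k [ o [s [go gs QL QS]]]].
  exists [::], [::]; split => //; rewrite cats0.
  - have QD i : expands 1 (fun th (tau : R) y =>
       tau%:C * (log_eval (grad_terms i S_lead) th tau y * log_eval (grad_L i [::]) th tau y) +
       (tau / 2)%:C * log_eval (grad_terms i (grad_terms i S_lead)) th tau y +
       (0 +i* (tau `^ (gam + 1) / 2)) * (log_eval (grad_terms i (grad_L i [::])) th tau y +
       log_eval (grad_L i [::]) th tau y * log_eval (grad_L i [::]) th tau y)).
      have QS := expands_reg (tame_list_grad i rS).
      have rL : tame_list 0 (grad_L i [::]) by exact: tame_list_grad_L.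
      have QL := expands_reg rL.
      apply: expands_D; last first.
        apply: expands_dispersive; apply: expands_D; last exact: (expands_M gam0 QL QL).
        exact: (expands_reg (tame_list_grad i rL)).
      apply: expands_D; first exact: (expands_tau (expands_M gam0 QS QL)).
      exact: (expands_half_tau (expands_reg (tame_list_grad i (tame_list_grad i rS)))).
    apply: expands_ext (expands_sum (index_enum 'I_d) QD) => rho0 Rb th tau _ _ y.
    by rewrite /formal_L /euler /= log_eval_nil add0r.
  - have QD i : expands 1 (fun th (tau : R) y => (tau / 2)%:C *
        (log_eval (grad_terms i S_lead) th tau y * log_eval (grad_terms i S_lead) th tau y)).
      by apply: expands_half_tau; apply: (expands_M (k := 0) (l := 0) gam0); exact: (expands_reg (tame_list_grad i rS)).
    apply: expands_ext (expands_sum (index_enum 'I_d) QD) => rho0 Rb th tau _ _ y.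
    by rewrite /formal_S log_eval_nil mulr0 expR0 mulr1 addrAC S_lead_solves add0r.
have up k' t : (0 < k')%N -> kept_term p gam top k' t -> kept_term p gam top 1 t.
  by move=> k0 [[e l] n]; split => //; split=> //; exact: exponent_ge_le e.
have ro : tame_list 1 o by apply: forall_sub go => t [[e _] n].
have rs : tame_list 0 (S_lead ++ s).
  by apply: forall_cat => //; apply: forall_sub gs => t [[[e _] n] _]; split=> //; exact: exponent_ge_le e.
have reals : real_list (S_lead ++ s).
  by apply: forall_cat => //; apply: forall_sub gs => t [].
have [ o' [s' [go' gs' QL' QS']]] := improve_order (ltn0Sn k) ro rs reals QL QS.
exists (o ++ o'), (s ++ s'); rewrite catA; split => //.
  by apply: forall_cat => //; apply: forall_sub go' => t; exact: up.
by apply: forall_cat => //; apply: forall_sub gs' => t [g r]; split=> //; exact: up g.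
Qed.

Lemma tame_csmooth rho0 Rb th c : 0 < rho0 -> data_bounds p rho0 Rb th -> tame p c -> csmooth (c th).
Proof.
move=> r0 v n; have r2 : 0 < rho0 / 2 by rewrite divr_gt0.
have r21 : rho0 / 2 < rho0 by rewrite ltr_pdivrMr// ltr_pMr// ltr1n.
by have [K h] := n _ _ Rb r2 r21; exact: (wiener_csmooth (ltW r2) (h _ v)).
Qed.

Lemma smooth_grad th i l : smooth_on th l -> smooth_on th (grad_terms i l).
Proof. by apply: forall_map => t h; exact: csmooth_partial. Qed.

Lemma partial_S th i tau s : smooth_on th s ->
  partial i (log_eval s th tau) = log_eval (grad_terms i s) th tau.
Proof. exact: log_eval_partial. Qed.

Lemma partial_L th i tau o : csmooth th.1 -> smooth_on th o ->
  partial i (fun y => th.1 y + log_eval o th tau y) = log_eval (grad_L i o) th tau.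
Proof.
move=> sP so; rewrite partialD; [|exact: csmooth_cderivable|exact: log_eval_cderivable].
rewrite log_eval_partial//; apply/funext => y.
by rewrite /grad_L log_eval_cons /log_monomial /= powRr0 expr0 mulr1 mul1r.
Qed.

(** This is where the analytic derivatives of the residual meet the formal
    ones: coefficients are smooth and [tau] is positive. *)
Lemma residual_L_formal th o s tau y : csmooth th.1 -> smooth_on th o -> smooth_on th s ->
  0 < tau -> residual_L p (profile_L th.1 (log_eval o th)) (log_eval s th) tau y =
  formal_L o s th tau y.
Proof.
move=> sP so ss t0; rewrite /residual_L /formal_L /laplacian /grad_dot.
have [dE eE] := log_eval_euler al o th y t0.
have -> : dtau (profile_L th.1 (log_eval o th)) tau y = dtau (log_eval o th) tau y.
  have h := is_cderiveD (is_cderive_cst (1 : R) (th.1 y) tau) (is_cderiveP dE).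
  by rewrite /dtau /profile_L (is_cderive_val h).2 add0r.
rewrite eE -!addrA; congr (_ + _).
have sL i : smooth_on th (grad_L i o).
  by split; [exact: csmooth_partial|exact: smooth_grad].
rewrite -big_split !mulr_sumr -!big_split /=; apply: eq_bigr => i _.
rewrite /profile_L !partial_L// !partial_S//; last exact: smooth_grad.
by rewrite -[RHS]addrA.
Qed.

Lemma residual_S_formal th o s tau y : smooth_on th s ->
  0 < tau -> residual_S p (profile_L th.1 (log_eval o th)) (log_eval s th) tau y =
  formal_S o s th tau y.
Proof.
move=> ss t0; rewrite /residual_S /formal_S /grad_dot.
have [_ ->] := log_eval_euler al s th y t0.
congr (_ + _ + _).
  by rewrite mulr_sumr; apply: eq_bigr => i _; rewrite partial_S.
by rewrite /profile_L /density cReD mulrDr expRD realCM.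
Qed.

Lemma profile_S_eval th s tau y :
  profile_S p th.1 th.2 (log_eval s th) tau y = log_eval (S_lead ++ s) th tau y.
Proof.
rewrite /profile_S log_eval_cat /S_lead !log_eval_cons log_eval_nil /log_monomial /= powRr0 !expr0.
by rewrite !mulr1 mul1r addr0 -!realCM [th.2 y * _]mulrC.
Qed.

End fuchsian_residuals.

(** * The profile and its bounds *)

Section coefficients_of_lists.
Context {R : realType} {d : nat}.
Implicit Types (l : seq (@log_term R d)) (th : @profile_data R d).

(** A list may contain a pair of exponents several times, hence the sum. *)
Definition coefficient l th (q : R) (j : nat) (y : 'rV[R]_d) : R[i] :=
  \sum_(t <- l) (if (t.1.1 == q) && (t.1.2 == j) then t.2 th y else 0).

Lemma log_degree_bound l : exists J, forall_terms (fun t => (t.1.2 <= J)%N) l.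
Proof.
elim: l => [|t l [J hJ]]; first by exists 0%N.
exists (maxn t.1.2 J); split; first exact: leq_maxl.
by apply: forall_sub hJ => u uJ; exact: leq_trans uJ (leq_maxr _ _).
Qed.

(** The degree bound [J] is common to all exponents, so terms are only regrouped. *)
Lemma log_power_sum_eval (E : set R) J l th tau y : finite_set E ->
  forall_terms (fun t => E t.1.1) l -> forall_terms (fun t => (t.1.2 <= J)%N) l ->
  log_power_sum E (fun=> J) (coefficient l th) tau y = log_eval l th tau y.
Proof.
move=> finE; rewrite /log_power_sum fsbig_finite//=.
set e := finmap.enum_fset _.
elim: l => [_ _|t l IH [Et /IH{}IH] [tJ /IH{}IH]].
  rewrite log_eval_nil big1// => q _; rewrite big1 ?mulr0// => j _.
  by rewrite /coefficient big_nil mul0r.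
rewrite log_eval_cons -IH.
have -> : log_monomial t.1.1 t.1.2 t.2 th tau y = \sum_(q <- e) (tau `^ q)%:C * (\sum_(j < J.+1)
      (if (t.1.1 == q) && (t.1.2 == j) then t.2 th y else 0) * (ln tau ^+ j)%:C).
  have te : t.1.1 \in e by rewrite /e in_fset_set// inE.
  rewrite (bigD1_seq t.1.1) ?finmap.fset_uniq//= eqxx [X in _ = _ + X]big1 ?addr0; last first.
    move=> q qt; rewrite big1 ?mulr0// => j _.
    by rewrite eq_sym (negbTE qt) mul0r.
  have tJ' : (t.1.2 < J.+1)%N by rewrite ltnS.
  rewrite (bigD1 (Ordinal tJ')) //= eqxx big1 ?addr0; last first.
    move=> j jt; case: eqP => [E'|]; last by rewrite mul0r.
    by case/eqP: jt; apply: val_inj.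
  by rewrite /log_monomial realCM; ring.
rewrite -big_split; apply: eq_bigr => q _ /=; rewrite -mulrDr -big_split.
congr (_ * _); apply: eq_bigr => j _ /=.
by rewrite /coefficient big_cons mulrDl.
Qed.

Lemma tame_coefficient p l q j : forall_terms (fun t => tame p t.2) l ->
  tame p (fun th => coefficient l th q j).
Proof.
have n0 : @tame R d p (fun _ _ => 0).
  by move=> rho1 rho0 Rb _ _; exists (fun=> 0) => th _; exact: wiener0.
elim: l => [_|t l IH [n /IH h]].
  rewrite (_ : (fun th => _) = fun _ _ => 0)//.
  by apply/funext => th; apply/funext => y; rewrite /coefficient big_nil.
rewrite (_ : (fun th => _) = fun th y =>
    (if (t.1.1 == q) && (t.1.2 == j) then t.2 th y else 0) + coefficient l th q j y).
  by apply: tameD h; case: ((t.1.1 == q) && (t.1.2 == j)).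
by apply/funext => th; apply/funext => y; rewrite /coefficient big_cons.
Qed.

End coefficients_of_lists.

Section final_bounds.
Context {R : realType} {d : nat}.
Variable p : R.

(** The two norms of a bound of the theorem are treated together; the power of
    the logarithm is available before the radii are known. *)
Lemma tauO_A_norm s (F G : @profile_data R d -> R -> 'rV[R]_d -> R[i]) :
  tauO p s F -> tauO p s G ->
  exists N : nat, forall rho1 rho0 Rb : R, 0 < rho1 -> rho1 < rho0 ->
  exists K : nat -> R, forall th tau n, data_bounds p rho0 Rb th -> 0 < tau <= 1 ->
    (A_norm rho1 n%:R (F th tau) + A_norm rho1 n%:R (G th tau)
      <= (K n * (tau ^+ s * log_weight tau ^+ N))%:E)%E.
Proof.
move=> [N1 h1] [N2 h2]; exists (N1 + N2)%N => rho1 rho0 Rb r1 r10.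
have [K1 {}h1] := h1 _ _ Rb r1 r10; have [K2 {}h2] := h2 _ _ Rb r1 r10.
exists (fun n => c2pi d * K1 n + c2pi d * K2 n) => th tau n v t.
have w1 := h1 _ _ v t; have w2 := h2 _ _ v t.
have b1 := wiener_A_norm n (ltW r1) w1; have b2 := wiener_A_norm n (ltW r1) w2.
apply: (le_trans (leeD b1 b2)); rewrite -EFinD lee_fin mulrDl -!mulrA.
have c0 := ltW (@c2pi_gt0 R d).
apply: lerD; apply: ler_wpM2l => //; apply: tauO_weaken; rewrite ?leq_addr ?leq_addl//.
  exact: (wiener_ge0 w1 n).
exact: (wiener_ge0 w2 n).
Qed.

(** Since [gam >= 1], both integers are smaller than [mu]. *)
Lemma finite_exponents (gam : R) (mu : nat) : 1 <= gam -> finite_set (exponents gam mu).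
Proof.
move=> g1; have fin := finite_setX (finite_II mu) (finite_II mu).
apply: sub_finite_set (finite_image (fun z : nat * nat => z.1%:R + z.2%:R * gam) fin).
move=> q [[l1 [l2 [_ ->]]] /andP[_ qmu]]; exists (l1, l2) => //.
have h1 : (l1%:R : R) < mu%:R.
  by apply: le_lt_trans qmu; rewrite lerDl mulr_ge0// (le_trans _ g1).
have h2 : (l2%:R : R) < mu%:R.
  apply: le_lt_trans qmu; rewrite (@le_trans _ _ (l2%:R * gam))//.
    by rewrite -[leLHS]mulr1 ler_wpM2l.
  by rewrite lerDr.
by split; rewrite /= -(ltr_nat R).
Qed.

Lemma admissible_data_bounds rho0 Rb eps (Psi : 'rV[R]_d -> R[i]) (Cplus : 'rV[R]_d -> R) :
  eps <= 1 -> admissible p rho0 Rb eps Psi -> continuous Cplus ->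
  (A_norm rho0 6 (fun y => (Cplus y)%:C) <= eps%:E)%E -> data_bounds p rho0 Rb (Psi, Cplus).
Proof.
move=> e1 [sP bP bW] cC bC; have eE : (eps%:E <= 1%:E)%E by rewrite lee_fin.
split => //=; last exact: le_trans bC eE.
- move=> i; apply: le_trans bP; rewrite (bigD1 i)//= leeDl// sume_ge0// => j _.
  exact: A_norm_ge0.
- apply: (le_trans _ eE); apply: le_trans bW; rewrite leeDr// adde_ge0 ?A_norm_ge0//.
  exact: Lnorm_ge0.
Qed.

End final_bounds.

Theorem proposition4p7 (R : realType) (d : nat) (p : R) (mu : nat)
    (d_ge1 : (1 <= d)%N) (p_bounds : 0 < p <= 1 / d%:R)
    (mu_gt : 2 * gamma_exp d p < mu%:R) :
  exists M N : nat,
  forall rhos rho1 rho0 Rb : R,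
    0 < rhos -> rhos < rho1 -> rho1 < rho0 -> 0 < Rb ->
  exists K : R,
  forall kappa : R,
    1 - alpha_exp d p < kappa -> kappa < alpha_exp d p * (mu%:R + 1) - 1 ->
  exists eps0 : R, 0 < eps0 <= 1 /\
  forall (eps : R) (Psi : 'rV[R]_d -> R[i]) (Cplus : 'rV[R]_d -> R),
    0 < eps <= eps0 ->
    admissible p rho0 Rb eps Psi ->
    continuous Cplus ->
    (A_norm rho0 6 (fun y => (Cplus y)%:C) <= eps%:E)%E ->
  exists (JO JS : R -> nat) (Om Sg : R -> nat -> 'rV[R]_d -> R[i]),
    let E := exponents (gamma_exp d p) mu in
    let Omega := log_power_sum E JO Om in
    let Sigma := log_power_sum E JS Sg in
    let L := profile_L Psi Omega in
    let S := profile_S p Psi Cplus Sigma in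
    [/\ (forall q, E q ->
           (forall j, (j <= JO q)%N -> csmooth (Om q j)) /\
           (forall j, (j <= JS q)%N -> csmooth (Sg q j))),
        (forall tau, 0 < tau <= 1 ->
           (A_norm rho1 6 (Omega tau) + A_norm rho1 6 (Sigma tau)
             <= (K * (tau * (1 + `|ln tau|) ^+ M))%:E)%E),
        (forall tau, 0 < tau <= 1 ->
           (A_norm rho1 8 (residual_S p L S tau) +
            A_norm rho1 8 (residual_L p L S tau)
             <= (K * (tau ^+ mu * (1 + `|ln tau|) ^+ N))%:E)%E) &
        (forall tau y, 0 < tau -> complex.Im (S tau y) = 0)].
Proof.
have d0 : 0 < (d%:R : R) by rewrite ltr0n.
have [p0 pd] := andP p_bounds.
have al0 : 0 < alpha_exp d p by rewrite divr_gt0// mulr_gt0.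
have al1 : alpha_exp d p <= 1 / 2.
  rewrite /alpha_exp ler_pM2r ?invr_gt0//.
  by rewrite mulrC -ler_pdivlMr.
have g1 : 1 <= gamma_exp d p by rewrite /gamma_exp ler_pdivlMr// mul1r; lra.
have g0 := le_trans ler01 g1.
have al_neq1 : 1 - alpha_exp d p != 0 by apply: lt0r_neq0; lra.
have mu0 : (0 < mu)%N.
  by rewrite -(ltr_nat R); apply: le_lt_trans mu_gt; rewrite mulr_ge0.
have [ o [s [go gs QL QS]]] := @profile_expansion R d p mu al0 g0 mu0 al_neq1 mu.
have OL := expands_tauO g0 (leqnSn mu) (leqnn mu) QL.
have OS := expands_tauO g0 (leqnSn mu) (leqnn mu) QS.
have ro : tame_list p 1 o by apply: forall_sub go => t [[e _] n].
have rs : tame_list p 1 s by apply: forall_sub gs => t [[[e _] n] _].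
have [M hM] := tauO_A_norm (expands_tauO g0 (leqnn 1) mu0 (expands_reg mu ro))
  (expands_tauO g0 (leqnn 1) mu0 (expands_reg mu rs)).
have [N hN] := tauO_A_norm OS OL.
exists M, N => rhos rho1 rho0 Rb rs0 rs1 r10 Rb0.
have r1 : 0 < rho1 := lt_trans rs0 rs1.
have [KM {}hM] := hM _ _ Rb r1 r10; have [KN {}hN] := hN _ _ Rb r1 r10.
(* Admissibility enters through bounds of the data by one. *)
exists (Num.max (KM 6%N) (KN 8%N)) => kappa _ _; exists 1; split; first by rewrite ltr01 lexx.
move=> eps Psi Cplus /andP[_ e1] adm cC bC.
have v := admissible_data_bounds e1 adm cC bC; set th := (Psi, Cplus) in v.
have [[JO hJO] [JS hJS]] := (log_degree_bound o, log_degree_bound s).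
have finE := finite_exponents mu g1.
have inE k (t : @log_term R d) : (0 < k)%N -> kept_term p (gamma_exp d p) mu k t -> exponents (gamma_exp d p) mu t.1.1.
  move=> k0 [[e lt] _]; have q0 := exponent_lower_bound g0 e; split.
    by have [l1 [l2 [kl ->]]] := e; exists l1, l2; split=> //; rewrite ltn_addr// (leq_trans k0).
  by rewrite lt andbT (lt_le_trans _ q0)// ltr0n.
have EO tau : log_power_sum (exponents (gamma_exp d p) mu) (fun=> JO) (coefficient o th) tau =
    log_eval o th tau.
  apply/funext => y; apply: log_power_sum_eval => //.
  by apply: forall_sub go => t; exact: inE.
have ES tau : log_power_sum (exponents (gamma_exp d p) mu) (fun=> JS) (coefficient s th) tau =
    log_eval s th tau.
  apply/funext => y; apply: log_power_sum_eval => //.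
  by apply: forall_sub gs => t [g _]; exact: (inE 1%N _ isT g).
have rho00 : 0 < rho0 := lt_trans r1 r10.
have sm (l : seq (@log_term R d)) : forall_terms (fun t => tame p t.2) l -> smooth_on th l.
  by apply: forall_sub => t n; exact: tame_csmooth v n.
have so : smooth_on th o by apply: sm; apply: forall_sub go => t [].
have ss : smooth_on th s by apply: sm; apply: forall_sub gs => t [[]].
have [rS realS] := @S_lead_tame R d p.
have sS : smooth_on th (S_lead p ++ s).
  apply: forall_cat => //; apply: (sm (S_lead p)).
  by apply: forall_sub rS => t [].
have sc (l : seq (@log_term R d)) q j : forall_terms (fun t => tame p t.2) l -> csmooth (coefficient l th q j).
  by move=> nl; exact: (tame_csmooth rho00 v (tame_coefficient q j nl)).
exists (fun=> JO), (fun=> JS), (coefficient o th), (coefficient s th) => E Omega Sigma L S.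
have -> : Omega = log_eval o th by apply/funext => tau; exact: EO.
have EL : L = profile_L th.1 (log_eval o th).
  by rewrite /L (_ : Omega = log_eval o th)//; apply/funext => tau; exact: EO.
have ESg : Sigma = log_eval s th by apply/funext => tau; exact: ES.
have ESS : S = log_eval (S_lead p ++ s) th.
  by apply/funext => tau; apply/funext => y; rewrite -profile_S_eval /S ESg.
have [sP _ _ _ _] := v.
split.
- move=> q _; split => j _; apply: sc; first by apply: forall_sub go => t [].
  by apply: forall_sub gs => t [[]].
- move=> tau t; rewrite ESg; apply: (le_trans (hM _ _ 6%N v t)); rewrite lee_fin expr1.
  apply: ler_wpM2r; last by rewrite le_max lexx.
  by case/andP: t => t0 _; rewrite mulr_ge0 ?(ltW t0)// exprn_ge0// log_weight_ge0.
- move=> tau t; have t0 : 0 < tau by case/andP: t.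
  rewrite EL ESS (_ : residual_S _ _ _ _ = formal_S p o (S_lead p ++ s) th tau); last first.
    by apply/funext => y; exact: residual_S_formal.
  rewrite (_ : residual_L _ _ _ _ = formal_L p o (S_lead p ++ s) th tau); last first.
    by apply/funext => y; exact: residual_L_formal.
  apply: (le_trans (hN _ _ 8%N v t)); rewrite lee_fin.
  apply: ler_wpM2r; last by rewrite le_max lexx orbT.
  by rewrite mulr_ge0 ?exprn_ge0 ?(ltW t0)// log_weight_ge0.
- move=> tau y _; rewrite ESS; apply: log_eval_real.
  by apply: forall_cat => //; apply: forall_sub gs => t [].
Qed.
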